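(* Let $M$ be a compact smooth manifold with boundary of dimension $n$, and let $g$ be an $\alpha$-gas giant metric on $M$, $\alpha\in(0,2)$, with Riemannian distance $d_g$ extended to $M\times M$. The Hausdorff dimension of $(\partial M,d_g)$ equals $\frac{2}{2-\alpha}(n-1)$. The Hausdorff dimension of $(M,d_g)$ equals $\max\{n,\frac{2}{2-\alpha}(n-1)\}$.
   Context: For $\alpha\in(0,2)$, an $\alpha$-gas giant metric on a compact manifold with boundary $M$ is a Riemannian metric $g$ on the interior $M^\circ$ of the form $g=x^{-\alpha}\overline g$, where $x$ is a boundary defining function ($x$ smooth, $x>0$ on $M^\circ$, $x=0$ and $dx\neq0$ on $\partial M$) and $\overline g$ is a Riemannian metric smooth and non-degenerate up to $\partial M$. The boundary is at finite distance and $d_g$ denotes the Riemannian distance of $g$ extended continuously to $M$; on $\partial M$ it is the restriction of this interior distance. *)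

(* Defs.v *)
From HB Require Import structures.
From mathcomp Require Import all_boot all_order all_algebra.
From mathcomp Require Import all_classical all_reals all_analysis.

Set Implicit Arguments.
Unset Strict Implicit.
Unset Printing Implicit Defensive.

Import Order.TTheory GRing.Theory Num.Theory.
Import numFieldNormedType.Exports.

Local Open Scope classical_set_scope.
Local Open Scope ring_scope.

Section smoothness.
Context {R : realType} {V W : normedModType R}.
Implicit Types (U A : set V) (f F : V -> W) (y : V).

(* Used only for finite-dimensional [V], where quantifying over all directions
   is the same as quantifying over the coordinate directions. *)
Fixpoint Ck (k : nat) U f : Prop :=
  (forall y, U y -> {for y, continuous f}) /\
  (if k is k'.+1 then
     forall v : V, (forall y, U y -> derivable f y v) /\ Ck k' U (fun y => 'D_v f y)
   else True).

Definition smooth_open U f := forall k, Ck k U f.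

Definition smooth_extension A f y F :=
  exists U, [/\ open U, U y, smooth_open U F &
    forall z, U z -> A z -> F z = f z].

(* Smoothness on a set that need not be open, e.g. a relatively open subset of
   a half-space or a closed interval. *)
Definition smooth_on A f := forall y, A y -> exists F, smooth_extension A f y F.

(* Differential at [y], a point of [A], of a map that is smooth on [A].  When
   [A] is relatively open in a half-space the result does not depend on the
   chosen extension, also if [y] lies on the bounding hyperplane. *)
Definition diff_on A f y : V -> W :=
  'd (xget f [set F | smooth_extension A f y F]) y.

End smoothness.

Section manifolds.
Context {R : realType} (n : nat) (M : topologicalType).

(* The first coordinate is nonnegative; for [n = 0] this is a point, and it has
   no boundary. *)
Definition halfspace : set 'rV[R]_n :=
  [set y | forall i : 'I_n, i = 0%N :> nat -> 0 <= y 0 i].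

Definition halfspace_boundary : set 'rV[R]_n :=
  [set y | exists2 i : 'I_n, i = 0%N :> nat & y 0 i = 0].

(* [cmap] matters only on [cdom], and [cinv] only on [cmap @` cdom]. *)
Record chart := Chart {
  cdom : set M ;
  cmap :> M -> 'rV[R]_n ;
  cinv : 'rV[R]_n -> M }.

Definition is_chart (c : chart) :=
  [/\ open (cdom c),
      exists2 O, open O & c @` cdom c = O `&` halfspace,
      {within cdom c, continuous c},
      {within c @` cdom c, continuous (cinv c)} &
      forall p, cdom c p -> cinv c (c p) = p].

Record smooth_manifold := SmoothManifold {
  mfd_hausdorff : hausdorff_space M ;
  mfd_second_countable : @second_countable M ;
  atlas : set chart ;
  atlas_chart : forall c, atlas c -> is_chart c ;
  atlas_cover : forall p, exists c, atlas c /\ cdom c p ;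
  atlas_smooth : forall c1 c2, atlas c1 -> atlas c2 ->
    smooth_on (c1 @` (cdom c1 `&` cdom c2)) (c2 \o cinv c1) }.

Variable X : smooth_manifold.

Definition boundary : set M :=
  [set p | exists c, [/\ atlas X c, cdom c p & halfspace_boundary (c p)]].

Definition interior_mfd : set M := ~` boundary.

Definition chart_at (p : M) : chart := sval (cid (atlas_cover X p)).

Definition smooth_fun (x : M -> R) :=
  forall c, atlas X c -> smooth_on (c @` cdom c) (x \o cinv c).

Definition boundary_defining (x : M -> R) :=
  [/\ smooth_fun x,
      forall p, interior_mfd p -> 0 < x p,
      forall p, boundary p -> x p = 0 &
      forall p c, boundary p -> atlas X c -> cdom c p ->
        exists v, diff_on (c @` cdom c) (x \o cinv c) (c p) v != 0].

(* [g c p] is the Gram matrix at [p] of the coordinate frame of the chart [c];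
   it matters only for [c] in the atlas and [p] in [cdom c]. *)
Definition tensor := chart -> M -> 'M[R]_n.

Definition form (G : 'M[R]_n) (u v : 'rV[R]_n) : R := (u *m G *m v^T) 0 0.

(* A smooth Riemannian metric on the open subset [D] of the manifold; [D] may
   contain boundary points, up to which the metric is then smooth and
   non-degenerate. *)
Definition riemannian (D : set M) (g : tensor) :=
  [/\ forall c, atlas X c ->
        smooth_on (c @` (cdom c `&` D)) (fun y => g c (cinv c y)),
      forall c p, atlas X c -> cdom c p -> D p -> (g c p)^T = g c p,
      forall c p v, atlas X c -> cdom c p -> D p -> v != 0 ->
        0 < form (g c p) v v &
      forall c1 c2 p u v, atlas X c1 -> atlas X c2 ->
        cdom c1 p -> cdom c2 p -> D p ->
        let dtau := diff_on (c1 @` (cdom c1 `&` cdom c2)) (c2 \o cinv c1) (c1 p) in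
        form (g c1 p) u v = form (g c2 p) (dtau u) (dtau v)].

Definition gas_giant (alpha : R) (g : tensor) :=
  riemannian interior_mfd g /\
  exists x gbar, [/\ boundary_defining x, riemannian [set: M] gbar &
    forall c p, atlas X c -> cdom c p -> interior_mfd p ->
      g c p = (x p `^ (- alpha)) *: gbar c p].

Definition smooth_segment (a b : R) (gamma : R -> M) :=
  forall c, atlas X c ->
    smooth_on (`[a, b]%classic `&` gamma @^-1` cdom c) (c \o gamma).

(* The break points are 0 and the elements of [s], the last of which is 1. *)
Definition piecewise_smooth (gamma : R -> M) :=
  {within `[0, 1], continuous gamma} /\
  exists s : seq R, [/\ path <%R 0 s, last 0 s = 1 &
    forall i, (i < size s)%N -> smooth_segment (nth 0 (0 :: s) i) (nth 0 s i) gamma].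

(* The Riemannian norm of the velocity, computed in some chart around
   [gamma t]; it is meaningful away from the break points. *)
Definition speed (g : tensor) (gamma : R -> M) (t : R) : R :=
  let c := chart_at (gamma t) in
  let v := derive1 (c \o gamma) t in
  Num.sqrt (form (g c (gamma t)) v v).

Definition curve_length (g : tensor) (gamma : R -> M) : \bar R :=
  \int[lebesgue_measure]_(t in `[0, 1]) (speed g gamma t)%:E.

(* Equal to +oo if [p] and [q] are in different components. *)
Definition interior_dist (g : tensor) (p q : M) : \bar R :=
  ereal_inf [set curve_length g gamma | gamma in
    [set gamma | [/\ piecewise_smooth gamma, gamma 0 = p, gamma 1 = q &
      forall t, t \in `[0, 1] -> interior_mfd (gamma t)]]].

(* Extension by continuity from the interior. *)
Definition dist (g : tensor) (p q : M) : \bar R :=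
  lim ((fun z : M * M => interior_dist g z.1 z.2) @
    within (interior_mfd `*` interior_mfd) (nbhs (p, q))).

End manifolds.

Section hausdorff.
Context {R : realType} (T : Type) (d : T -> T -> \bar R).
Local Open Scope ereal_scope.

Definition diam (U : set T) : \bar R :=
  ereal_sup [set d z.1 z.2 | z in U `*` U].

(* With this convention the 0-dimensional measure is the counting measure: the
   empty set contributes 0, a point 0 `^ 0 = 1. *)
Definition diam_pow (s : R) (U : set T) : \bar R :=
  if `[< U = set0 >] then 0 else diam U `^ s.

Definition hausdorff_premeasure (s delta : R) (A : set T) : \bar R :=
  ereal_inf [set \sum_(0 <= i <oo) diam_pow s (U i) | U in
    [set U : nat -> set T | A `<=` \bigcup_i U i /\
      forall i, diam (U i) <= delta%:E]].

Definition hausdorff_measure (s : R) (A : set T) : \bar R :=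
  ereal_sup [set hausdorff_premeasure s delta A | delta in
    [set delta : R | (0 < delta)%R]].

Definition hausdorff_dim (A : set T) : \bar R :=
  ereal_inf [set s%:E | s in
    [set s : R | (0 <= s)%R /\ hausdorff_measure s A = 0]].

End hausdorff.

(* Main.v *)
Require Import Defs.
From HB Require Import structures.
From mathcomp Require Import all_boot all_order all_algebra.
From mathcomp Require Import all_classical all_reals all_analysis.
From mathcomp Require Import measurable_realfun ring lra zify.

Set Implicit Arguments.
Unset Strict Implicit.
Unset Printing Implicit Defensive.

Import Order.TTheory GRing.Theory Num.Theory.
Import numFieldNormedType.Exports.
Local Open Scope classical_set_scope.
Local Open Scope ring_scope.

(* In a chart near a boundary point the metric is comparable to the Euclidean
   metric times [y_0 ^ (- alpha)], where [y_0] is the height over the boundary.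
   Two points at Euclidean distance less than [h] are joined by a curve that
   climbs to height [h] and comes back, of length at most [C h ^ sigma] with
   [sigma = 1 - alpha / 2].  Conversely a curve between two boundary points at
   Euclidean distance [h] stays below height [h] until it leaves a ball of radius
   comparable to [h], so that its length is at least [c h ^ sigma].  Hence the
   boundary is locally bi-Lipschitz to [R ^ (n - 1)] with the Euclidean distance
   raised to the power [sigma], which has dimension [(n - 1) / sigma], while the
   interior is locally bi-Lipschitz to [R ^ n]. *)

(** * Smooth maps and curves *)

(** The dimension depends on the Hausdorff measure only through its vanishing. Upper bounds are
    therefore local, by second countability, and each lower bound can be tested near a single point.
    The distance at the boundary is a limit of distances between interior points. All estimates are
    thus proved for interior points with constants uniform up to the boundary, and survive the
    limit. The lower estimate in a boundary chart requires one of the two points to have height 0: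
    at larger heights the factor [y_0 ^ (- alpha)] may be too small for the power of the distance
    that is claimed. Two obstacles shape the preparations. The speed is computed in a chart that
    changes from point to point, so the transformation laws of velocities and of the metric come
    before any estimate. And a point is a boundary point as soon as one chart says so; that all
    charts agree rests on the differentials of the transition maps. *)

Section calculus.
Context {R : realType}.

Lemma mx_norm_le (m n : nat) (x : 'M[R]_(m, n)) (r : R) :
  0 <= r -> (forall i j, `|x i j| <= r) -> `|x| <= r.
Proof.
move=> r0 h; rewrite /Num.norm/= mx_normrE; by apply: bigmax_le => // -[i j] _; exact: h.
Qed.

Lemma entry_le_norm (m n : nat) (x : 'M[R]_(m, n)) i j : `|x i j| <= `|x|.
Proof.
rewrite {2}/Num.norm/= mx_normrE.
exact: (le_bigmax 0 (fun ij : 'I_m * 'I_n => `|x ij.1 ij.2|) (i, j)).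
Qed.

Lemma near_normP (V : normedModType R) (y : V) (P : set V) :
  (\forall z \near y, P z) <->
  exists2 r : R, 0 < r & forall z, `|y - z| < r -> P z.
Proof. by split=> [/nbhs_normP|?]; last exact/nbhs_normP. Qed.

Lemma near_eq_continuous (V W : normedModType R) (f g : V -> W) (y : V) :
  (\forall z \near y, f z = g z) -> {for y, continuous f} -> {for y, continuous g}.
Proof.
move=> fg; rewrite /prop_for /continuous_at (nbhs_singleton fg); apply: cvg_trans.
by apply: near_eq_cvg; move: fg; apply: filterS => z ->.
Qed.

Section line.
Context {V W : normedModType R}.
Implicit Types (f : V -> W) (a b v x : V).

Lemma is_derive_line f a v (t : R) : derivable f (a + t *: v) v ->
  is_derive t 1 (fun s : R => f (a + s *: v)) ('D_v f (a + t *: v)).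
Proof.
move=> df.
have E : (fun h : R => h^-1 *: (((fun s : R => f (a + s *: v)) \o shift t) (h *: (1 : R)) -
    f (a + t *: v))) = (fun h => h^-1 *: ((f \o shift (a + t *: v)) (h *: v) - f (a + t *: v))).
  apply/funext => h /=; congr (_ *: (f _ - _)).
  by rewrite [h *: _]mulr1 scalerDl addrCA addrA addrC addrA.
split; first by rewrite /derivable E.
by rewrite /derive E.
Qed.

(** Only derivability along [v] is assumed. Homogeneity in the direction comes from the one-variable
    function [g], whose differential at 0 is linear. *)
Lemma is_derive_dirZ f x v (k : R) : derivable f x v ->
  is_derive x (k *: v) f (k *: 'D_v f x).
Proof.
move=> df; pose g s := f (x + s *: v).
have dg : is_derive (0 : R) 1 g ('D_v f x).
  have := @is_derive_line f x v 0; rewrite scale0r addr0; exact.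
have dg' : differentiable g (0 : R) by apply/derivable1_diffP.
have E : (fun h : R => h^-1 *: ((f \o shift x) (h *: (k *: v)) - f x)) =
   (fun h : R => h^-1 *: ((g \o shift 0) (h *: k) - g 0)).
  by apply/funext => h /=; rewrite /g [h *: k]/(h * k) scale0r addr0 addr0 scalerA [x + _]addrC.
have dgk : derivable g 0 k by exact: diff_derivable.
split; first by rewrite /derivable E.
have -> : 'D_(k *: v) f x = 'D_k g 0 by rewrite /derive E.
rewrite deriveE// -[k]mulr1.
have -> : (k * 1 : R) = k *: (1 : R) by [].
by rewrite linearZ/= -deriveE// derive_val [_ *: (1 : R)]mulr1.
Qed.

End line.

Lemma MVT_dir {V : normedModType R} (f : V -> R) (a v : V) :
  (forall t : R, 0 <= t <= 1 -> derivable f (a + t *: v) v) ->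
  exists2 t : R, 0 <= t <= 1 & f (a + v) - f a = 'D_v f (a + t *: v).
Proof.
move=> df; pose g (t : R) : R := f (a + t *: v); pose dg (t : R) : R := 'D_v f (a + t *: v).
have gd (t : R) : 0 <= t <= 1 -> is_derive t 1 g (dg t).
  by move=> t01; apply: is_derive_line; apply: df.
have gc : {within `[0, 1], continuous g}.
  apply: derivable_within_continuous => t; rewrite in_itv/= => t01.
  by have := gd _ t01; case.
have [|c] := @MVT_segment _ g dg 0 1 ler01 _ gc.
  by move=> x; rewrite in_itv/= => /andP[x0 x1]; apply: gd; rewrite !ltW.
rewrite in_itv/= => c01; rewrite subr0 mulr1 /g scale1r scale0r addr0 => E.
by exists c.
Qed.

(* Telescoping over the coordinates: the increment of [f] is split along the
   vertices obtained by replacing the coordinates of [y] one by one. *)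
Lemma C1_differentiable n (f : 'rV[R]_n -> R) (y : 'rV[R]_n) :
  (forall v, \forall z \near y, derivable f z v) ->
  (forall v, {for y, continuous ('D_v f)}) -> differentiable f y.
Proof.
move=> df cf.
pose D j := 'D_(delta_mx 0 j) f y.
pose L (h : 'rV[R]_n) : R := \sum_(j < n) h 0 j * D j.
have Llin : linear L.
  move=> k u v; rewrite /L scaler_sumr -big_split/=; apply: eq_bigr => j _.
  by rewrite !mxE mulrDl -mulrA.
pose LL : {linear 'rV[R]_n -> R} := HB.pack L (GRing.isLinear.Build _ _ _ _ _ Llin).
have Lc : continuous (LL : 'rV[R]_n -> R).
  move=> x; rewrite /LL/=.
  have -> : L = \sum_(j < n) (fun h : 'rV[R]_n => h 0 j * D j).
    by apply/funext => h; rewrite /L fct_sumE.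
  apply: (@differentiable_continuous); apply: differentiable_sum => j.
  apply: differentiableM => //; exact: differentiable_coord.
suff dE : (f \o shift y : 'rV[R]_n -> R) = cst (f y) + (LL : 'rV[R]_n -> R) +o_ (nbhs (0 : 'rV[R]_n)) id.
  have EL := diff_unique Lc dE.
  apply/diff_locallyP; rewrite EL; split => //.
apply/eqaddoP => e e0.
have n0 : 0 < (n.+1%:R : R) by rewrite ltr0n.
(* An equal share for each coordinate; [n.+1] instead of [n] avoids a division by zero. *)
have e'0 : 0 < e / n.+1%:R by rewrite divr_gt0.
have near_j (j : 'I_n) : \forall z \near y, derivable f z (delta_mx 0 j) /\
    `|D j - 'D_(delta_mx 0 j) f z| < e / n.+1%:R.
  near=> z; split; first by near: z; exact: df.
  near: z; have /cvgrPdist_lt := cf (delta_mx 0 j); exact.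
have [r r0 hr] : exists2 r : R, 0 < r & forall (j : 'I_n) z, `|y - z| < r ->
    derivable f z (delta_mx 0 j) /\ `|D j - 'D_(delta_mx 0 j) f z| < e / n.+1%:R.
  have : \forall z \near y, forall j : 'I_n, derivable f z (delta_mx 0 j) /\
    `|D j - 'D_(delta_mx 0 j) f z| < e / n.+1%:R.
    by apply: (@filter_forall _ _ _ _ (nbhs_filter y)); exact: near_j.
  by move=> /near_normP[r r0 hr]; exists r => // j z yz; apply: hr.
suff : \forall h \near (0 : 'rV[R]_n), `|f (h + y) - (f y + L h)| <= e * `|h| by [].
apply/near_normP; exists r => // h; rewrite sub0r normrN => hr'.
pose p k : 'rV[R]_n := y + \row_j (if (j < k)%N then h 0 j else 0).
have p0 : p 0%N = y.
  rewrite /p -[RHS]addr0; congr (_ + _); apply/rowP => j; by rewrite !mxE ltn0.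
have pn : p n = y + h.
  by rewrite /p; congr (_ + _); apply/rowP => j; rewrite !mxE ltn_ord.
have pS (k : 'I_n) : p k.+1 = p k + h 0 k *: delta_mx 0 k.
  rewrite /p -addrA; congr (_ + _); apply/rowP => j; rewrite !mxE ltnS eqxx/=.
  have [->|jk] := eqVneq j k; first by rewrite leqnn ltnn add0r mulr1.
  rewrite mulr0 addr0 leq_eqVlt; case: eqP => // jk'.
  by case/eqP: jk; apply: val_inj.
have step (k : 'I_n) :
    `|f (p k.+1) - f (p k) - h 0 k * D k| <= e / n.+1%:R * `|h|.
  have pt (t : R) : 0 <= t <= 1 -> `|y - (p k + t *: (h 0 k *: delta_mx 0 k))| < r.
    move=> /andP[t0 t1]; apply: le_lt_trans hr'.
    rewrite /p -addrA opprD addrA subrr add0r normrN.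
    apply: mx_norm_le => // i j; rewrite !mxE !ord1 eqxx/=.
    have [->|jk] := eqVneq j k; last first.
      rewrite !mulr0 addr0; case: ifP => _; [exact: entry_le_norm|by rewrite normr0].
    rewrite ltnn add0r mulr1 normrM ger0_norm//.
    by apply: le_trans (entry_le_norm h 0 k); rewrite ler_piMl.
  have [t|t t01 E] := @MVT_dir _ f (p k) (h 0 k *: delta_mx 0 k).
    move=> /pt /hr - /(_ k)[dk _].
    by have [] := is_derive_dirZ (h 0 k) dk.
  rewrite pS E.
  have [dk Dk] := hr k _ (pt _ t01).
  have [_ ->] := is_derive_dirZ (h 0 k) dk.
  rewrite -[_ *: _]/(_ * _) -mulrBr normrM mulrC.
  apply: ler_pM => //; last exact: entry_le_norm.
  by rewrite distrC ltW.
have tel : f (y + h) - f y = \sum_(k < n) (f (p k.+1) - f (p k)).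
  rewrite -(big_mkord xpredT (fun k => f (p k.+1) - f (p k))).
  by rewrite (telescope_sumr (fun k => f (p k)))// pn p0.
rewrite opprD addrA addrC [h + y]addrC tel addrC /L -sumrB.
apply: (le_trans (ler_norm_sum _ _ _)).
apply: (@le_trans _ _ (\sum_(k < n) e / n.+1%:R * `|h|)).
  by apply: ler_sum => k _; exact: step.
rewrite sumr_const card_ord -[_ *+ n]mulr_natl mulrA ler_wpM2r//.
by rewrite mulrCA ler_piMr ?ltW// ltr_pdivrMr// mul1r ltr_nat.
Unshelve. all: by end_near. Qed.

Lemma differentiable_rVP n m (f : 'rV[R]_n -> 'rV[R]_m) y :
  (forall j, differentiable (fun z => f z 0 j) y) -> differentiable f y.
Proof.
move=> df.
have -> : f = \sum_(j < m) (fun z => f z 0 j *: (delta_mx 0 j : 'rV[R]_m)).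
  by apply/funext => z; rewrite fct_sumE {1}[f z]row_sum_delta.
by apply: differentiable_sum => j; exact: differentiableZl.
Qed.

Section Ck_theory.
Context {V W : normedModType R}.
Implicit Types (U : set V) (f g : V -> W).

(** Openness turns equality on [U] into equality near each of its points, which derivatives
    respect. *)
Lemma Ck_ext k U f g : open U -> (forall y, U y -> f y = g y) ->
  Ck k U f -> Ck k U g.
Proof.
move=> oU.
have nE (f1 g1 : V -> W) y : (forall y, U y -> f1 y = g1 y) -> U y ->
    \forall z \near y, f1 z = g1 z.
  by move=> fg Uy; have : nbhs y U by [exact: open_nbhs_nbhs]; apply: filterS => z /fg.
elim: k f g => [|k IH] f g fg /= [cf h].
  by split => // y Uy; exact: near_eq_continuous (nE _ _ _ fg Uy) (cf _ Uy).
split=> [y Uy|v]; first exact: near_eq_continuous (nE _ _ _ fg Uy) (cf _ Uy).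
have [dv h'] := h v; split=> [y Uy|].
  exact: (near_eq_derivable (nE _ _ _ fg Uy) (dv _ Uy)).
by apply: IH h' => y Uy; exact: (near_eq_derive v (nE _ _ _ fg Uy)).
Qed.

Lemma CkD k U f g : open U -> Ck k U f -> Ck k U g -> Ck k U (f + g).
Proof.
move=> oU; elim: k f g => [|k IH] f g /= [cf hf] [cg hg].
  by split=> // y Uy; apply: continuousD; [exact: cf|exact: cg].
split=> [y Uy|v]; first by apply: continuousD; [exact: cf|exact: cg].
have [df {}hf] := hf v; have [dg {}hg] := hg v; split=> [y Uy|].
  by apply: derivableD; [exact: df|exact: dg].
apply: (@Ck_ext k U ('D_v f + 'D_v g)) => //; last exact: IH.
by move=> y Uy; rewrite deriveD//; [exact: df|exact: dg].
Qed.

Lemma smooth_open_derive U f v : smooth_open U f -> smooth_open U ('D_v f).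
Proof. by move=> sf k; have [_ /(_ v)[]] := sf k.+1. Qed.

Lemma smooth_open_derivable U f v y : smooth_open U f -> U y -> derivable f y v.
Proof. by move=> sf Uy; have [_ /(_ v)[+ _]] := sf 1%N; exact. Qed.

Lemma smooth_open_continuous U f y : smooth_open U f -> U y -> {for y, continuous f}.
Proof. by move=> sf Uy; have [+ _] := sf 0%N; exact. Qed.

End Ck_theory.

(** [Ck] speaks of directional derivatives only, whereas the chain rule for transition maps needs a
    total differential. *)
Lemma smooth_open_differentiable n m (U : set 'rV[R]_n)
    (f : 'rV[R]_n -> 'rV[R]_m) y :
  open U -> smooth_open U f -> U y -> differentiable f y.
Proof.
move=> oU sf Uy; apply: differentiable_rVP => j.
have nU : \forall z \near y, U z by exact: open_nbhs_nbhs.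
have nD v : \forall z \near y, derivable f z v.
  by apply: filterS nU => z; exact: smooth_open_derivable.
apply: C1_differentiable => v.
  by apply: filterS (nD v) => z /derivable_mxP.
have E : \forall z \near y, 'D_v f z 0 j = 'D_v (fun x => f x 0 j) z.
  by apply: filterS (nD v) => z dz; rewrite derive_mx// mxE.
have c1 : {for y, continuous (fun z => 'D_v f z 0 j)}.
  have c2 : {for y, continuous ('D_v f)}.
    exact: smooth_open_continuous (smooth_open_derive v sf) Uy.
  apply: (continuous_comp c2 (g := fun w : 'rV[R]_m => w 0 j)).
  exact/differentiable_continuous/differentiable_coord.
exact: near_eq_continuous E c1.
Qed.

Lemma smooth_open_differentiable_real n (U : set 'rV[R]_n)
    (f : 'rV[R]_n -> R) y :
  open U -> smooth_open U f -> U y -> differentiable f y.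
Proof.
move=> oU sf Uy.
have nU : \forall z \near y, U z by exact: open_nbhs_nbhs.
apply: C1_differentiable => v.
  by apply: filterS nU => z; exact: smooth_open_derivable.
exact: smooth_open_continuous (smooth_open_derive v sf) Uy.
Qed.

Section curves.
Context {V W : normedModType R}.

Lemma is_derive_scale (k : R -> R) (f : R -> W) (t dk : R) (df : W) :
  is_derive t 1 k dk -> is_derive t 1 f df ->
  is_derive t 1 (fun s => k s *: f s) (dk *: f t + k t *: df).
Proof.
move=> Hk Hf.
have ck : {for t, continuous k}.
  by apply: differentiable_continuous; apply/derivable1_diffP.
have H : h^-1 *: (((fun s => k s *: f s) \o shift t) (h *: (1 : R)) - k t *: f t)
    @[h --> 0^'] --> dk *: f t + k t *: df.
  have -> : (fun h : R => h^-1 *: (((fun s => k s *: f s) \o shift t) (h *: (1 : R)) - k t *: f t)) =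
    (fun h : R => (h^-1 *: ((k \o shift t) (h *: (1 : R)) - k t)) *: f t +
     ((k \o shift t) (h *: (1 : R))) *: (h^-1 *: ((f \o shift t) (h *: (1 : R)) - f t))).
    apply/funext => h /=; set u := k _; set w := f (_ + t).
    rewrite [h^-1 *: (u - _)]/(_ * _) -[in RHS]scalerA [_ *: (h^-1 *: _)]scalerA.
    rewrite [u * _]mulrC -[in RHS]scalerA -scalerDr; congr (_ *: _).
    by rewrite scalerBl scalerBr [RHS]addrC addrA subrK.
  apply: cvgD; apply: cvgZ.
  - have [dk1 <-] := Hk; exact: dk1.
  - exact: cvg_cst.
  - have ct : shift t (h *: (1 : R)) @[h --> (0 : R)] --> t.
      rewrite -[X in _ --> X]add0r -[X in _ --> X + _](scale0r (1 : R)).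
      by apply: cvgD; [apply: cvgZ; [exact: cvg_id|exact: cvg_cst]|exact: cvg_cst].
    have := @cvg_comp _ _ _ _ k _ _ _ ct ck.
    apply: cvg_trans; apply: cvg_app; exact: cvg_within.
  - have [df1 <-] := Hf; exact: df1.
split; first by apply/cvg_ex; eexists; exact: H.
exact/cvg_lim.
Qed.

Lemma is_derive_poly_line (F : V -> W) (a b : V) (s : {poly R}) (t : R) :
  derivable F (a + s.[t] *: b) b ->
  is_derive t 1 (fun t => F (a + s.[t] *: b)) (s^`().[t] *: 'D_b F (a + s.[t] *: b)).
Proof.
move=> dF; pose G r := F (a + r *: b).
have dG : is_derive s.[t] 1 G ('D_b F (a + s.[t] *: b)) by exact: is_derive_line.
have diG : differentiable G s.[t] by apply/derivable1_diffP.
have ds := is_derive_poly s t.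
have dis : differentiable (horner s) t by apply/derivable1_diffP.
have dGs : differentiable (G \o horner s) t by exact: differentiable_comp.
apply: (DeriveDef (f := G \o horner s)); first exact/derivable1_diffP.
have ds1 : 'd (horner s) t 1 = s^`().[t] *: (1 : R).
  by rewrite -deriveE// derive_val [RHS]mulr1.
have dG1 : 'd G (s.[t] : R) 1 = 'D_b F (a + s.[t] *: b) by rewrite -deriveE// derive_val.
by rewrite deriveE// diff_comp//= ds1 linearZ/= dG1.
Qed.

(** The factor [q] closes the induction: the derivative is a sum of two terms of the same shape, one
    with [q^]()[and]F[, the other with]q * s^[()] and ['D_b F]. *)
Lemma Ck_poly_line k (U : set V) (F : V -> W) (a b : V) (s q : {poly R}) :
  open U -> smooth_open U F ->
  Ck k [set t : R | U (a + s.[t] *: b)] (fun t => q.[t] *: F (a + s.[t] *: b)).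
Proof.
move=> oU.
have oU' : open [set t : R | U (a + s.[t] *: b)].
  apply: (@open_comp _ _ (fun t : R => a + s.[t] *: b)) => // t _.
  apply: cvgD; first exact: cvg_cst.
  by apply: cvgZ; [exact: continuous_horner|exact: cvg_cst].
elim: k F q => [|k IH] F q sF.
  split=> // t Ut; apply: differentiable_continuous; apply/derivable1_diffP.
  have := is_derive_poly_line (smooth_open_derivable (v := b) sF Ut).
  by move=> /(is_derive_scale (is_derive_poly q t)) [].
have D t : U (a + s.[t] *: b) -> is_derive t 1 (fun t => q.[t] *: F (a + s.[t] *: b))
   (q^`().[t] *: F (a + s.[t] *: b) + (q * s^`()).[t] *: 'D_b F (a + s.[t] *: b)).
  move=> Ut; have := is_derive_poly_line (smooth_open_derivable (v := b) sF Ut).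
  by move=> /(is_derive_scale (is_derive_poly q t)); rewrite scalerA hornerM.
split=> [t Ut|v].
  apply: differentiable_continuous; apply/derivable1_diffP.
  by have [] := D _ Ut.
have Dv t : U (a + s.[t] *: b) -> is_derive t v (fun t => q.[t] *: F (a + s.[t] *: b))
   ((v *: q^`()).[t] *: F (a + s.[t] *: b) + (v *: (q * s^`())).[t] *: 'D_b F (a + s.[t] *: b)).
  move=> Ut; have [d1 e1] := D _ Ut.
  have := is_derive_dirZ v d1; rewrite [_ *: (1 : R)]mulr1 e1.
  by rewrite !hornerZ scalerDr !scalerA.
split=> [t Ut|]; first by have [] := Dv _ Ut.
apply: (@Ck_ext _ _ _ _ ((fun t => (v *: q^`()).[t] *: F (a + s.[t] *: b)) +
   (fun t => (v *: (q * s^`())).[t] *: 'D_b F (a + s.[t] *: b)))) => //.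
  by move=> t Ut; have [_ ->] := Dv _ Ut.
apply: CkD => //; first exact: IH.
exact: (IH _ (v *: (q * s^`())) (smooth_open_derive b sF)).
Qed.

Lemma smooth_poly_line (U : set V) (F : V -> W) (a b : V) (s : {poly R}) :
  open U -> smooth_open U F ->
  smooth_open [set t : R | U (a + s.[t] *: b)] (fun t => F (a + s.[t] *: b)).
Proof.
move=> oU sF k; have := @Ck_poly_line k U F a b s 1 oU sF.
have -> // : (fun t : R => (1 : {poly R}).[t] *: F (a + s.[t] *: b)) =
  (fun t : R => F (a + s.[t] *: b)).
by apply/funext => t; rewrite hornerE scale1r.
Qed.

End curves.
End calculus.

(** * Integrals of functions that need not be measurable *)

(* The speed of a curve is not known to be measurable.  The integral of a
   nonnegative function is a supremum over simple functions below it, so that the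
   following properties do not need measurability of the integrand. *)
Section lower_integral.
Context d (T : measurableType d) (R : realType) (mu : {measure set T -> \bar R}).
Implicit Types (f g : T -> \bar R) (A B D N : set T).
Import HBNNSimple.
Local Open Scope ereal_scope.

Lemma ereal_supD_le (A B : set \bar R) (x : \bar R) :
  A !=set0 -> B !=set0 -> (forall a, A a -> 0 <= a) -> (forall b, B b -> 0 <= b) ->
  (forall a b, A a -> B b -> a + b <= x) -> ereal_sup A + ereal_sup B <= x.
Proof.
move=> [a0 Aa0] [b0 Bb0] A0 B0 AB.
have [->|xoo] := eqVneq x +oo; first by rewrite leey.
have xfin : x \is a fin_num.
  rewrite fin_numE xoo andbT; apply/eqP => xE.
  have := AB _ _ Aa0 Bb0; rewrite xE leeNy_eq => /eqP E.
  by have := adde_ge0 (A0 _ Aa0) (B0 _ Bb0); rewrite E.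
have Afin a : A a -> a \is a fin_num.
  move=> Aa; rewrite ge0_fin_numE ?A0//; apply: (@le_lt_trans _ _ x).
    by apply: le_trans (AB _ _ Aa Bb0); rewrite leeDl// B0.
  by rewrite ltey_eq xfin.
have supB a : A a -> ereal_sup B <= x - a.
  by move=> Aa; apply: ub_ereal_sup => b Bb; rewrite leeBrDr ?Afin// addeC AB.
have Bfin : ereal_sup B \is a fin_num.
  rewrite ge0_fin_numE; last first.
    by apply: le_trans (B0 _ Bb0) _; exact: ereal_sup_ubound.
  apply: (le_lt_trans (supB _ Aa0)).
  by rewrite ltey_eq fin_numB xfin Afin.
rewrite -leeBrDr//; apply: ub_ereal_sup => a Aa; rewrite leeBrDr//.
by rewrite -leeBrDl ?Afin// supB.
Qed.

Lemma lower_integral_le D f g : (forall x, D x -> 0 <= f x) ->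
  (forall x, D x -> f x <= g x) -> \int[mu]_(x in D) f x <= \int[mu]_(x in D) g x.
Proof.
move=> f0 fg; rewrite !ge0_integralE//; last by move=> x Dx; exact: le_trans (f0 _ Dx) (fg _ Dx).
apply: le_ereal_sup => _ [h hf <-]; exists h => // x; apply: le_trans (hf x) _.
by rewrite /patch; case: ifPn => //; rewrite inE => /fg.
Qed.

Lemma lower_integral_nnsfun_le D f (h : {nnsfun T >-> R}) :
  (forall x, D x -> 0 <= f x) -> (forall x, (h x)%:E <= (f \_ D) x) ->
  sintegral mu h <= \int[mu]_(x in D) f x.
Proof. by move=> f0 hf; rewrite ge0_integralE//; apply: ereal_sup_ubound; exists h. Qed.

(** Reduces an upper bound to simple functions, which are measurable. Being below [f \_ D] they
    vanish off [D], so nothing is lost by integrating them over [D]. *)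
Lemma lower_integral_ub D f x : (forall x, D x -> 0 <= f x) ->
  (forall h : {nnsfun T >-> R}, (forall x, (h x)%:E <= (f \_ D) x) ->
    \int[mu]_(x in D) (h x)%:E <= x) -> \int[mu]_(x in D) f x <= x.
Proof.
move=> f0 H; rewrite ge0_integralE//; apply: ub_ereal_sup => _ [h hf <-].
rewrite -integralT_nnsfun; apply: le_trans (H _ hf).
rewrite [leRHS]integral_mkcond; apply: lower_integral_le => [y _|y _].
  by rewrite lee_fin.
rewrite /patch; case: ifPn => // Dy; apply: le_trans (hf y) _.
by rewrite /patch (negbTE Dy).
Qed.

(** One inequality is additivity for simple functions. For the other, simple functions below [f] on
    [A] and on [B] add up to one below [f] on the disjoint union. *)
Lemma lower_integral_setU A B f : measurable A -> measurable B -> A `&` B = set0 ->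
  (forall x, (A `|` B) x -> 0 <= f x) ->
  \int[mu]_(x in A `|` B) f x = \int[mu]_(x in A) f x + \int[mu]_(x in B) f x.
Proof.
move=> mA mB AB f0.
have fA x : A x -> 0 <= f x by move=> Ax; apply: f0; left.
have fB x : B x -> 0 <= f x by move=> Bx; apply: f0; right.
apply/eqP; rewrite eq_le; apply/andP; split.
  apply: lower_integral_ub => // h hf.
  rewrite ge0_integral_setU//=; last 3 first.
  - by apply/measurable_EFinP; exact: measurable_funTS.
  - by move=> x _; rewrite lee_fin.
  - by apply/disj_setPS; rewrite AB.
  have hf' x : (A `|` B) x -> (h x)%:E <= f x.
    by move=> ABx; have := hf x; rewrite /patch mem_set.
  by apply: leeD; apply: lower_integral_le => x Ax; rewrite ?lee_fin//; apply: hf'; [left|right].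
rewrite [X in X + _]ge0_integralE// [X in _ + X]ge0_integralE//.
have ne D (g : T -> \bar R) : (forall x, D x -> 0 <= g x) ->
   [set sintegral mu h | h in [set h : {nnsfun T >-> R} | forall x, (h x)%:E <= (g \_ D) x]] !=set0.
  move=> g0; exists (sintegral mu (@nnsfun0 _ T R)); exists (@nnsfun0 _ T R) => // x.
  by rewrite /patch /=; case: ifPn => //; rewrite inE => /g0.
apply: ereal_supD_le.
- exact: ne.
- exact: ne.
- by move=> _ [h _ <-]; exact: sintegral_ge0.
- by move=> _ [h _ <-]; exact: sintegral_ge0.
move=> _ _ [h hA <-] [k kB <-]; rewrite -sintegralD.
apply: (@lower_integral_nnsfun_le _ _ (add_nnsfun h k)) => // x /=.
rewrite EFinD; apply: le_trans (leeD (hA x) (kB x)) _; rewrite /patch in_setU.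
case: ifPn => Ax; case: ifPn => Bx //=; rewrite ?add0e ?adde0//.
by move: Ax Bx; rewrite !inE => Ax Bx; have : (A `&` B) x by []; rewrite AB.
Qed.

Lemma lower_integral_subset A D f : measurable A -> measurable D -> A `<=` D ->
  (forall x, D x -> 0 <= f x) ->
  \int[mu]_(x in A) f x <= \int[mu]_(x in D) f x.
Proof.
move=> mA mD AD f0; rewrite -(setDUK AD) lower_integral_setU//.
- rewrite leeDl//; apply: integral_ge0 => x [Dx _]; exact: f0.
- exact: measurableD.
- by rewrite setDE setICA setICr setI0.
- by rewrite setDUK.
Qed.

Lemma lower_integral_null N f : measurable N -> mu N = 0 ->
  (forall x, N x -> 0 <= f x) -> \int[mu]_(x in N) f x = 0.
Proof.
move=> mN N0 f0; apply/eqP; rewrite eq_le integral_ge0// andbT.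
apply: lower_integral_ub => // h _; rewrite null_set_integral//.
by apply/measurable_EFinP; exact: measurable_funTS.
Qed.

(** Serves to ignore the break points of a curve, where its speed has no meaning. *)
Lemma eq_lower_integral D N f g : measurable D -> measurable N -> mu N = 0 ->
  (forall x, D x -> 0 <= f x) -> (forall x, D x -> 0 <= g x) ->
  (forall x, D x -> ~ N x -> f x = g x) ->
  \int[mu]_(x in D) f x = \int[mu]_(x in D) g x.
Proof.
move=> mD mN N0 f0 g0 fg.
have split_off h : (forall x, D x -> 0 <= h x) ->
    \int[mu]_(x in D) h x = \int[mu]_(x in D `\` N) h x.
  move=> h0; rewrite -{1}(setDUK (@subIsetl _ D N)) lower_integral_setU//.
  - rewrite lower_integral_null ?add0e ?setDIr ?setDv ?set0U//.
    + exact: measurableI.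
    + apply/eqP; rewrite -measure_le0 -N0; apply: le_measure => //; rewrite ?inE//.
      exact: measurableI.
    + by move=> x [/h0].
  - exact: measurableI.
  - by apply: measurableD => //; exact: measurableI.
  - by rewrite setDE setICA setICr setI0.
  - by rewrite setDUK//; exact: subIsetl.
rewrite split_off// (split_off g)//; apply: eq_integral => x.
by rewrite inE => -[Dx Nx]; exact: fg.
Qed.

End lower_integral.

Section lower_integral_scale.
Context d (T : measurableType d) (R : realType) (mu : {measure set T -> \bar R}).
Import HBNNSimple.
Local Open Scope ereal_scope.

Lemma lower_integralZ_le D (k : R) (f : T -> \bar R) : measurable D -> (0 < k)%R ->
  (forall x, 0 <= f x) ->
  \int[mu]_(x in D) (k%:E * f x) <= k%:E * \int[mu]_(x in D) f x.
Proof.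
move=> mD k0 f0; have ki0 : (0 < k^-1)%R by rewrite invr_gt0.
apply: lower_integral_ub => [x _|h hf]; first by rewrite mule_ge0// lee_fin ltW.
rewrite -lee_pdivrMl// -ge0_integralZl//; last 3 first.
- by apply/measurable_EFinP; exact: measurable_funTS.
- by move=> x _; rewrite lee_fin.
- by rewrite lee_fin ltW.
apply: lower_integral_le => [x _|x Dx]; first by rewrite mule_ge0// lee_fin// ltW.
rewrite lee_pdivrMl//; apply: le_trans (hf x) _.
by rewrite /patch mem_set.
Qed.

Lemma lower_integralZ D (k : R) (f : T -> \bar R) : measurable D -> (0 < k)%R ->
  (forall x, 0 <= f x) ->
  \int[mu]_(x in D) (k%:E * f x) = k%:E * \int[mu]_(x in D) f x.
Proof.
move=> mD k0 f0; apply/eqP; rewrite eq_le lower_integralZ_le//=.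
have ki0 : (0 < k^-1)%R by rewrite invr_gt0.
rewrite -lee_pdivlMl//; apply: le_trans (lower_integralZ_le mD ki0 _).
  apply: lower_integral_le => // x _.
  by rewrite muleA -EFinM mulVf ?gt_eqF// mul1e.
by move=> x; rewrite mule_ge0// lee_fin ltW.
Qed.

End lower_integral_scale.

Section ereal_inf_add.
Context {R : realType}.
Local Open Scope ereal_scope.

Lemma ereal_infD_ge (A B : set (\bar R)) (x : \bar R) :
  (forall a, A a -> 0 <= a) -> (forall b, B b -> 0 <= b) ->
  (forall a b, A a -> B b -> x <= a + b) -> x <= ereal_inf A + ereal_inf B.
Proof.
move=> A0 B0 AB.
have iA0 : 0 <= ereal_inf A by apply: le_ereal_inf_tmp.
have iB0 : 0 <= ereal_inf B by apply: le_ereal_inf_tmp.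
have [Aoo|Aoo] := eqVneq (ereal_inf A) +oo.
  by rewrite Aoo addye ?leey// gt_eqF// (lt_le_trans _ iB0)// ltNy0.
have Afin : ereal_inf A \is a fin_num by rewrite ge0_fin_numE// ltey.
have [Boo|Boo] := eqVneq (ereal_inf B) +oo.
  by rewrite Boo addey ?leey// gt_eqF// (lt_le_trans _ iA0)// ltNy0.
have Bfin : ereal_inf B \is a fin_num by rewrite ge0_fin_numE// ltey.
rewrite -leeBlDr//; apply: le_ereal_inf_tmp => a Aa.
have [->|aoo] := eqVneq a +oo; first by rewrite leey.
have afin : a \is a fin_num by rewrite ge0_fin_numE ?A0// ltey.
rewrite leeBlDr// addeC -leeBlDr//; apply: le_ereal_inf_tmp => b Bb.
by rewrite leeBlDr// addeC AB.
Qed.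

End ereal_inf_add.

Section affine_change_of_variables.
Context {R : realType}.
Notation mu := (@lebesgue_measure R).
Import HBNNSimple.

(** The rescaled push-forward under the affine map agrees with [mu] on half-open intervals, and
    these determine the measure. *)
Lemma lebesgue_measure_affine (k c : R) (A : set R) : 0 < k -> measurable A ->
  mu A = (k%:E * mu ((fun x : R => k * x + c)%R @^-1` A))%E.
Proof.
move=> k0 mA.
pose aff := (fun x => k * x + c) : measurableTypeR R -> measurableTypeR R.
have maff : measurable_fun setT aff.
  by apply: measurable_funD => //; exact: measurable_funM.
pose nu0 := mscale (NngNum (ltW k0)) (pushforward mu aff).
pose nu := nu0 maff.
suff : mu A = nu A by [].
apply: lebesgue_measure_unique => // X [[a b] _ <-] /=.
rewrite /nu /nu0 /mscale/= /pushforward.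
have -> : (fun x => k * x + c) @^-1` `]a, b]%classic = `](a - c) / k, (b - c) / k]%classic.
  apply/seteqP; split => x /=; rewrite !in_itv/= ltr_pdivrMr// ler_pdivlMr// ltrBlDr lerBrDr mulrC //.
rewrite !lebesgue_measure_itv/= !lte_fin.
rewrite ltr_pM2r ?invr_gt0// ltrD2r; case: ifPn => ab; last by rewrite mule0.
by rewrite -!EFinB -EFinM; congr EFin; field; rewrite gt_eqF.
Qed.

Lemma integral_affine (k c : R) (f : R -> \bar R) : 0 < k ->
  measurable_fun [set: R] f -> (forall x, 0 <= f x)%E ->
  (\int[mu]_x f x = k%:E * \int[mu]_x f (k * x + c)%R)%E.
Proof.
move=> k0 mf f0.
pose aff := (fun x => k * x + c) : measurableTypeR R -> measurableTypeR R.
have maff : measurable_fun setT aff.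
  by apply: measurable_funD => //; exact: measurable_funM.
pose nu0 := mscale (NngNum (ltW k0)) (pushforward mu aff).
pose nu := nu0 maff.
transitivity (\int[nu]_x f x)%E.
  apply: eq_measure_integral => A mA _; rewrite /nu /nu0 /mscale/= /pushforward.
  exact: lebesgue_measure_affine.
by rewrite ge0_integral_mscale//= ge0_integral_pushforward.
Qed.

Lemma lower_integral_affine_le (k c a b : R) (f : R -> \bar R) : 0 < k ->
  (forall x, 0 <= f x)%E ->
  (\int[mu]_(x in `[(k * a + c)%R, (k * b + c)%R]) f x <=
    k%:E * \int[mu]_(x in `[a, b]) f (k * x + c)%R)%E.
Proof.
move=> k0 f0; rewrite ge0_integralE//; apply: ub_ereal_sup => _ [h hf <-].
rewrite -integralT_nnsfun (@integral_affine k c)//; last 2 first.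
- apply/measurable_EFinP; exact: (@measurable_funPT _ _ (measurableTypeR R) _ h).
- by move=> x; rewrite lee_fin.
rewrite lee_pmul2l ?lte_fin//= [leRHS]integral_mkcond.
apply: lower_integral_le => x _; first by rewrite lee_fin.
apply: le_trans (hf _) _; rewrite /patch; case: ifPn; case: ifPn => //.
rewrite !inE/= !in_itv/= lerD2r ler_pM2l// lerD2r ler_pM2l//.
by move=> /negP; rewrite inE/= in_itv/= => h1 /h1.
Qed.

(** The missing inequality is the previous one for the inverse affine map. *)
Lemma lower_integral_affine (k c a b : R) (f : R -> \bar R) : 0 < k ->
  (forall x, 0 <= f x)%E ->
  (\int[mu]_(x in `[(k * a + c)%R, (k * b + c)%R]) f x =
    k%:E * \int[mu]_(x in `[a, b]) f (k * x + c)%R)%E.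
Proof.
move=> k0 f0; apply/eqP; rewrite eq_le lower_integral_affine_le//=.
have ki0 : 0 < k^-1 by rewrite invr_gt0.
have kx x : k^-1 * (k * x + c) + - (k^-1 * c) = x.
  by field; rewrite gt_eqF.
have := @lower_integral_affine_le k^-1 (- (k^-1 * c)) (k * a + c) (k * b + c)
  (fun x => f (k * x + c)) ki0 (fun x => f0 _).
rewrite !kx => H; rewrite -lee_pdivlMl//.
apply: le_trans H _; rewrite lee_pmul2l ?lte_fin//.
apply: lower_integral_le => x _ //.
suff -> : k * (k^-1 * x + - (k^-1 * c)) + c = x by [].
by field; rewrite gt_eqF.
Qed.

End affine_change_of_variables.

Lemma smooth_on_extends (R : realType) (V W : normedModType R) (A : set V)
    (f : V -> W) y (F := xget f [set F | smooth_extension A f y F]) :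
  smooth_on A f -> A y -> smooth_extension A f y F.
Proof. by move=> sf /sf Fex; rewrite /F; apply: xgetPex. Qed.

Lemma cvg_line (R : realType) (V : normedModType R) (a v : V) (t : R) :
  a + s *: v @[s --> t] --> a + t *: v.
Proof.
apply: cvgD; first exact: cvg_cst.
by apply: cvgZ; [exact: cvg_id|exact: cvg_cst].
Qed.

(** * Charts, boundary and interior *)

Section smooth_manifold_theory.
Context {R : realType} {m : nat} {M : topologicalType}.
Variable X : @smooth_manifold R m.+1 M.
Implicit Types (c : @chart R m.+1 M) (p q : M) (y z : 'rV[R]_m.+1).

Lemma halfspaceE y : @halfspace R m.+1 y <-> 0 <= y 0 ord0.
Proof.
split=> [/(_ ord0)|y0 i i0]; first exact.
by have -> : i = ord0 by exact: val_inj.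
Qed.

Lemma halfspace_boundaryE y : @halfspace_boundary R m.+1 y <-> y 0 ord0 = 0.
Proof.
split=> [[i i0 <-]|y0]; last by exists ord0.
by have -> : i = ord0 by exact: val_inj.
Qed.

Lemma chart_halfspace c p : atlas X c -> cdom c p -> 0 <= c p 0 ord0.
Proof.
move=> /atlas_chart[_ [D _ cD] _ _ _] cp; apply/halfspaceE.
by have : (D `&` @halfspace R m.+1) (c p) by [rewrite -cD; exists p]; case.
Qed.

Lemma cmapK c p : atlas X c -> cdom c p -> cinv c (c p) = p.
Proof. by move=> /atlas_chart[_ _ _ _]; exact. Qed.

Lemma cinvP c y : atlas X c -> (c @` cdom c) y ->
  cdom c (cinv c y) /\ c (cinv c y) = y.
Proof. by move=> ac [p cp <-]; rewrite cmapK. Qed.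

Lemma cdom_open c : atlas X c -> open (cdom c).
Proof. by move=> /atlas_chart[]. Qed.

Lemma near_cdom c p : atlas X c -> cdom c p -> \forall q \near p, cdom c q.
Proof. by move=> ac cp; apply: open_nbhs_nbhs; split => //; exact: cdom_open. Qed.

Lemma near_chart_image c p : atlas X c -> cdom c p ->
  \forall z \near c p, 0 <= (z : 'rV[R]_m.+1) 0 ord0 -> (c @` cdom c) z.
Proof.
move=> /atlas_chart[_ [D oD cD] _ _ _] cp; rewrite cD.
have : (D `&` @halfspace R m.+1) (c p) by rewrite -cD; exists p.
case=> Dcp _; have : nbhs (c p) D by exact: open_nbhs_nbhs.
by apply: filterS => z Dz z0; split => //; exact/halfspaceE.
Qed.

Lemma cmap_continuous c p : atlas X c -> cdom c p -> {for p, continuous c}.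
Proof.
move=> /atlas_chart[oc _ cc _ _] cp.
by move: cc; rewrite continuous_open_subspace// => /(_ p); apply; rewrite inE.
Qed.

Lemma cinv_cvg c y : atlas X c -> (c @` cdom c) y ->
  cinv c z @[z --> within (c @` cdom c) (nbhs y)] --> cinv c y.
Proof.
move=> /atlas_chart[_ _ _ cc _] cy.
by move/continuous_within_itvP : cc || move/subspace_continuousP : cc; exact.
Qed.

Lemma near_pos y : 0 < y 0 ord0 -> \forall z \near y, 0 < (z : 'rV[R]_m.+1) 0 ord0.
Proof.
move=> y0.
have cf : {for y, continuous (fun z : 'rV[R]_m.+1 => z 0 ord0)}.
  exact/differentiable_continuous/differentiable_coord.
exact: (cvgr_gt _ cf).
Qed.

Lemma near_chart_image_pos c p : atlas X c -> cdom c p -> 0 < c p 0 ord0 ->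
  \forall z \near c p, (c @` cdom c) z /\ 0 < z 0 ord0.
Proof.
move=> ac cp /near_pos; have := near_chart_image ac cp.
by apply: filterS2 => z cz z0; split => //; exact/cz/ltW.
Qed.

(** Off the bounding hyperplane the image of the chart is a full neighbourhood, so that continuity
    within the image is plain continuity. *)
Lemma cinv_continuous_pos c y : atlas X c -> (c @` cdom c) y -> 0 < y 0 ord0 ->
  {for y, continuous (cinv c)}.
Proof.
move=> ac [p cp <-] y0; have cy : (c @` cdom c) (c p) by exists p.
rewrite /prop_for /continuous_at; apply: cvg_trans (cinv_cvg ac cy).
move=> B BW.
have : \forall z \near c p, (c @` cdom c) z -> B (cinv c z) by exact: BW.
have := near_chart_image_pos ac cp y0; apply: filterS2 => z [cz _]; exact.
Qed.

(* The first coordinate of a transition map [F] into a chart is nonnegative; if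
   it vanishes at an interior point it is minimal there, so that the image of
   the differential of [F] lies in a hyperplane although [F] is invertible. *)
Lemma chart_interior c p : atlas X c -> cdom c p -> 0 < c p 0 ord0 -> interior_mfd X p.
Proof.
move=> ac cp p0 -[c' [ac' cp' /halfspace_boundaryE p0']].
set y := c p; set y' := c' p.
pose A := c @` (cdom c `&` cdom c'); pose A' := c' @` (cdom c' `&` cdom c).
have Ay : A y by exists p.
have Ay' : A' y' by exists p.
have [F [U [oU Uy sF FA]]] := atlas_smooth ac ac' Ay.
have [G [U' [oU' Uy' sG GA]]] := atlas_smooth ac' ac Ay'.
have dF : differentiable F y by exact: smooth_open_differentiable sF Uy.
have Fy : F y = y' by rewrite FA//= cmapK.
have dG : differentiable G (F y) by rewrite Fy; exact: smooth_open_differentiable sG Uy'.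
(* Here [0 < c p 0 ord0] enters: a full neighbourhood of [y] lies in the overlap, so the transition
   map may be differentiated in all directions. *)
have nA : \forall z \near y, A z.
  have ncy : (c @` cdom c) y by exists p.
  have nc' : \forall z \near y, cdom c' (cinv c z).
    apply: (cinv_continuous_pos ac ncy p0).
    by rewrite /y cmapK//; exact: near_cdom.
  have := near_chart_image_pos ac cp p0.
  move: nc'; apply: filterS2 => z cz [[q cq qz] _].
  by exists q => //; split => //; move: cz; rewrite -qz cmapK.
have nU : \forall z \near y, U z by exact: open_nbhs_nbhs.
have nFU' : \forall z \near y, U' (F z).
  have cF := differentiable_continuous dF.
  by apply: cF; rewrite Fy; exact: open_nbhs_nbhs.
have FE z : A z -> U z -> exists2 q, cdom c q /\ cdom c' q & z = c q /\ F z = c' q.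
  move=> Az Uz; rewrite FA//=; case: Az => q [cq cq'] <-.
  by exists q => //; rewrite cmapK.
have GFid : \forall z \near y, (G \o F) z = id z.
  near=> z; have [||q [cq cq'] [zE FzE]] := FE z; [by near: z|by near: z|].
  have UFz : U' (F z) by near: z.
  by rewrite /= FzE GA//= ?cmapK// -?FzE//; exists q.
have F0 : \forall z \near y, 0 <= F z 0 ord0.
  near=> z; have [||q [cq cq'] [_ ->]] := FE z; [by near: z|by near: z|].
  exact: chart_halfspace.
have dF0 v : 'd F y v 0 ord0 = 0.
  have dFv z : U z -> derivable (fun w => F w 0 ord0) z v.
    by move=> Uz; have /derivable_mxP := smooth_open_derivable (v := v) sF Uz; exact.
  have -> : 'd F y v 0 ord0 = 'D_v (fun w => F w 0 ord0) y.
    rewrite -deriveE// derive_mx ?mxE//; exact: diff_derivable.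
  pose phi (t : R) : R := F (y + t *: v) 0 ord0.
  have := @cvg_line _ _ y v 0; rewrite scale0r addr0 => cl.
  have nUF : \forall z \near y, U z /\ 0 <= F z 0 ord0.
    by near=> z; split; near: z.
  have : \forall t \near (0 : R), U (y + t *: v) /\ 0 <= F (y + t *: v) 0 ord0.
    exact: cl nUF.
  move=> /near_normP[e e0 he].
  have he' t : t \in `]-e, e[ -> U (y + t *: v) /\ 0 <= F (y + t *: v) 0 ord0.
    by rewrite in_itv/= => te; apply: he; rewrite sub0r normrN ltr_norml.
  have dphi : is_derive (0 : R) 1 phi 0.
    apply: (@derive1_at_min _ phi (- e) e 0).
    - by rewrite ge0_cp// ltW.
    - by move=> t /he'[Ut _]; have [] := is_derive_line (dFv _ Ut).
    - by rewrite in_itv/= oppr_lt0 e0.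
    - move=> t /he'[_ +]; rewrite /phi scale0r addr0 Fy /y' p0'; exact.
  have := @is_derive_line _ _ _ (fun w => F w 0 ord0) y v 0.
  rewrite scale0r addr0 => /(_ (dFv _ Uy)) [_ <-].
  by have [_] := dphi.
have GFd v : 'd G (F y) ('d F y v) = v.
  have dGF : differentiable (G \o F) y by exact: differentiable_comp.
  have E : 'D_v (G \o F) y = 'D_v id y by exact: near_eq_derive v GFid.
  have DC := congr1 (fun h => h v) (diff_comp dF dG).
  apply: etrans (esym DC) _; apply: etrans (esym (deriveE v dGF)) _.
  by rewrite E derive_id.
pose B1 := lin1_mx ('d F y); pose B2 := lin1_mx ('d G (F y)).
have B12 : B1 *m B2 = 1%:M.
  apply/row_matrixP => i; rewrite row_mul [row i B1]rowE !mul_rV_lin1 GFd.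
  by rewrite row1.
(* A one-sided inverse of a square matrix is two-sided, so [B2 *m B1] is the identity; but its rows
   are values of ['d F], whose first coordinate is 0. *)
have := congr1 (fun B : 'M[R]_m.+1 => row ord0 B 0 ord0) (mulmx1C B12).
rewrite row_mul mul_rV_lin1 dF0 !mxE eqxx => /eqP.
by rewrite eq_sym oner_eq0.
Unshelve. all: by end_near. Qed.

Lemma interior_chart c p : atlas X c -> cdom c p -> interior_mfd X p -> 0 < c p 0 ord0.
Proof.
move=> ac cp ip; rewrite lt_neqAle chart_halfspace// andbT.
apply/negP => /eqP c0; apply: ip; exists c; split => //.
exact/halfspace_boundaryE.
Qed.

Lemma boundary_chart c p : atlas X c -> cdom c p -> boundary X p -> c p 0 ord0 = 0.
Proof.
move=> ac cp bp; apply/eqP; rewrite eq_le chart_halfspace// andbT leNgt.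
by apply/negP => /(chart_interior ac cp).
Qed.

(** Raising the first coordinate in a chart leads from any point to interior points nearby. *)
Lemma interior_mfd_dense p B : nbhs p B -> exists2 q, B q & interior_mfd X q.
Proof.
move=> pB; have [c [ac cp]] := atlas_cover X p.
have cy : (c @` cdom c) (c p) by exists p.
have := cinv_cvg ac cy; rewrite cmapK// => /(_ _ pB).
move=> nB0.
have nB : \forall z \near c p, (c @` cdom c) z -> B (cinv c z) by exact: nB0.
have : \forall z \near c p, 0 <= (z : 'rV[R]_m.+1) 0 ord0 -> (c @` cdom c) z /\ B (cinv c z).
  near=> z => z0; have cz : (c @` cdom c) z.
    by move: z0; near: z; exact: near_chart_image.
  by split => //; move: cz; near: z.
move=> /near_normP[r r0 hr].
have r20 : 0 < r / 2 by rewrite divr_gt0.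
pose z := c p + (r / 2) *: delta_mx 0 ord0.
have z0 : 0 < z 0 ord0.
  by rewrite !mxE/= mulr1 ltr_wpDl ?chart_halfspace.
have [] := hr z _ (ltW z0).
  rewrite /z opprD addrA subrr add0r normrN.
  apply: (@le_lt_trans _ _ (r / 2)); last first.
    by rewrite ltr_pdivrMr// mulr_natr mulr2n ltrDl.
  apply: mx_norm_le => [|i j]; first exact: ltW.
  rewrite !mxE normrM (gtr0_norm r20).
  by case: (_ && _); rewrite ?normr1 ?mulr1// normr0 mulr0 ltW.
move=> /(cinvP ac)[cz zE] Bz; exists (cinv c z) => //.
by apply: chart_interior ac cz _; rewrite zE.
Unshelve. all: by end_near. Qed.

End smooth_manifold_theory.

(** * Curves and their length *)

Section segments.
Context {R : realType}.
Implicit Types (P Q : R -> R -> Prop) (a : R) (s : seq R).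

(** Recursive form of the condition on consecutive break points in [piecewise_smooth], suited to
    induction and to concatenation. *)
Fixpoint segs P a s := if s is b :: s' then P a b /\ segs P b s' else True.

Lemma segsP P a s :
  segs P a s <-> forall i, (i < size s)%N -> P (nth 0 (a :: s) i) (nth 0 s i).
Proof.
elim: s a => [|b s IH] a /=; first by split.
split=> [[Pab /IH h] [|i]//|h]; first by move/h.
split; first exact: (h 0%N).
by apply/IH => i; exact: (h i.+1).
Qed.

Lemma segs_cat P a s s' : segs P a (s ++ s') <-> segs P a s /\ segs P (last a s) s'.
Proof.
elim: s a => [|b s IH] a /=; first by split=> // -[].
by rewrite IH; split=> [[? []]|[[]]].
Qed.

Lemma segs_map P (f : R -> R) a s :
  segs P (f a) (map f s) <-> segs (fun x y => P (f x) (f y)) a s.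
Proof. by elim: s a => //= b s IH a; rewrite IH. Qed.

Lemma segs_impl P Q a s : (forall x y, P x y -> Q x y) -> segs P a s -> segs Q a s.
Proof. by move=> PQ; elim: s a => //= b s IH a [/PQ ? /IH]. Qed.

Lemma path_lt_last a s : path <%R a s -> a <= last a s.
Proof.
elim: s a => //= b s IH a /andP[ab /IH]; apply: le_trans; exact: ltW.
Qed.

Lemma segs_bounds P a s : path <%R a s -> segs P a s ->
  segs (fun x y => [/\ P x y, a <= x, x < y & y <= last a s]) a s.
Proof.
elim: s a => //= b s IH a /andP[ab pb] [Pab sb]; split.
  by split=> //; exact: path_lt_last.
apply: segs_impl (IH _ pb sb) => x y [Pxy bx xy yl]; split=> //.
exact: le_trans (ltW ab) bx.
Qed.

Lemma segs_interior P a s t : segs P a s -> a <= t <= last a s -> t \notin a :: s ->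
  exists x y, [/\ P x y & x < t < y].
Proof.
elim: s a => [|b s IH] a /=.
  by move=> _; rewrite -eq_le inE => /eqP ->; rewrite eqxx.
move=> [Pab sb] /andP[at' tl]; rewrite inE negb_or => /andP[ta tb].
have [tltb|blet] := ltP t b.
  by exists a, b; split => //; rewrite lt_neqAle eq_sym ta at'.
by apply: (IH b) => //; rewrite blet.
Qed.

End segments.

Lemma form_scale (R : realType) n (G : 'M[R]_n) (k : R) (v : 'rV[R]_n) :
  Defs.form G (k *: v) (k *: v) = k ^+ 2 * Defs.form G v v.
Proof. by rewrite /Defs.form linearZ/= -!scalemxAl -scalemxAr !mxE mulrA. Qed.

Section curves_in_manifold.
Context {R : realType} {m : nat} {M : topologicalType}.
Variable X : @smooth_manifold R m.+1 M.
Implicit Types (c : @chart R m.+1 M) (p q : M) (y z : 'rV[R]_m.+1) (gamma : R -> M).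

Lemma atlas_chart_at p : atlas X (chart_at X p).
Proof. by rewrite /chart_at; case: cid => c []. Qed.

Lemma cdom_chart_at p : cdom (chart_at X p) p.
Proof. by rewrite /chart_at; case: cid => c []. Qed.

Lemma near_curve_cdom c gamma (t : R) : atlas X c -> cdom c (gamma t) ->
  {for t, continuous gamma} -> \forall u \near t, cdom c (gamma u).
Proof. by move=> ac ct cg; exact: cg (near_cdom ac ct). Qed.

(** The chain rule, applied to the smooth extension of the transition map that [diff_on] selects. *)
Lemma velocity_change c1 c2 gamma (t : R) : atlas X c1 -> atlas X c2 ->
  cdom c1 (gamma t) -> cdom c2 (gamma t) -> {for t, continuous gamma} ->
  derivable (c1 \o gamma) t 1 ->
  derivable (c2 \o gamma) t 1 /\
  derive1 (c2 \o gamma) t =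
   diff_on (c1 @` (cdom c1 `&` cdom c2)) (c2 \o cinv c1) (c1 (gamma t))
     (derive1 (c1 \o gamma) t).
Proof.
move=> a1 a2 d1 d2 cg dg; rewrite /diff_on.
set F := xget _ _.
have [U [oU Uy sF FA]] : smooth_extension (c1 @` (cdom c1 `&` cdom c2))
    (c2 \o cinv c1) (c1 (gamma t)) F.
  by apply: smooth_on_extends; [exact: (atlas_smooth a1 a2)|exists (gamma t)].
have dF : differentiable F (c1 (gamma t)) by exact: smooth_open_differentiable sF Uy.
have dg' : differentiable (c1 \o gamma) t by apply/derivable1_diffP.
have dFg : differentiable (F \o (c1 \o gamma)) t by exact: differentiable_comp.
have nU : \forall u \near t, U (c1 (gamma u)).
  by apply: (differentiable_continuous dg'); exact: open_nbhs_nbhs.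
have n1 := near_curve_cdom a1 d1 cg.
have n2 := near_curve_cdom a2 d2 cg.
have E : \forall u \near t, (F \o (c1 \o gamma)) u = (c2 \o gamma) u.
  near=> u.
  have u1 : cdom c1 (gamma u) by near: u.
  have u2 : cdom c2 (gamma u) by near: u.
  rewrite /= FA/=; [by rewrite (cmapK a1)|by near: u|by exists (gamma u)].
split; first by apply: near_eq_derivable E _; apply/derivable1_diffP.
rewrite !derive1E -(near_eq_derive (1 : R) E) deriveE// diff_comp//=.
by rewrite (deriveE (1 : R) dg').
Unshelve. all: by end_near. Qed.

(** The transformation law of the metric frees [speed] from the chart [chart_at], which varies with
    the point, so that a whole piece of curve can be studied in one chart. *)
Lemma speedE (g : @tensor R m.+1 M) c gamma (t : R) :
  riemannian X (interior_mfd X) g -> atlas X c ->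
  cdom c (gamma t) -> interior_mfd X (gamma t) -> {for t, continuous gamma} ->
  derivable (c \o gamma) t 1 ->
  speed X g gamma t =
    Num.sqrt (Defs.form (g c (gamma t)) (derive1 (c \o gamma) t) (derive1 (c \o gamma) t)).
Proof.
move=> [_ _ _ gc] ac ct it cg dg; rewrite /speed.
have [_ ->] := velocity_change ac (atlas_chart_at (gamma t)) ct (cdom_chart_at _) cg dg.
by rewrite -gc//; [exact: atlas_chart_at|exact: cdom_chart_at].
Qed.

Lemma segment_derivable c gamma (a b t : R) : smooth_segment X a b gamma ->
  {for t, continuous gamma} -> a < t < b -> atlas X c -> cdom c (gamma t) ->
  derivable (c \o gamma) t 1 /\ {for t, continuous (derive1 (c \o gamma))}.
Proof.
move=> sg cg /andP[ta tb] ac ct.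
have nab : \forall u \near t, a < u < b.
  near=> u; apply/andP; split; near: u; [exact: lt_nbhsr|exact: lt_nbhsl] .
have [F [U [oU Ut sF FA]]] : exists F, smooth_extension
    (`[a, b]%classic `&` gamma @^-1` cdom c) (c \o gamma) t F.
  by apply: sg => //; split => //=; rewrite in_itv/= !ltW.
have nU : \forall u \near t, U u by exact: open_nbhs_nbhs.
have nc := near_curve_cdom ac ct cg.
have E : \forall u \near t, F u = (c \o gamma) u.
  near=> u; apply: FA; first by near: u.
  have /andP[au ub] : a < u < b by near: u.
  split; first by rewrite /= in_itv/= !ltW.
  by rewrite /=; near: u.
split; first by apply: (near_eq_derivable E); exact: (smooth_open_derivable sF).
have E' : \forall u \near t, ('D_1 F) u = derive1 (c \o gamma) u.
  have := near_join E; apply: filterS => u Eu.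
  by rewrite derive1E (near_eq_derive (1 : R) Eu).
apply: near_eq_continuous E' _.
exact: smooth_open_continuous (smooth_open_derive (1 : R) sF) Ut.
Unshelve. all: by end_near. Qed.

Lemma within_continuous_interior gamma (a b t : R) :
  {within `[a, b], continuous gamma} -> a < t < b -> {for t, continuous gamma}.
Proof.
move=> cg /andP[ta tb]; have := @continuous_subspaceW _ _ `]a, b[%classic _ gamma _ cg.
rewrite continuous_open_subspace; last exact: interval_open.
move=> h; have : {in `]a, b[%classic, continuous gamma}.
  by apply: h => x /=; exact: subset_itv_oo_cc.
by apply; rewrite inE/= in_itv/= ta tb.
Qed.

Lemma derive1_affine (V : normedModType R) (f : R -> V) (k e t : R) :
  derivable f (k * t + e) 1 ->
  is_derive t 1 (fun u => f (k * u + e)) (k *: derive1 f (k * t + e)).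
Proof.
move=> df; pose s : {poly R} := k *: 'X + e%:P.
have sE u : s.[u] = k * u + e by rewrite /s !hornerE.
have := @is_derive_poly_line R _ _ f 0 1 s t.
have lE (u : R) : 0 + s.[u] *: (1 : R) = k * u + e.
  by rewrite add0r [_ *: _]mulr1 sE.
rewrite lE => /(_ df); rewrite /s derivD derivZ derivX derivC addr0 hornerZ hornerE mulr1.
rewrite derive1E; under eq_fun do rewrite -/s lE; exact.
Qed.

Lemma speed_affine (g : @tensor R m.+1 M) gamma gamma' (k e t : R) : 0 <= k ->
  (\forall u \near t, gamma' u = gamma (k * u + e)) ->
  derivable (chart_at X (gamma (k * t + e)) \o gamma) (k * t + e) 1 ->
  speed X g gamma' t = k * speed X g gamma (k * t + e).
Proof.
move=> k0 E dg; rewrite /speed (nbhs_singleton E).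
set c := chart_at X _.
have -> : derive1 (c \o gamma') t = k *: derive1 (c \o gamma) (k * t + e).
  have := derive1_affine dg => -[_ <-]; rewrite derive1E.
  by apply: near_eq_derive; move: E; apply: filterS => u /= ->.
by rewrite form_scale sqrtrM ?sqr_ge0// sqrtr_sqr ger0_norm.
Qed.

Lemma smooth_segment_affine gamma gamma' (k e a b a' b' : R) :
  smooth_segment X a b gamma ->
  (forall t, a' <= t <= b' -> a <= k * t + e <= b /\ gamma' t = gamma (k * t + e)) ->
  smooth_segment X a' b' gamma'.
Proof.
move=> sg H c ac t [/=]; rewrite in_itv/= => /H[tab tE] ct.
have [F [U [oU Ut sF FA]]] : exists F, smooth_extension
    (`[a, b]%classic `&` gamma @^-1` cdom c) (c \o gamma) (k * t + e) F.
  by apply: sg => //; split; rewrite /= ?in_itv//= -tE.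
pose s : {poly R} := k *: 'X + e%:P.
have lE (u : R) : 0 + s.[u] *: (1 : R) = k * u + e.
  by rewrite add0r [_ *: _]mulr1 /s !hornerE.
exists (fun u => F (0 + s.[u] *: (1 : R))), [set u | U (0 + s.[u] *: (1 : R))].
split => //=.
- apply: (@open_comp _ _ (fun u : R => 0 + s.[u] *: (1 : R))) => // u _.
  under eq_fun do rewrite lE; apply: cvgD; last exact: cvg_cst.
  by apply: cvgM; [exact: cvg_cst|exact: cvg_id].
- by rewrite lE.
- exact: smooth_poly_line.
- move=> u; rewrite lE => Uu [/=]; rewrite in_itv/= => /H[uab uE] cu.
  by rewrite FA//= ?uE//; split; rewrite /= ?in_itv//= -uE.
Qed.

Lemma within_continuous_affine gamma gamma' (k e a b a' b' : R) :
  {within `[a, b], continuous gamma} ->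
  (forall t, a' <= t <= b' -> a <= k * t + e <= b /\ gamma' t = gamma (k * t + e)) ->
  {within `[a', b'], continuous gamma'}.
Proof.
move=> /subspace_continuousP cg H; apply/subspace_continuousP => t /=.
rewrite in_itv/= => tab; have [kt tE] := H _ tab.
have cl : k * u + e @[u --> t] --> k * t + e.
  apply: cvgD; last exact: cvg_cst.
  by apply: cvgM; [exact: cvg_cst|exact: cvg_id].
suff : gamma' u @[u --> within `[a', b'] (nbhs t)] --> gamma' t by [].
rewrite tE => B /= gB.
have : \forall u \near k * t + e, `[a, b]%classic u -> B (gamma u).
  by apply: cg gB; rewrite /= in_itv.
move=> /cl nB; suff : \forall u \near t, `[a', b']%classic u -> B (gamma' u) by [].
have nB' : \forall u \near t, `[a, b]%classic (k * u + e) -> B (gamma (k * u + e)) by exact: nB.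
move: nB'; apply: filterS => u /= h.
by rewrite in_itv/= => /H[ku ->]; apply: h; rewrite in_itv.
Qed.

End curves_in_manifold.

(** * Concatenation of curves and the triangle inequality *)

Section concatenation.
Context {R : realType} {m : nat} {M : topologicalType}.
Variable X : @smooth_manifold R m.+1 M.
Variable g : @tensor R m.+1 M.
Implicit Types (gamma : R -> M).

Lemma speed_ge0 gamma (t : R) : (0 <= (speed X g gamma t)%:E)%E.
Proof. by rewrite lee_fin sqrtr_ge0. Qed.

Lemma curve_length_ge0 gamma : (0 <= curve_length X g gamma)%E.
Proof. by apply: integral_ge0 => t _; exact: speed_ge0. Qed.

(** Both branches have the shape [k * t + e] of the lemmas on affine reparametrisation. *)
Definition concat gamma1 gamma2 (t : R) : M :=
  if t <= 2^-1 then gamma1 (2 * t + 0) else gamma2 (2 * t + -1).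

Lemma concat_l gamma1 gamma2 (t : R) : t <= 2^-1 ->
  concat gamma1 gamma2 t = gamma1 (2 * t + 0).
Proof. by rewrite /concat => ->. Qed.

Lemma concat_r gamma1 gamma2 (t : R) : gamma1 1 = gamma2 0 -> 2^-1 <= t ->
  concat gamma1 gamma2 t = gamma2 (2 * t + -1).
Proof.
rewrite /concat => E t2; case: ifPn => // t2'.
have -> : t = 2^-1 by apply/le_anti; rewrite t2' t2.
by rewrite divff ?pnatr_eq0// addr0 subrr.
Qed.

Lemma piecewise_smooth_concat gamma1 gamma2 :
  piecewise_smooth X gamma1 -> piecewise_smooth X gamma2 -> gamma1 1 = gamma2 0 ->
  piecewise_smooth X (concat gamma1 gamma2).
Proof.
pose P gamma a b := smooth_segment X a b gamma.
move=> [c1 [s1 [p1 l1 h1']]] [c2 [s2 [p2 l2 h2']]] E.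
have h1 := (segsP (P gamma1) 0 s1).2 h1'; have h2 := (segsP (P gamma2) 0 s2).2 h2'.
have cl := @concat_l gamma1 gamma2; have cr t := @concat_r gamma1 gamma2 t E.
split.
  have -> : `[0, 1]%classic = `[0, 2^-1]%classic `|` `[2^-1, 1]%classic :> set R.
    apply/seteqP; split=> t /=; rewrite !in_itv/=.
      by move=> /andP[t0 t1]; have [t2|t2] := leP t 2^-1; [left; rewrite t0|right; rewrite ltW].
    by move=> [|] /andP[? ?]; apply/andP; split; lra.
  apply: withinU_continuous; [exact: interval_closed|exact: interval_closed| |].
  - apply: (within_continuous_affine (k := 2) (e := 0) c1) => t /andP[t0 t1].
    by split; [apply/andP; split; lra|exact: cl].
  - apply: (within_continuous_affine (k := 2) (e := -1) c2) => t /andP[t0 t1].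
    by split; [apply/andP; split; lra|exact: cr].
pose f1 (x : R) := 2^-1 * x; pose f2 (x : R) := 2^-1 * x + 2^-1.
have f10 : f1 0 = 0 by rewrite /f1 mulr0.
have lf1 : last 0 (map f1 s1) = f2 0.
  by rewrite -[X in last X]f10 last_map l1 /f1 /f2 mulr1 mulr0 add0r.
exists (map f1 s1 ++ map f2 s2); split.
- rewrite cat_path lf1; apply/andP; split.
    rewrite -[X in path _ X]f10; apply: homo_path p1 => x y xy.
    by rewrite /f1 ltr_pM2l.
  by apply: homo_path p2 => x y xy; rewrite /f2 ltrD2r ltr_pM2l.
- by rewrite last_cat lf1 last_map l2 /f2; lra.
- apply/(segsP (P (concat gamma1 gamma2))); apply/segs_cat; rewrite lf1; split.
    rewrite -[X in segs _ X]f10; apply/segs_map.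
    apply: segs_impl (segs_bounds p1 h1) => x y [sxy x0 xy]; rewrite l1 => y1.
    apply: (smooth_segment_affine (k := 2) (e := 0) sxy) => t.
    rewrite /f1 => /andP[t0 t1]; split; first by apply/andP; split; lra.
    by apply: cl; lra.
  apply/segs_map; apply: segs_impl (segs_bounds p2 h2) => x y [sxy x0 xy].
  rewrite l2 => y1; apply: (smooth_segment_affine (k := 2) (e := -1) sxy) => t.
  rewrite /f2 => /andP[t0 t1]; split; first by apply/andP; split; lra.
  by apply: cr; lra.
Qed.

(** Doubling the speed compensates for halving the time. The speeds are compared only off the break
    points, a finite and hence null set. *)
Lemma length_half gamma gamma' (a : R) : piecewise_smooth X gamma ->
  (forall t, a <= t <= a + 2^-1 -> gamma' t = gamma (2 * t + (- (2 * a)))) ->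
  (\int[lebesgue_measure]_(t in `[a, (a + 2^-1)%R]) (speed X g gamma' t)%:E =
   curve_length X g gamma)%E.
Proof.
move=> [cg [s [ps ls hs']]] E.
have hs := (segsP (fun a b => smooth_segment X a b gamma) 0 s).2 hs'.
have h0 : 0 < 2^-1 :> R by [].
have := @lower_integral_affine R 2^-1 a 0 1 (fun t => (speed X g gamma' t)%:E) h0
  (speed_ge0 _).
rewrite mulr0 add0r mulr1 [2^-1 + a]addrC => ->.
have mN : measurable [set` 0 :: s].
  apply: countable_measurable; first by move=> x; exact: measurable_set1.
  exact: (finite_set_countable (finite_seq _)).
have N0 : lebesgue_measure [set` 0 :: s] = 0%E.
  by apply: countable_lebesgue_measure0; exact: (finite_set_countable (finite_seq _)).
have EQ := @eq_lower_integral _ (measurableTypeR R) R lebesgue_measure `[0, 1]%classic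
  [set` 0 :: s] (fun t => (speed X g gamma' (2^-1 * t + a))%:E)
  (fun t => (2%:E * (speed X g gamma t)%:E)%E) (measurable_itv _) mN N0
  (fun t _ => speed_ge0 _ _).
have LZ := @lower_integralZ _ (measurableTypeR R) R lebesgue_measure `[0, 1]%classic
  2 (fun t => (speed X g gamma t)%:E) (measurable_itv _) (ltr0Sn _ 1) (speed_ge0 gamma).
rewrite EQ ?LZ.
- by rewrite muleA -EFinM mulVf ?pnatr_eq0// mul1e.
- by move=> x _; rewrite mule_ge0// speed_ge0.
move=> t /=; rewrite in_itv/= => /andP[t0 t1] /negP tN.
have [|x [y [sxy xty]]] := segs_interior hs _ tN; first by rewrite t0 ls.
(* Both 0 and 1 occur in [0 :: s], so a time off the break points is an inner one. *)
have tp : 0 < t < 1.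
  have /andP[n0 n1] : (t != 0) && (t != 1).
    move: tN; rewrite inE negb_or => /andP[-> ns] /=; apply: contra ns => /eqP ->.
    case: (s) ps ls => [_ /= /eqP|b s' _ <-]; first by rewrite eq_sym oner_eq0.
    by rewrite /= mem_last.
  by rewrite !lt_neqAle eq_sym n0 t0 n1.
have tc := within_continuous_interior cg tp.
have te : 2 * (2^-1 * t + a) + - (2 * a) = t by lra.
rewrite (@speed_affine _ _ _ _ _ gamma _ 2 (- (2 * a))) ?te//.
  have : \forall u \near 2^-1 * t + a, a < u < a + 2^-1.
    near=> u; apply/andP; split; near: u; [apply: lt_nbhsr|apply: lt_nbhsl].
      by move: tp => /andP[]; lra.
    by move: tp => /andP[]; lra.
  by apply: filterS => u /andP[au ua]; apply: E; rewrite !ltW.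
by have [] := segment_derivable sxy tc xty (atlas_chart_at X _) (cdom_chart_at X _).
Unshelve. all: by end_near. Qed.

Lemma curve_length_concat gamma1 gamma2 :
  piecewise_smooth X gamma1 -> piecewise_smooth X gamma2 -> gamma1 1 = gamma2 0 ->
  (curve_length X g (concat gamma1 gamma2) <=
   curve_length X g gamma1 + curve_length X g gamma2)%E.
Proof.
move=> s1 s2 E.
have s01 : `[0, 1]%classic = `[0, 2^-1]%classic `|` `]2^-1, 1]%classic :> set R.
  apply/seteqP; split=> t /=; rewrite !in_itv/=.
    by move=> /andP[t0 t1]; have [t2|t2] := leP t 2^-1; [left; rewrite t0|right].
  by move=> [|] /andP[? ?]; apply/andP; split; lra.
have dj : `[0, 2^-1]%classic `&` `]2^-1, 1]%classic = set0 :> set R.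
  apply/seteqP; split => // t /= []; rewrite !in_itv/= => /andP[_ t1] /andP[t2 _].
  by move: (le_lt_trans t1 t2); rewrite ltxx.
have I := @lower_integral_setU _ _ R lebesgue_measure _ _
  (fun t => (speed X g (concat gamma1 gamma2) t)%:E) (measurable_itv _) (measurable_itv _)
  dj (fun t _ => speed_ge0 _ t).
rewrite -s01 in I; rewrite {1}/curve_length I.
have := @length_half gamma1 (concat gamma1 gamma2) 0 s1; rewrite add0r mulr0 oppr0 => <-; last first.
  by move=> t /andP[_ t2]; exact: concat_l.
have := @length_half gamma2 (concat gamma1 gamma2) 2^-1 s2.
have -> : 2^-1 + 2^-1 = 1 :> R by lra.
have -> : 2 / 2 = 1 :> R by lra.
move=> <-; last by move=> t /andP[t2 _]; exact: concat_r.
rewrite leeD2l//; apply: lower_integral_subset => //.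
  by move=> t /=; rewrite !in_itv/= => /andP[/ltW -> ->].
by move=> t _; exact: speed_ge0.
Qed.

Lemma interior_dist_ge0 p q : (0 <= interior_dist X g p q)%E.
Proof. by apply: le_ereal_inf_tmp => _ [gamma _ <-]; exact: curve_length_ge0. Qed.

Lemma interior_dist_triangle p q r :
  (interior_dist X g p r <= interior_dist X g p q + interior_dist X g q r)%E.
Proof.
apply: ereal_infD_ge => [_ [gamma _ <-]|_ [gamma _ <-]|].
- exact: curve_length_ge0.
- exact: curve_length_ge0.
move=> _ _ [gamma1 [s1 a1 b1 i1] <-] [gamma2 [s2 a2 b2 i2] <-].
have E : gamma1 1 = gamma2 0 by rewrite b1 a2.
apply: le_trans (curve_length_concat s1 s2 E); apply: ereal_inf_lbound.
exists (concat gamma1 gamma2) => //; split.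
- exact: piecewise_smooth_concat.
- by rewrite concat_l// mulr0 addr0.
- have h1 : 2^-1 <= 1 :> R by lra.
  by rewrite (concat_r E h1) -b2; congr gamma2; lra.
move=> t; rewrite in_itv/= => /andP[t0 t1].
have [t2|/ltW t2] := leP t 2^-1.
  by rewrite concat_l//; apply: i1; rewrite in_itv/=; apply/andP; split; lra.
by rewrite concat_r//; apply: i2; rewrite in_itv/=; apply/andP; split; lra.
Qed.

End concatenation.

(** * Local bounds for the metric *)

Section forms.
Context {R : realType}.

Lemma formE n (G : 'M[R]_n) (v : 'rV[R]_n) :
  Defs.form G v v = \sum_j (\sum_i v 0 i * G i j) * v 0 j.
Proof.
by rewrite /Defs.form mxE; apply: eq_bigr => j _; rewrite !mxE.
Qed.

Lemma form_continuous n (G : 'M[R]_n) : continuous (fun v : 'rV[R]_n => Defs.form G v v).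
Proof.
move=> v.
have -> : (fun v : 'rV[R]_n => Defs.form G v v) =
    \sum_(j < n) ((\sum_(i < n) (fun v : 'rV[R]_n => v 0 i * G i j)) * (fun v => v 0 j)).
  by apply/funext => w; rewrite formE fct_sumE; apply: eq_bigr => j _; rewrite mulrfctE fct_sumE.
apply: (@differentiable_continuous); apply: differentiable_sum => j.
apply: differentiableM; last exact: differentiable_coord.
apply: differentiable_sum => i; apply: differentiableM => //.
exact: differentiable_coord.
Qed.

Lemma form_le n (G : 'M[R]_n) (v : 'rV[R]_n) :
  `|Defs.form G v v| <= n%:R ^+ 2 * `|G| * `|v| ^+ 2.
Proof.
rewrite formE; apply: (le_trans (ler_norm_sum _ _ _)).
have -> : n%:R ^+ 2 * `|G| * `|v| ^+ 2 = \sum_(j < n) (n%:R * (`|v| * `|G|)) * `|v|.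
  by rewrite sumr_const card_ord -[RHS]mulr_natl expr2; ring.
apply: ler_sum => j _; rewrite normrM; apply: ler_pM => //; last exact: entry_le_norm.
apply: (le_trans (ler_norm_sum _ _ _)).
rewrite mulr_natl -[X in _ *+ X]card_ord -sumr_const; apply: ler_sum => i _.
by rewrite normrM; apply: ler_pM => //; exact: entry_le_norm.
Qed.

Lemma formD n (G E : 'M[R]_n) (v : 'rV[R]_n) :
  Defs.form (G + E) v v = Defs.form G v v + Defs.form E v v.
Proof. by rewrite /Defs.form mulmxDr mulmxDl mxE. Qed.

Lemma formZ n (G : 'M[R]_n) (k : R) (v : 'rV[R]_n) :
  Defs.form (k *: G) v v = k * Defs.form G v v.
Proof. by rewrite /Defs.form -scalemxAr -scalemxAl mxE. Qed.

(** The constant is the minimum of the form on the compact unit sphere of the sup norm; homogeneity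
    does the rest. *)
Lemma form_coercive n (G : 'M[R]_n.+1) : (forall v, v != 0 -> 0 < Defs.form G v v) ->
  exists2 mu : R, 0 < mu & forall v, mu * `|v| ^+ 2 <= Defs.form G v v.
Proof.
move=> pos; pose S := [set v : 'rV[R]_n.+1 | `|v| = 1].
have S0 : S !=set0.
  exists (const_mx 1); apply/eqP; rewrite eq_le; apply/andP; split.
    by apply: mx_norm_le => // i j; rewrite mxE normr1.
  by have := entry_le_norm (const_mx 1 : 'rV[R]_n.+1) 0 0; rewrite mxE normr1.
have cS : compact S.
  apply: bounded_closed_compact.
    by exists 1; split => // x x1 v /= ->; exact: ltW.
  have -> : S = (fun v : 'rV[R]_n.+1 => `|v|) @^-1` [set 1] by [].
  apply: closed_comp => [v _|]; first exact: norm_continuous.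
  exact: closed_eq.
have [v0 /set_mem v0S v0min] := EVT_min_rV S0 cS (continuous_subspaceT (@form_continuous _ G)).
have v00 : v0 != 0 by apply: contra_eq_neq v0S => ->; rewrite normr0 eq_sym oner_eq0.
exists (Defs.form G v0 v0) => [|v]; first exact: pos.
have [->|vn0] := eqVneq v 0.
  by rewrite normr0 expr0n mulr0 /Defs.form !mul0mx mxE.
have vp : 0 < `|v| by rewrite normr_gt0.
have {2 3}-> : v = `|v| *: (`|v|^-1 *: v) by rewrite scalerA divff ?gt_eqF// scale1r.
rewrite form_scale mulrC ler_wpM2l ?sqr_ge0//; apply: v0min; apply/mem_set => /=.
by rewrite /S/= normrZ ger0_norm ?invr_ge0// mulVf// gt_eqF.
Qed.

Lemma form_bounds_near n (G : 'M[R]_n.+1) : (forall v, v != 0 -> 0 < Defs.form G v v) ->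
  exists a b e : R, [/\ 0 < a, 0 < b, 0 < e &
    forall G', `|G' - G| < e -> forall v,
      a * `|v| ^+ 2 <= Defs.form G' v v <= b * `|v| ^+ 2].
Proof.
move=> /form_coercive[mu mu0 Hmu]; pose N := n.+1%:R ^+ 2 : R.
have N0 : 0 < N by rewrite exprn_gt0.
have b0 : 0 < N * `|G| + mu by rewrite ltr_wpDl// mulr_ge0// ltW.
(* By [form_le], a perturbation smaller than [mu / 2 / N] changes the form by at most half of the
   coercivity bound. *)
exists (mu / 2), (N * `|G| + mu), (mu / 2 / N); split; rewrite ?divr_gt0//.
move=> G' G'G v; have -> : G' = G + (G' - G) by rewrite addrC subrK.
rewrite formD; have h1 := Hmu v; have h2 := form_le G v; have h3 := form_le (G' - G) v.
have v2 : 0 <= `|v| ^+ 2 by rewrite sqr_ge0.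
have h4 : N * `|G' - G| * `|v| ^+ 2 <= mu / 2 * `|v| ^+ 2.
  by rewrite ler_wpM2r// mulrC -ler_pdivlMr// ltW.
move: h2 h3 h4; rewrite -/N !ler_norml => /andP[_ h2] /andP[h3 h3'] h4.
have p2 : 0 <= mu * `|v| ^+ 2 by rewrite mulr_ge0// ltW.
by rewrite mulrDl; apply/andP; split; lra.
Qed.

End forms.

Lemma smooth_on_near (R : realType) (V W : normedModType R) (A : set V) (f : V -> W) y :
  smooth_on A f -> A y -> forall e, 0 < e -> exists2 r : R, 0 < r &
    forall z, `|y - z| < r -> A z -> `|f z - f y| < e.
Proof.
move=> sf Ay e e0; have [F [U [oU Uy sF FA]]] := sf y Ay.
have cF := smooth_open_continuous sF Uy.
have : \forall z \near y, U z /\ `|F z - F y| < e.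
  near=> z; split; first by near: z; exact: open_nbhs_nbhs.
  by rewrite distrC; near: z; move/cvgrPdist_lt : cF; exact.
move=> /near_normP[r r0 hr]; exists r => // z yz Az.
by have [Uz] := hr z yz; rewrite !FA.
Unshelve. all: by end_near. Qed.

Section local_model.
Context {R : realType} {m : nat} {M : topologicalType}.
Variable X : @smooth_manifold R m.+1 M.
Variable g : @tensor R m.+1 M.
Implicit Types (c : @chart R m.+1 M) (p q : M) (y z v : 'rV[R]_m.+1).

(* Both kinds of points are treated at once: the exponent [e] is [alpha] at
   boundary points and [0] at interior points. *)
Record local_model (e : R) c p (r a b : R) : Prop := LocalModel {
  lm_atlas : atlas X c;
  lm_dom : cdom c p;
  lm_r : 0 < r;
  lm_a : 0 < a;
  lm_b : 0 < b;
  lm_image : forall y, `|c p - y| < r -> 0 <= y 0 ord0 -> (c @` cdom c) y;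
  lm_form : forall y v, `|c p - y| < r -> 0 < y 0 ord0 ->
    a * y 0 ord0 `^ (- e) * `|v| ^+ 2 <= Defs.form (g c (cinv c y)) v v
      <= b * y 0 ord0 `^ (- e) * `|v| ^+ 2 }.

Lemma near_chart_ball c p : atlas X c -> cdom c p ->
  exists2 r : R, 0 < r & forall y, `|c p - y| < r -> 0 <= y 0 ord0 -> (c @` cdom c) y.
Proof. by move=> ac cp; have /near_normP := near_chart_image ac cp. Qed.

(** The bound on [r] by the height of [c p] keeps the ball in the open half-space. *)
Lemma local_model_interior p : riemannian X (interior_mfd X) g -> interior_mfd X p ->
  exists c r a b, local_model 0 c p r a b /\ r <= c p 0 ord0.
Proof.
move=> [gs _ gpos _] ip; have [c [ac cp]] := atlas_cover X p.
have c0 := interior_chart ac cp ip.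
have cim : (c @` (cdom c `&` interior_mfd X)) (c p) by exists p.
have [a [b [e [a0 b0 e0 Hab]]]] := form_bounds_near (fun v => gpos c p v ac cp ip).
have [r1 r10 H1] := smooth_on_near (gs c ac) cim e0.
have [r2 r20 H2] := near_chart_ball ac cp.
pose r := Num.min (c p 0 ord0) (Num.min r1 r2).
have r0 : 0 < r by rewrite !lt_min c0 r10 r20.
exists c, r, a, b; split; last by rewrite ge_min lexx.
split => // [y yr|y v yr y0].
  by apply: H2; apply: lt_le_trans yr _; rewrite !ge_min lexx !orbT.
have yim : (c @` cdom c) y.
  by apply: H2; [apply: lt_le_trans yr _; rewrite !ge_min lexx !orbT|exact: ltW].
have [cy cyE] := cinvP ac yim.
have iy : interior_mfd X (cinv c y) by apply: (chart_interior ac cy); rewrite cyE.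
rewrite oppr0 powRr0 !mulr1; apply: Hab.
have := H1 y; rewrite (cmapK ac cp); apply.
  by apply: lt_le_trans yr _; rewrite !ge_min lexx !orbT.
by exists (cinv c y).
Qed.

(** As [x] vanishes on the hyperplane, its tangential derivatives at [c p] are 0, so the nonzero
    differential forces a nonzero normal derivative [k]. The mean value theorem in the normal
    direction then compares [x] with the height. *)
Lemma defining_function_bounds (x : M -> R) c p : boundary_defining X x ->
  boundary X p -> atlas X c -> cdom c p ->
  exists k r : R, [/\ 0 < k, 0 < r & forall y, `|c p - y| < r -> 0 < y 0 ord0 ->
    k / 2 * y 0 ord0 <= x (cinv c y) <= 2 * k * y 0 ord0].
Proof.
move=> [xs xpos x0 xd] bp ac cp; have [w] := xd p c bp ac cp.
rewrite /diff_on; set F := xget _ _; set y0 := c p => dFw.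
have y00 : y0 0 ord0 = 0 := boundary_chart ac cp bp.
have [U [oU Uy sF FA]] : smooth_extension (c @` cdom c) (x \o cinv c) y0 F.
  by apply: smooth_on_extends; [exact: xs|exists p].
have dF : differentiable F y0 by exact: smooth_open_differentiable_real sF Uy.
have [r1 r10 H1] := near_chart_ball ac cp.
have [r2 r20 H2] : exists2 r : R, 0 < r & forall z, `|y0 - z| < r -> U z.
  by apply/near_normP; exact: open_nbhs_nbhs.
have FX y : `|y0 - y| < r1 -> `|y0 - y| < r2 -> 0 <= y 0 ord0 -> F y = x (cinv c y).
  by move=> h1 h2 h3; apply: FA; [exact: H2|exact: H1].
have F0 y : `|y0 - y| < r1 -> `|y0 - y| < r2 -> y 0 ord0 = 0 -> F y = 0.
  move=> h1 h2 h3; rewrite FX ?h3//; apply: x0.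
  have yim : (c @` cdom c) y by apply: H1; rewrite ?h3.
  have [cy cyE] := cinvP ac yim.
  by exists c; split => //; rewrite cyE; apply/halfspace_boundaryE.
pose k := 'D_(delta_mx 0 ord0) F y0.
have k0 : k != 0.
  apply: contra dFw => /eqP kE.
  rewrite [w]row_sum_delta linear_sum/= big1// => j _; rewrite linearZ/= -deriveE//.
  have [->|j0] := eqVneq j ord0; first by rewrite -/k kE scaler0.
  suff -> : 'D_(delta_mx 0 j) F y0 = 0 by rewrite scaler0.
  have dl : derivable F (y0 + 0 *: delta_mx 0 j) (delta_mx 0 j).
    by rewrite scale0r addr0; exact: smooth_open_derivable sF Uy.
  have := is_derive_line dl; rewrite scale0r addr0 => -[_ <-].
  rewrite (@near_eq_derive _ _ _ _ (fun=> 0)) ?derive_cst//.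
  apply/near_normP; exists (Num.min r1 r2); first by rewrite lt_min r10 r20.
  move=> t; rewrite sub0r normrN lt_min => /andP[t1 t2].
  have tE : `|y0 - (y0 + t *: delta_mx 0 j)| <= `|t|.
    rewrite opprD addrA subrr add0r normrN normrZ ler_piMr//.
    by apply: mx_norm_le => // i l; rewrite mxE; case: (_ && _); rewrite ?normr1 ?normr0.
  apply: F0; [exact: le_lt_trans tE t1|exact: le_lt_trans tE t2|].
  by rewrite !mxE y00 eqxx/= eq_sym (negbTE j0) mulr0 addr0.
have ck : {for y0, continuous ('D_(delta_mx 0 ord0) F)}.
  exact: smooth_open_continuous (smooth_open_derive _ sF) Uy.
have k2 : 0 < `|k| / 2 by rewrite divr_gt0// normr_gt0.
have [r3 r30 H3] : exists2 r : R, 0 < r & forall z, `|y0 - z| < r ->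
    `|k - 'D_(delta_mx 0 ord0) F z| < `|k| / 2.
  by apply/near_normP; move/cvgrPdist_lt : ck; exact.
pose r := Num.min r1 (Num.min r2 r3).
have r0 : 0 < r by rewrite !lt_min r10 r20 r30.
have rr y : `|y0 - y| < r -> [/\ `|y0 - y| < r1, `|y0 - y| < r2 & `|y0 - y| < r3].
  by rewrite !lt_min => /and3P[].
have Fy y : `|y0 - y| < r -> 0 < y 0 ord0 -> exists2 D : R,
    `|k - D| < `|k| / 2 & x (cinv c y) = y 0 ord0 * D.
  (* [y'] is the foot of [y] on the hyperplane, where [F] vanishes; for the sup norm the vertical
     segment from [y'] to [y] stays in the ball. *)
  move=> yr yp; pose y' := y - y 0 ord0 *: delta_mx 0 ord0.
  have yt (t : R) : 0 <= t <= 1 -> `|y0 - (y' + t *: (y 0 ord0 *: delta_mx 0 ord0))| < r.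
    move=> /andP[t0 t1]; apply: le_lt_trans yr; apply: mx_norm_le => // i j.
    rewrite !mxE !ord1 eqxx/=; have [->|j0] := eqVneq j ord0.
      rewrite mulr1 subrr add0r y00 sub0r normrN normrM (ger0_norm t0).
      apply: le_trans (entry_le_norm (y0 - y) 0 ord0).
      by rewrite !mxE y00 sub0r normrN ler_piMl.
    by rewrite !mulr0 subr0 addr0; have := entry_le_norm (y0 - y) 0 j; rewrite !mxE.
  have y'r : `|y0 - y'| < r by have := yt 0; rewrite scale0r addr0 lexx ler01; exact.
  have [t /yt tr|t t01 E] := @MVT_dir _ _ F y' (y 0 ord0 *: delta_mx 0 ord0).
    apply: (smooth_open_derivable sF); apply: H2.
    by have [] := rr _ tr.
  have [h1 h2 h3] := rr _ (yt _ t01).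
  exists ('D_(delta_mx 0 ord0) F (y' + t *: (y 0 ord0 *: delta_mx 0 ord0))).
    exact: H3.
  have [_ dZ] := is_derive_dirZ (y 0 ord0)
    (smooth_open_derivable (v := delta_mx 0 ord0) sF (H2 _ h2)).
  have {}dZ : _ = y 0 ord0 * _ := dZ.
  rewrite -dZ -E subrK; have [q1 q2 _] := rr _ yr; have [q1' q2' _] := rr _ y'r.
  rewrite FX//; last exact: ltW.
  by rewrite F0 ?subr0// !mxE/= mulr1 subrr.
(* The sign of [k] is that of [x] at one point above [y0], and [x] is positive in the interior. *)
have kp : 0 < k.
  pose y := y0 + (r / 2) *: delta_mx 0 ord0.
  have r20' : 0 < r / 2 by rewrite divr_gt0.
  have yp : 0 < y 0 ord0 by rewrite !mxE/= y00 add0r mulr1.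
  have yr : `|y0 - y| < r.
    rewrite /y opprD addrA subrr add0r normrN normrZ gtr0_norm//.
    apply: (@le_lt_trans _ _ (r / 2)); last by rewrite ltr_pdivrMr// ltr_pMr// ltr1n.
    rewrite ler_piMr ?(ltW r20')//.
    by apply: mx_norm_le => // i l; rewrite mxE; case: (_ && _); rewrite ?normr1 ?normr0.
  have [D kD xE] := Fy y yr yp.
  have yim : (c @` cdom c) y by have [h1 _ _] := rr _ yr; apply: H1 => //; exact: ltW.
  have [cy cyE] := cinvP ac yim.
  have : 0 < x (cinv c y) by apply: xpos; apply: (chart_interior ac cy); rewrite cyE.
  rewrite xE pmulr_rgt0// => D0; rewrite lt_neqAle eq_sym k0/= leNgt.
  apply/negP => kn; move: kD; rewrite ltr_norml (ltr0_norm kn) => /andP[kD _]; lra.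
exists k, r; split => // y yr yp; have [D kD ->] := Fy y yr yp.
move: kD; rewrite (gtr0_norm kp) ltr_norml => /andP[kD1 kD2].
by rewrite ![_ * y 0 ord0]mulrC !ler_pM2l//; apply/andP; split; lra.
Qed.

Lemma local_model_boundary (alpha : R) p : 0 < alpha -> gas_giant X alpha g ->
  boundary X p -> exists c r a b, local_model alpha c p r a b.
Proof.
move=> alpha0 [_ [x [gbar [xd [gs _ gpos _] gE]]]] bp.
have [c [ac cp]] := atlas_cover X p.
have cim : (c @` (cdom c `&` setT)) (c p) by exists p.
have [a [b [e [a0 b0 e0 Hab]]]] := form_bounds_near (fun v => gpos c p v ac cp I).
have [r1 r10 H1] := smooth_on_near (gs c ac) cim e0.
have [r2 r20 H2] := near_chart_ball ac cp.
have [k [r3 [k0 r30 H3]]] := defining_function_bounds xd bp ac cp.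
pose r := Num.min r3 (Num.min r1 r2).
have r0 : 0 < r by rewrite !lt_min r30 r10 r20.
have k20 : 0 < k / 2 by rewrite divr_gt0.
have k2' : 0 < 2 * k by rewrite mulr_gt0.
(* The exponent [- alpha] is negative: the upper bound [2 * k] for [x] over the height yields the
   lower constant, and [k / 2] the upper one. *)
exists c, r, (a * (2 * k) `^ (- alpha)), (b * (k / 2) `^ (- alpha)).
have rr y : `|c p - y| < r -> [/\ `|c p - y| < r3, `|c p - y| < r1 & `|c p - y| < r2].
  by rewrite !lt_min => /and3P[].
split => //; rewrite ?mulr_gt0 ?powR_gt0//.
  by move=> y /rr[_ _]; exact: H2.
move=> y v /rr[h3 h1 h2] y0.
have yim : (c @` cdom c) y by apply: H2 => //; exact: ltW.
have [cy cyE] := cinvP ac yim.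
have iy : interior_mfd X (cinv c y) by apply: (chart_interior ac cy); rewrite cyE.
have /andP[x1 x2] := H3 y h3 y0.
have xp : 0 < x (cinv c y) by case: xd => _ xp _ _; exact: xp.
have /andP[f1 f2] : a * `|v| ^+ 2 <= Defs.form (gbar c (cinv c y)) v v <= b * `|v| ^+ 2.
  apply: Hab; have := H1 y; rewrite (cmapK ac cp); apply => //.
  by exists (cinv c y).
have v2 : 0 <= `|v| ^+ 2 by rewrite sqr_ge0.
rewrite gE// formZ.
have pM (k' : R) : 0 < k' ->
    k' `^ (- alpha) * y 0 ord0 `^ (- alpha) = (k' * y 0 ord0) `^ (- alpha).
  by move=> k'0; rewrite powRM ?(ltW k'0) ?(ltW y0).
rewrite -(mulrA a) -(mulrA b) !pM//.
have powN (s t : R) : 0 < s -> s <= t -> t `^ (- alpha) <= s `^ (- alpha).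
  move=> s0 st; have t0 := lt_le_trans s0 st.
  rewrite !powRN lef_pV2 ?posrE ?powR_gt0//.
  by apply: ge0_ler_powR; rewrite ?nnegrE ?(ltW alpha0) ?(ltW s0) ?(ltW t0).
have p1 := powN _ _ xp x2.
have p2 := powN _ _ (mulr_gt0 k20 y0) x1.
have av0 : 0 <= a * `|v| ^+ 2 by rewrite mulr_ge0 ?(ltW a0).
have f0 := le_trans av0 f1.
set P := (2 * k * _) `^ _ in p1 *; set Q := (k / 2 * _) `^ _ in p2 *.
have P0 : 0 <= P by exact: powR_ge0.
by rewrite [a * _]mulrC [b * _]mulrC -!mulrA !ler_pM// powR_ge0.
Qed.

End local_model.

(** * Upper and lower bounds for the distance *)

(** For the profile [t ^+ k], squared derivative against the power [e] of the height: the exponents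
    [2 * (k - 1)] and [k * e] of a base at most 1 are compared. *)
Lemma profile_pow (R : realType) (e : R) (k : nat) (t : R) :
  0 <= e -> (2 <= k)%N -> k%:R * e <= 2 * k%:R - 2 -> 0 <= t <= 1 ->
  (k%:R * t ^+ k.-1) ^+ 2 <= k%:R ^+ 2 * (t ^+ k) `^ e.
Proof.
move=> e0 k2 ke /andP[t0 t1].
rewrite exprMn ler_wpM2l ?sqr_ge0// -exprM.
have [->|tn0] := eqVneq t 0.
  by rewrite expr0n muln_eq0 /= -subn1 subn_eq0 leqNgt k2/= powR_ge0.
have tp : 0 < t by rewrite lt_neqAle eq_sym tn0 t0.
rewrite -!powR_mulrn// -powRrM; apply: ger_powR; first by rewrite tp.
apply: le_trans ke _; rewrite natrM -subn1 natrB; last by case: (k) k2.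
lra.
Qed.

Section upper_bound_interior_dist.
Context {R : realType} {m : nat} {M : topologicalType}.
Variable X : @smooth_manifold R m.+1 M.
Variable g : @tensor R m.+1 M.
Hypothesis riem : riemannian X (interior_mfd X) g.
Implicit Types (c : @chart R m.+1 M) (p q : M) (y z u v w : 'rV[R]_m.+1).

Lemma interior_dist_le_speed (gamma : R -> M) (C : R) :
  piecewise_smooth X gamma -> (forall t : R, 0 <= t <= 1 -> interior_mfd X (gamma t)) ->
  (forall t : R, 0 <= t <= 1 -> speed X g gamma t <= C) ->
  (interior_dist X g (gamma 0%R) (gamma 1%R) <= C%:E)%E.
Proof.
move=> sg ig sC; apply: (@le_trans _ _ (curve_length X g gamma)).
  by apply: ereal_inf_lbound; exists gamma => //; split => // t; rewrite in_itv; exact: ig.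
apply: (@le_trans _ _ (\int[lebesgue_measure]_(t in `[0%R, 1%R]) (cst C%:E) t)%E).
  apply: lower_integral_le => t; rewrite /= in_itv/= => t01; first exact: speed_ge0.
  by rewrite lee_fin sC.
by rewrite integral_cst//= lebesgue_measure_itv/= lte_fin ltr01 oppr0 adde0 mule1.
Qed.

Section segment.
Variables (c : @chart R m.+1 M) (p : M) (e r a b : R).
Hypothesis lm : local_model X g e c p r a b.
Hypothesis e0 : 0 <= e.
Variables (u w : 'rV[R]_m.+1) (s k : R) (q : {poly R}).
Hypotheses (ur : `|c p - u| < r) (wr : `|c p - w| < r).
Hypotheses (u0 : 0 < u 0 ord0) (s0 : 0 < s) (ws : s <= w 0 ord0).
Hypothesis uw : `|w - u| <= 2 * s.
Hypothesis q01 : forall t : R, 0 <= t <= 1 -> 0 <= q.[t] <= 1.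
Hypothesis q' : forall t : R, 0 <= t <= 1 -> q^`().[t] ^+ 2 <= k ^+ 2 * q.[t] `^ e.

Let l (t : R) : 'rV[R]_m.+1 := u + q.[t] *: (w - u).
Let gamma (t : R) : M := cinv c (l t).

Let lE (t : R) : l t = (1 - q.[t]) *: u + q.[t] *: w.
Proof. by apply/rowP => i; rewrite /l !mxE; ring. Qed.

Let l_ball (t : R) : 0 <= t <= 1 -> `|c p - l t| < r.
Proof.
move=> /q01/andP[t0 t1].
have -> : c p - l t = (1 - q.[t]) *: (c p - u) + q.[t] *: (c p - w).
  by rewrite lE; apply/rowP => i; rewrite !mxE; ring.
apply: le_lt_trans (ler_normD _ _) _; rewrite !normrZ !ger0_norm ?subr_ge0//.
have [->|qn0] := eqVneq q.[t] 0; first by rewrite subr0 mul1r mul0r addr0.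
have qp : 0 < q.[t] by rewrite lt_neqAle eq_sym qn0.
have : q.[t] * `|c p - w| < q.[t] * r by rewrite ltr_pM2l.
have : (1 - q.[t]) * `|c p - u| <= (1 - q.[t]) * r by rewrite ler_wpM2l ?subr_ge0// ltW.
lra.
Qed.

Let l_height (t : R) : 0 <= t <= 1 -> 0 < l t 0 ord0 /\ q.[t] * s <= l t 0 ord0.
Proof.
move=> /q01/andP[t0 t1]; rewrite lE !mxE.
have h1 : q.[t] * s <= q.[t] * w 0 ord0 by rewrite ler_wpM2l.
have h2 : 0 <= (1 - q.[t]) * u 0 ord0 by rewrite mulr_ge0 ?subr_ge0// ltW.
split; last by lra.
have [q0|qn0] := eqVneq q.[t] 0; first by rewrite q0 subr0 mul1r mul0r addr0.
have : 0 < q.[t] * s by rewrite mulr_gt0// lt_neqAle eq_sym qn0.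
lra.
Qed.

Let l_image (t : R) : 0 <= t <= 1 -> (c @` cdom c) (l t).
Proof.
by move=> t01; apply: (lm_image lm) (l_ball t01) _; have [/ltW] := l_height t01.
Qed.

Let l_cvg (t : R) : l z @[z --> t] --> l t.
Proof.
apply: cvgD; first exact: cvg_cst.
by apply: cvgZ; [exact: continuous_horner|exact: cvg_cst].
Qed.

Let near_l (t : R) : 0 <= t <= 1 ->
  \forall z \near t, (c @` cdom c) (l z) /\ 0 < (l z : 'rV[R]_m.+1) 0 ord0.
Proof.
move=> t01; have [h _] := l_height t01; have [cy cyE] := cinvP (lm_atlas lm) (l_image t01).
have := near_chart_image_pos (lm_atlas lm) cy; rewrite cyE => /(_ h); exact: l_cvg.
Qed.

Let gamma_continuous (t : R) : 0 <= t <= 1 -> {for t, continuous gamma}.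
Proof.
move=> t01; have [h _] := l_height t01.
have := cinv_continuous_pos (lm_atlas lm) (l_image t01) h.
exact: (@continuous_comp _ _ _ l (cinv c) t (@l_cvg t)).
Qed.

Let gamma_interior (t : R) : 0 <= t <= 1 -> interior_mfd X (gamma t).
Proof.
move=> t01; have [cy cyE] := cinvP (lm_atlas lm) (l_image t01).
by apply: (chart_interior (lm_atlas lm) cy); rewrite cyE; have [] := l_height t01.
Qed.

Let gamma_chart (t : R) : 0 <= t <= 1 -> \forall z \near t, l z = (c \o gamma) z.
Proof.
move=> /near_l; apply: filterS => z [lz _].
by rewrite /gamma/=; have [_ ->] := cinvP (lm_atlas lm) lz.
Qed.

Let gamma_derive (t : R) : 0 <= t <= 1 ->
  is_derive t 1 (c \o gamma) (q^`().[t] *: (w - u)).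
Proof.
move=> t01; apply: near_eq_is_derive (gamma_chart t01) _.
have := @is_derive_poly_line R _ _ id u (w - u) q t (@derivable_id _ _ _ _).
by rewrite derive_id.
Qed.

Let gamma_smooth : piecewise_smooth X gamma.
Proof.
split.
  by apply: continuous_in_subspaceT => t /set_mem /=; rewrite in_itv; exact: gamma_continuous.
exists [:: 1]; split => //=; first by rewrite ltr01.
move=> [|//] _ /= c' ac' t [/=]; rewrite in_itv/= => t01 c't.
have [cy cyE] := cinvP (lm_atlas lm) (l_image t01).
have [F [U [oU Ut sF FA]]] : exists F, smooth_extension (c @` (cdom c `&` cdom c'))
    (c' \o cinv c) (l t) F.
  by apply: (atlas_smooth (lm_atlas lm) ac'); exists (gamma t).
exists (fun z : R => F (l z)), [set z : R | U (l z)]; split => //.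
- by apply: (@open_comp _ _ l) => // z _; exact: l_cvg.
- exact: smooth_poly_line.
- move=> z Uz [/=]; rewrite in_itv/= => z01 c'z; rewrite FA//.
  have [cz czE] := cinvP (lm_atlas lm) (l_image z01).
  by exists (gamma z).
Qed.

Let gamma_speed (t : R) : 0 <= t <= 1 ->
  speed X g gamma t <= Num.sqrt (4 * b * k ^+ 2) * s `^ (1 - e / 2).
Proof.
move=> t01; have [cy cyE] := cinvP (lm_atlas lm) (l_image t01).
have [dg dE] := gamma_derive t01.
rewrite (@speedE _ _ _ _ _ c)//; first last.
- exact: gamma_continuous.
- exact: gamma_interior.
- exact: (lm_atlas lm).
rewrite derive1E dE.
have [lp lqs] := l_height t01; have /andP[q0 q1] := q01 t01.
have b0 := lm_b lm.
have /andP[_ F] := lm_form lm (q^`().[t] *: (w - u)) (l_ball t01) lp.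
have -> : s `^ (1 - e / 2) = Num.sqrt (s `^ (2 - e)).
  by rewrite -powR12_sqrt ?powR_ge0// -powRrM; congr (_ `^ _); field.
rewrite -sqrtrM; last by rewrite mulr_ge0 ?sqr_ge0// mulr_ge0// ltW.
apply: ler_wsqrtr; apply: le_trans F _.
rewrite normrZ exprMn real_normK ?num_real//.
set L := l t 0 ord0 in lp lqs *.
have Lp : 0 < L `^ e by exact: powR_gt0.
have sp : 0 < s `^ e by exact: powR_gt0.
have h1 : q.[t] `^ e * s `^ e <= L `^ e.
  rewrite -powRM ?(ltW s0)//; apply: ge0_ler_powR => //.
  - by rewrite nnegrE mulr_ge0// ltW.
  - by rewrite nnegrE ltW.
(* Multiplied out instead of divided by the power of [q.[t]], since [q] may vanish at an end of the
   segment. *)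
have h2 : L `^ (- e) * q.[t] `^ e <= s `^ (- e).
  by rewrite !powRN ler_pdivrMl// ler_pdivlMr.
have h3 : `|w - u| ^+ 2 <= 4 * s ^+ 2.
  have -> : 4 * s ^+ 2 = (2 * s) ^+ 2 by ring.
  by apply: lerXn2r uw; rewrite nnegrE// mulr_ge0// ltW.
have -> : s `^ (2 - e) = s `^ (- e) * s ^+ 2.
  rewrite -(powR_mulrn 2 (ltW s0)) -powRD ?(gt_eqF s0) ?implybT//.
  by rewrite addrC.
have h4 := q' t01.
have Lm0 : 0 <= L `^ (- e) by exact: powR_ge0.
have h5 : L `^ (- e) * q^`().[t] ^+ 2 <= k ^+ 2 * s `^ (- e).
  apply: (@le_trans _ _ (L `^ (- e) * (k ^+ 2 * q.[t] `^ e))).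
    by rewrite ler_wpM2l.
  by rewrite mulrCA ler_wpM2l ?sqr_ge0.
have h6 : (L `^ (- e) * q^`().[t] ^+ 2) * `|w - u| ^+ 2 <=
    (k ^+ 2 * s `^ (- e)) * (4 * s ^+ 2).
  by apply: ler_pM h5 h3; [apply: mulr_ge0 => //|]; exact: sqr_ge0.
have -> : b * L `^ (- e) * (q^`().[t] ^+ 2 * `|w - u| ^+ 2) =
  b * ((L `^ (- e) * q^`().[t] ^+ 2) * `|w - u| ^+ 2) by ring.
have -> : 4 * b * k ^+ 2 * (s `^ (- e) * s ^+ 2) =
  b * ((k ^+ 2 * s `^ (- e)) * (4 * s ^+ 2)) by ring.
by rewrite ler_wpM2l// ltW.
Qed.

Lemma interior_dist_segment :
  (interior_dist X g (cinv c (u + q.[0] *: (w - u))) (cinv c (u + q.[1] *: (w - u))) <=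
   (Num.sqrt (4 * b * k ^+ 2) * s `^ (1 - e / 2))%:E)%E.
Proof. exact: (interior_dist_le_speed gamma_smooth gamma_interior gamma_speed). Qed.

End segment.

(* The curve climbs to height at least [s] above the midpoint of [u] and [v]
   and comes back; its profile [t ^+ k] flattens the singularity of the metric
   at the boundary, so that its speed is bounded. *)
Lemma interior_dist_upper (e : R) c p (r a b : R) : 0 <= e < 2 ->
  local_model X g e c p r a b -> exists2 C : R, 0 < C &
  forall u v (s : R), `|c p - u| < r / 8 -> `|c p - v| < r / 8 ->
    0 < u 0 ord0 -> 0 < v 0 ord0 -> 0 < s <= r / 4 -> `|u - v| < s ->
    (interior_dist X g (cinv c u) (cinv c v) <= (C * s `^ (1 - e / 2))%:E)%E.
Proof.
move=> /andP[e0 e2] lm.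
(* [k >= 2 / (2 - e)] is the exponent condition of [profile_pow]; the two successors also give
   [2 <= k]. *)
pose k := (Num.truncn (2 / (2 - e))).+2.
have k2 : (2 <= k)%N by [].
have ke : k%:R * e <= 2 * k%:R - 2.
  have e2' : 0 < 2 - e by rewrite subr_gt0.
  have : 2 / (2 - e) <= k%:R.
    have /andP[_ /ltW h] := @truncn_itv _ (2 / (2 - e)) (divr_ge0 (ler0n _ 2) (ltW e2')).
    by apply: le_trans h _; rewrite ler_nat.
  by rewrite ler_pdivrMr//; lra.
have r0 := lm_r lm.
pose C0 := Num.sqrt (4 * b * k%:R ^+ 2).
have C00 : 0 < C0.
  by rewrite sqrtr_gt0 !mulr_gt0 ?exprn_gt0 ?ltr0n// (lm_b lm).
exists (C0 + C0); first by rewrite addr_gt0.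
move=> u v s ur vr u0 v0 /andP[s0 sr] uvs.
(* The height of [w] is at least [s], and its distance to [u] and to [v] is at most [s / 2 + s]. *)
pose w := 2^-1 *: (u + v) + s *: delta_mx 0 ord0.
have dn : `|delta_mx 0 ord0 : 'rV[R]_m.+1| <= 1.
  by apply: mx_norm_le => // i l; rewrite mxE; case: (_ && _); rewrite ?normr1 ?normr0.
have sdn : `|s *: delta_mx 0 ord0 : 'rV[R]_m.+1| <= s.
  by rewrite normrZ gtr0_norm// ler_piMr// ltW.
have h2 : `|2^-1 : R| = 2^-1 by rewrite ger0_norm.
have wr : `|c p - w| < r.
  have -> : c p - w = 2^-1 *: ((c p - u) + (c p - v)) - s *: delta_mx 0 ord0.
    by apply/rowP => i; rewrite !mxE; field.
  apply: le_lt_trans (ler_normB _ _) _.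
  have := ler_normD (c p - u) (c p - v); rewrite normrZ h2; lra.
have ws : s <= w 0 ord0 by rewrite !mxE/= mulr1 lerDr mulr_ge0 ?addr_ge0// ltW.
have wu (y z : 'rV[R]_m.+1) : `|y - z| < s ->
    `|2^-1 *: (y + z) + s *: delta_mx 0 ord0 - y| <= 2 * s.
  move=> yz.
  have -> : 2^-1 *: (y + z) + s *: delta_mx 0 ord0 - y =
     s *: delta_mx 0 ord0 - 2^-1 *: (y - z).
    by apply/rowP => i; rewrite !mxE; field.
  by apply: le_trans (ler_normB _ _) _; rewrite (normrZ 2^-1) h2; lra.
have ur' : `|c p - u| < r by lra.
have vr' : `|c p - v| < r by lra.
have P01 (t : R) : 0 <= t <= 1 -> 0 <= t ^+ k <= 1.
  by move=> /andP[t0 t1]; rewrite exprn_ge0//= exprn_ile1.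
have D1 : (interior_dist X g (cinv c u) (cinv c w) <= (C0 * s `^ (1 - e / 2))%:E)%E.
  have := @interior_dist_segment c p e r a b lm e0 u w s k%:R 'X^k ur' wr u0 s0 ws (wu _ _ uvs).
  rewrite !hornerXn expr0n expr1n scale0r addr0 scale1r subrKC; apply.
    by move=> t; rewrite hornerXn; exact: P01.
  move=> t t01; rewrite derivXn hornerMn !hornerXn -mulr_natl.
  exact: profile_pow.
(* The reversed profile [(1 - 'X) ^+ k], with [v] as base point, runs the second segment from [w]
   down to [v]. *)
have D2 : (interior_dist X g (cinv c w) (cinv c v) <= (C0 * s `^ (1 - e / 2))%:E)%E.
  have wv : `|w - v| <= 2 * s by rewrite /w [u + v]addrC; apply: wu; rewrite distrC.
  have := @interior_dist_segment c p e r a b lm e0 v w s k%:R ((1 - 'X) ^+ k) vr' wr v0 s0 ws wv.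
  have qE (t : R) : ((1 - 'X) ^+ k).[t] = (1 - t) ^+ k by rewrite horner_exp !hornerE.
  rewrite !qE subr0 subrr expr1n expr0n scale1r scale0r addr0 subrKC; apply.
    move=> t /andP[t0 t1]; rewrite qE; apply: P01.
    by rewrite subr_ge0 t1 lerBlDr lerDl t0.
  move=> t /andP[t0 t1]; rewrite qE deriv_exp derivB derivX derivC sub0r.
  have := @profile_pow _ e k (1 - t) e0 k2 ke.
  rewrite subr_ge0 t1 lerBlDr lerDl t0 => /(_ isT).
  by rewrite mulN1r mulNrn hornerN sqrrN hornerMn horner_exp !hornerE -[_ ^+ _ *+ k]mulr_natl.
apply: le_trans (interior_dist_triangle _ _ _ (cinv c w) _) _.
by rewrite mulrDl EFinD; exact: leeD.
Qed.

End upper_bound_interior_dist.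

(** [F] is known to be continuously differentiable in the open interval only. The fundamental
    theorem is applied on smaller closed intervals, and continuity of [F] at the two ends gives the
    rest. *)
Lemma variation_le_integral (R : realType) (a b K : R) (F h : R -> R) : 0 < K -> a < b ->
  {within `[a, b], continuous F} ->
  (forall t : R, a < t < b -> [/\ derivable F t 1, {for t, continuous (derive1 F)} &
    K * `|derive1 F t| <= h t]) ->
  (forall t, 0 <= h t) ->
  ((K * `|F b - F a|)%:E <= \int[lebesgue_measure]_(t in `[a, b]) (h t)%:E)%E.
Proof.
move=> K0 ab cF H h0.
pose mu := @lebesgue_measure R.
have h0E (t : R) : (0 <= (h t)%:E)%E by rewrite lee_fin.
have inner (a' b' : R) : a < a' -> a' < b' -> b' < b ->
    ((K * `|F b' - F a'|)%:E <= \int[mu]_(t in `[a, b]) (h t)%:E)%E.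
  move=> aa ab' bb.
  have sub (t : R) : a' <= t <= b' -> a < t < b.
    by move=> /andP[at' tb]; rewrite (lt_le_trans aa at') (le_lt_trans tb bb).
  have cf : {within `[a', b'], continuous (derive1 F)}.
    apply: continuous_in_subspaceT => t /set_mem /=; rewrite in_itv/= => /sub tab.
    by have [] := H t tab.
  have cF' (t : R) : a' <= t <= b' -> {for t, continuous F}.
    by move=> /sub /H[dF _ _]; apply/differentiable_continuous/derivable1_diffP.
  have FTC := @continuous_FTC2 R (derive1 F) F a' b' ab' cf.
  have {}FTC : (\int[mu]_(t in `[a', b']) (derive1 F t)%:E = (F b' - F a')%:E)%E.
    rewrite FTC//; split.
    - by move=> t; rewrite in_itv/= => /andP[/ltW h1 /ltW h2]; have [] := H t (sub t _); rewrite ?h1 ?h2.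
    - by apply: cvg_at_right_filter; apply: cF'; rewrite lexx ltW.
    - by apply: cvg_at_left_filter; apply: cF'; rewrite lexx ltW.
  have mf : measurable_fun `[a', b'] (fun t => (derive1 F t)%:E : \bar R).
    apply/measurable_EFinP; apply: subspace_continuous_measurable_fun => //.
  have := @le_abse_integral _ _ _ mu `[a', b'] _ (measurable_itv _) mf.
  rewrite FTC abse_EFin => {}FTC.
  apply: (@le_trans _ _ (K%:E * \int[mu]_(t in `[a', b']) `|(derive1 F t)%:E|)%E).
    by rewrite EFinM; apply: lee_wpmul2l => //; rewrite lee_fin ltW.
  rewrite -(@lower_integralZ _ _ _ mu)//.
  apply: (@le_trans _ _ (\int[mu]_(t in `[a', b']) (h t)%:E)%E).
    apply: lower_integral_le => t /=; rewrite in_itv/= => /sub tab.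
      by rewrite lee_fin mulr_ge0// ltW.
    by have [_ _] := H t tab; rewrite lee_fin.
  apply: lower_integral_subset => //.
  by move=> t /=; rewrite !in_itv/= => /sub/andP[/ltW -> /ltW ->].
move/subspace_continuousP : cF => cF.
set J := (\int[lebesgue_measure]_(t in _) _)%E in inner *.
have [->|JN] := eqVneq J +oo%E; first by rewrite leey.
have J0 : (0 <= J)%E by apply: integral_ge0.
have JE : J = (fine J)%:E by rewrite fineK// ge0_fin_numE// lt_neqAle JN leey.
rewrite JE lee_fin; apply/ler_addgt0Pr => e e0.
(* There is one error at each end, and both are multiplied by [K]. *)
pose d := e / (2 * K).
have d0 : 0 < d by rewrite divr_gt0// mulr_gt0.
have pick (x : R) : a <= x <= b -> exists2 rho : R, 0 < rho &
    forall z, `|x - z| < rho -> a <= z <= b -> `|F x - F z| < d.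
  move=> xab; have /cF : [set` `[a, b]] x by rewrite /= in_itv/=.
  move=> /cvgrPdist_lt/(_ _ d0)/near_normP[rho rho0 rhoP]; by exists rho.
have [|r1 r10 h1] := pick a; first by rewrite lexx ltW.
have [|r2 r20 h2] := pick b; first by rewrite lexx ltW.
(* The thirds of the interval keep [a' < b']. *)
pose a' := a + Num.min (r1 / 2) ((b - a) / 3).
pose b' := b - Num.min (r2 / 2) ((b - a) / 3).
have [a1 a2 a3] : [/\ a < a', a' - a < r1 & a' <= a + (b - a) / 3].
  rewrite /a' lerD2l ge_min lexx orbT ltrDl lt_min !divr_gt0// ?subr_gt0//; split => //.
  by rewrite addrC addKr; apply: (@le_lt_trans _ _ (r1 / 2)); [rewrite ge_min lexx|lra].
have [b1 b2 b3] : [/\ b' < b, b - b' < r2 & b - (b - a) / 3 <= b'].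
  rewrite /b' lerD2l lerN2 ge_min lexx orbT ltrBlDr ltrDl lt_min !divr_gt0// ?subr_gt0//.
  split => //; rewrite opprB addrC subrK.
  by apply: (@le_lt_trans _ _ (r2 / 2)); [rewrite ge_min lexx|lra].
have := inner a' b' a1 _ b1; rewrite JE lee_fin => /(_ _)/wrap[]; first by lra.
move=> Jab.
have {h1} : `|F a - F a'| < d by apply: h1; [rewrite distrC gtr0_norm ?subr_gt0|apply/andP; split; lra].
have {h2} : `|F b - F b'| < d by apply: h2; [rewrite gtr0_norm ?subr_gt0|apply/andP; split; lra].
move=> hb ha.
have : `|F b - F a| <= `|F b' - F a'| + 2 * d.
  have -> : F b - F a = (F b - F b') + (F b' - F a') - (F a - F a') by ring.
  by apply: le_trans (ler_normB _ _) _; have := ler_normD (F b - F b') (F b' - F a'); lra.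
rewrite -(ler_pM2l K0) => /le_trans; apply; rewrite mulrDr.
have -> : K * (2 * d) = e by rewrite /d; field; rewrite gt_eqF.
by rewrite lerD2r.
Qed.

(** Joins the estimates for consecutive pieces of a curve; the common point [b] is a null set. *)
Lemma integral_cat (R : realType) (h : R -> R) (a b d : R) : (forall t, 0 <= h t) -> a <= b <= d ->
  (\int[lebesgue_measure]_(t in `[a, b]) (h t)%:E +
   \int[lebesgue_measure]_(t in `[b, d]) (h t)%:E <=
   \int[lebesgue_measure]_(t in `[a, d]) (h t)%:E)%E.
Proof.
move=> h0 /andP[ab bd].
have hE (t : R) : (0 <= (h t)%:E)%E by rewrite lee_fin.
have E : `[b, d]%classic = [set b] `|` `]b, d]%classic by rewrite setU1itv// bnd_simp.
rewrite E (@lower_integral_setU _ (measurableTypeR R) R lebesgue_measure)//; last first.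
  by apply/seteqP; split => // t [/= ->]; rewrite in_itv/= ltxx.
rewrite (@lower_integral_null _ (measurableTypeR R) R lebesgue_measure)//; last exact: lebesgue_measure_set1.
rewrite add0e -(@lower_integral_setU _ (measurableTypeR R) R lebesgue_measure)//; last first.
  apply/seteqP; split => // t [/=]; rewrite !in_itv/= => /andP[_ tb] /andP[bt _].
  by move: (le_lt_trans tb bt); rewrite ltxx.
apply: (@lower_integral_subset _ (measurableTypeR R) R lebesgue_measure) => //.
  by apply: measurableU; exact: measurable_itv.
move=> t [/=|/=]; rewrite !in_itv/= => /andP[h1 h2]; apply/andP; split => //.
  exact: le_trans bd.
exact: le_trans ab (ltW h1).
Qed.

Section lower_bound_interior_dist.
Context {R : realType} {m : nat} {M : topologicalType}.
Variable X : @smooth_manifold R m.+1 M.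
Variable g : @tensor R m.+1 M.
Hypothesis riem : riemannian X (interior_mfd X) g.
Implicit Types (c : @chart R m.+1 M) (p q : M) (y z u v w : 'rV[R]_m.+1).

Section chart_curve.
Variables (c : @chart R m.+1 M) (gamma : R -> M) (K T : R).
Hypotheses (ac : atlas X c) (K0 : 0 < K) (T1 : T <= 1).
Hypothesis cg : {within `[0, 1], continuous gamma}.
Hypothesis dg : forall t : R, 0 <= t <= T -> cdom c (gamma t).
Hypothesis ig : forall t : R, 0 <= t <= T -> interior_mfd X (gamma t).
(** Only times before [T] are included: at the exit time the curve may sit on the sphere, outside
    the open ball where the metric is controlled. *)
Hypothesis Kg : forall (t : R) v, 0 <= t < T ->
  K ^+ 2 * `|v| ^+ 2 <= Defs.form (g c (gamma t)) v v.

Let chart_cvg (t : R) : 0 <= t <= T ->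
  c (gamma z) @[z --> within `[0, 1] (nbhs t)] --> c (gamma t).
Proof.
move=> t0T; have /andP[t0 tT] := t0T.
have ct := cmap_continuous ac (dg t0T).
move/subspace_continuousP : cg => /(_ t) H.
apply: (@cvg_comp _ _ _ gamma c _ _ _ _ ct).
by apply: H; rewrite /= in_itv/= t0 (le_trans tT).
Qed.

(** One coordinate at a time suffices for the sup norm, and reduces the length of a curve to the
    variation of a real function. *)
Lemma chart_segment_length (a b : R) (j : 'I_m.+1) : 0 <= a -> a < b -> b <= T ->
  smooth_segment X a b gamma ->
  ((K * `|c (gamma b) 0 j - c (gamma a) 0 j|)%:E <=
   \int[lebesgue_measure]_(t in `[a, b]) (speed X g gamma t)%:E)%E.
Proof.
move=> a0 ab bT sg.
have D (t : R) : a < t < b -> [/\ {for t, continuous gamma}, derivable (c \o gamma) t 1,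
    {for t, continuous (derive1 (c \o gamma))} &
    derive1 (fun t => c (gamma t) 0 j) t = derive1 (c \o gamma) t 0 j].
  move=> tab; have /andP[at' tb] := tab.
  have t0T : 0 <= t <= T by rewrite (le_trans a0 (ltW at')) (le_trans (ltW tb)).
  have ct : {for t, continuous gamma}.
    apply: (within_continuous_interior cg); rewrite (le_lt_trans a0 at').
    exact: lt_le_trans tb (le_trans bT T1).
  have [dc cc] := segment_derivable sg ct tab ac (dg t0T).
  split; [exact: ct|exact: dc|exact: cc|].
  by rewrite !derive1E (derive_mx dc) mxE.
apply: (@variation_le_integral _ a b K (fun t => c (gamma t) 0 j)) => //; first last.
- by move=> t; rewrite -lee_fin; exact: speed_ge0.
- move=> t tab; have /andP[at' tb] := tab; have [ct dc cc E] := D t tab.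
  have t0T : 0 <= t <= T by rewrite (le_trans a0 (ltW at')) (le_trans (ltW tb)).
  split.
  + by have /derivable_mxP := dc; apply.
  + apply: (@near_eq_continuous _ _ _ (fun t => derive1 (c \o gamma) t 0 j)).
      have tab' : \forall z \near t, a < z < b.
        by near=> z; apply/andP; split; near: z; [exact: lt_nbhsr|exact: lt_nbhsl].
      by move: tab'; apply: filterS => z /D[].
    exact: (cvg_comp _ _ cc (@coord_continuous R 1 m.+1 0 j _)).
  + rewrite E (speedE riem ac)//; [|exact: dg|exact: ig].
    set v := derive1 _ _.
    rewrite -[X in X * _ <= _](@ger0_norm _ K) ?(ltW K0)// -sqrtr_sqr.
    apply: (@le_trans _ _ (Num.sqrt (K ^+ 2) * `|v|)).
      by rewrite ler_wpM2l ?sqrtr_ge0//; exact: entry_le_norm.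
    rewrite -[X in _ * X <= _](@ger0_norm _ `|v|)// -(sqrtr_sqr `|v|) -sqrtrM ?sqr_ge0//.
    apply: ler_wsqrtr; apply: Kg; rewrite (le_trans a0 (ltW at'))//.
    exact: lt_le_trans tb bT.
- apply/subspace_continuousP => t /=; rewrite in_itv/= => /andP[at' tb].
  have t0T : 0 <= t <= T by rewrite (le_trans a0 at') (le_trans tb).
  have H : c (gamma z) 0 j @[z --> within `[0, 1] (nbhs t)] --> c (gamma t) 0 j.
    exact: (cvg_comp _ _ (chart_cvg t0T) (@coord_continuous R 1 m.+1 0 j _)).
  move=> A /H HA.
  have {}HA : \forall z \near t, `[0, 1]%classic z -> A (c (gamma z) 0 j) by exact: HA.
  suff : \forall z \near t, `[a, b]%classic z -> A (c (gamma z) 0 j) by [].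
  move: HA; apply: filterS => z h /=; rewrite in_itv/= => /andP[az zb].
  by apply: h; rewrite /= in_itv/= (le_trans a0 az) (le_trans zb (le_trans bT T1)).
Unshelve. all: by end_near.
Qed.

(** Induction over the break points; the piece that contains [T] is cut off there. *)
Lemma chart_path_length (a : R) (s : seq R) (j : 'I_m.+1) : 0 <= a -> a <= T ->
  path <%R a s -> segs (fun x y : R => smooth_segment X x y gamma) a s -> T <= last a s ->
  ((K * `|c (gamma T) 0 j - c (gamma a) 0 j|)%:E <=
   \int[lebesgue_measure]_(t in `[a, T]) (speed X g gamma t)%:E)%E.
Proof.
have sp0 (t : R) : 0 <= speed X g gamma t by rewrite -lee_fin; exact: speed_ge0.
elim: s a => [|b s IH] a a0 aT /=.
  move=> _ _ Ta; have -> : T = a by apply/eqP; rewrite eq_le Ta aT.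
  by rewrite subrr normr0 mulr0; apply: integral_ge0 => t _; exact: speed_ge0.
move=> /andP[ab pb] [sab sb] Tl; have [Tb|bT] := leP T b.
  move: aT; rewrite le_eqVlt => /orP[/eqP <-|aT].
    by rewrite subrr normr0 mulr0; apply: integral_ge0 => t _; exact: speed_ge0.
  apply: chart_segment_length => // c' ac' t [/=]; rewrite in_itv/= => /andP[at' tT] ct.
  have [|F [U [oU Ut sF FA]]] := sab c' ac' t.
    by split => //=; rewrite in_itv/= at' (le_trans tT).
  exists F, U; split => // z Uz [/=]; rewrite in_itv/= => /andP[az zT] cz.
  by apply: FA => //; split => //=; rewrite in_itv/= az (le_trans zT).
have h1 := chart_segment_length j a0 ab (ltW bT) sab.
have h2 := IH b (le_trans a0 (ltW ab)) (ltW bT) pb sb Tl.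
apply: (@le_trans _ _ ((K * `|c (gamma b) 0 j - c (gamma a) 0 j|)%:E +
    (K * `|c (gamma T) 0 j - c (gamma b) 0 j|)%:E)%E).
  rewrite -EFinD lee_fin -mulrDr ler_wpM2l ?(ltW K0)//.
  rewrite [leRHS]addrC; have -> : c (gamma T) 0 j - c (gamma a) 0 j =
    (c (gamma T) 0 j - c (gamma b) 0 j) + (c (gamma b) 0 j - c (gamma a) 0 j) by ring.
  exact: ler_normD.
apply: le_trans (leeD h1 h2) _; apply: integral_cat => //.
by rewrite (ltW ab) (ltW bT).
Qed.

End chart_curve.

(* By compactness of the closed ball in the chart, the curve is still in the
   domain of the chart at the first time [T] at which it leaves the open ball. *)
Lemma exit_length c u (K r : R) (gamma : R -> M) : atlas X c -> 0 < K -> 0 < r ->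
  (forall y, `|u - y| <= r -> 0 <= y 0 ord0 -> (c @` cdom c) y) ->
  (forall y v, `|u - y| < r -> 0 < y 0 ord0 ->
    K ^+ 2 * `|v| ^+ 2 <= Defs.form (g c (cinv c y)) v v) ->
  0 < u 0 ord0 -> piecewise_smooth X gamma -> gamma 0 = cinv c u ->
  (forall t, t \in `[0, 1] -> interior_mfd X (gamma t)) ->
  ~ (cdom c (gamma 1) /\ `|u - c (gamma 1)| < r) ->
  ((K * r)%:E <= curve_length X g gamma)%E.
Proof.
move=> ac K0 r0 ball Kr u0 [cg [s [ps ls sg]]] g0 ig bad1.
pose good t := cdom c (gamma t) /\ `|u - c (gamma t)| < r.
pose B := [set t : R | 0 <= t <= 1 /\ ~ good t].
have B1 : B 1 by split=> //; rewrite ler01 lexx.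
have Binf : has_inf B by split; [exists 1|exists 0 => t [/andP[]]].
pose T := inf B.
have T0 : 0 <= T by apply: lb_le_inf => [|t [/andP[]]//]; exists 1.
have T1 : T <= 1 by apply: ge_inf => //; case: Binf.
have goodT (t : R) : 0 <= t < T -> good t.
  move=> /andP[t0 tT]; apply: contrapT => nt; have : T <= t.
    apply: ge_inf; first by case: Binf.
    by split => //; rewrite t0 (le_trans (ltW tT)).
  by rewrite leNgt tT.
have cgT (t : R) : 0 <= t <= 1 -> gamma z @[z --> within `[0, 1] (nbhs t)] --> gamma t.
  by move=> t01; move/subspace_continuousP : cg; apply; rewrite /= in_itv.
have near_good (t : R) : 0 <= t <= 1 -> good t ->
    \forall z \near t, 0 <= z <= 1 -> good z.
  move=> t01 [ct utr].
  have h1 : \forall p \near gamma t, cdom c p /\ `|u - c p| < r.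
    have := near_cdom ac ct.
    have : \forall p \near gamma t, `|u - c p| < r.
      have h : \forall y \near c (gamma t), `|u - y| < r.
        apply/near_normP; exists (r - `|u - c (gamma t)|); first by rewrite subr_gt0.
        move=> z h; have := ler_distD (c (gamma t)) u z; lra.
      exact: (cmap_continuous ac ct h).
    by apply: filterS2.
  have : \forall z \near t, `[0, 1]%classic z -> good z by exact: (cgT t t01 _ h1).
  by apply: filterS => z h z01; apply: h; rewrite /= in_itv.
have cu : (c @` cdom c) u by apply: ball; [rewrite subrr normr0 ltW|exact: ltW].
have [cy cyE] := cinvP ac cu.
have good0 : good 0 by rewrite /good g0 cyE subrr normr0.
have Tpos : 0 < T.
  have [|d d0 dP] := (near_normP (0 : R) _).1 (near_good 0 _ good0); first by rewrite lexx ler01.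
  apply: lt_le_trans (_ : Num.min d 1 <= T); first by rewrite lt_min d0 ltr01.
  apply: lb_le_inf; first by exists 1.
  move=> t [t01 nt]; rewrite leNgt; apply/negP => td; apply: nt; apply: dP => //.
  move: td t01; rewrite lt_min => /andP[td _] /andP[t0 _].
  by rewrite sub0r normrN ger0_norm.
have T01 : 0 <= T <= 1 by rewrite T0.
pose S := [set y : 'rV[R]_m.+1 | `|u - y| <= r] `&` [set y : 'rV[R]_m.+1 | 0 <= y 0 ord0].
have cS : compact S.
  apply: bounded_closed_compact.
    exists (r + `|u|); split; first exact: num_real.
    move=> x rx y [uy _]; apply: le_trans (ltW rx).
    have := ler_normB u (u - y); rewrite opprB addrC subrK => h; apply: le_trans h _.
    by rewrite addrC lerD2r.
  apply: closedI.
    exact: closed_closed_ball_.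
  apply: (@closed_comp _ _ (fun y : 'rV[R]_m.+1 => y 0 ord0) [set x | 0 <= x]).
    by move=> y _; exact: coord_continuous.
  exact: closed_ge.
(* In a Hausdorff space the compact image of the closed half-ball is closed, so it contains the
   limit [gamma T] of its earlier points. *)
have cK : closed (cinv c @` S).
  apply: compact_closed; first exact: mfd_hausdorff X.
  apply: continuous_compact => //.
  have [_ _ _ h _] := atlas_chart ac.
  by apply: continuous_subspaceW h => y [uy y0]; exact: ball.
have [y [uy y0] yE] : (cinv c @` S) (gamma T).
  apply: cK => D nD.
  have HD : \forall z \near T, `[0, 1]%classic z -> D (gamma z) by exact: (cgT T T01 _ nD).
  have [d d0 dP] := (near_normP T _).1 HD.
  have d'0 : 0 < Num.min d T by rewrite lt_min d0.
  have [d1 d2] : Num.min d T <= d /\ Num.min d T <= T by rewrite !ge_min !lexx orbT.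
  have [t1 t2 t3] : [/\ 0 <= T - Num.min d T / 2, T - Num.min d T / 2 < T &
      `|T - (T - Num.min d T / 2)| < d].
    by split; rewrite ?opprB ?[T + _]addrC ?subrK ?ger0_norm; lra.
  exists (gamma (T - Num.min d T / 2)); split.
    have [ct ut] := goodT (T - Num.min d T / 2) (introT andP (conj t1 t2)).
    exists (c (gamma (T - Num.min d T / 2))); last exact: (cmapK ac ct).
    by split; [exact: ltW|exact: (chart_halfspace ac ct)].
  by apply: dP => //; rewrite /= in_itv/= t1 (le_trans (ltW t2)).
have [dT cT] : cdom c (gamma T) /\ c (gamma T) = y.
  by rewrite -yE; apply: (cinvP ac); exact: ball.
(* Otherwise the curve would stay in the ball for a while after [T], against the choice of [T] as an
   infimum. *)
have Tr : r <= `|u - c (gamma T)|.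
  rewrite leNgt; apply/negP => uT.
  have gT : good T by [].
  have [d d0 dP] := (near_normP T _).1 (near_good T T01 gT).
  have [T1'|T1'] := eqVneq T 1; first by apply: bad1; rewrite -T1'.
  have [t Bt tT] : exists2 t, B t & t < T + d.
    by apply: inf_adherent.
  have Tt : T <= t by apply: ge_inf => //; case: Binf.
  have [t01 nt] := Bt; apply: nt; apply: dP => //.
  rewrite distrC ger0_norm ?subr_ge0//; lra.
have dgT (t : R) : 0 <= t <= T -> cdom c (gamma t).
  move=> /andP[t0]; rewrite le_eqVlt => /orP[/eqP ->//|tT].
  by have [] := goodT t; rewrite ?t0.
have igT (t : R) : 0 <= t <= T -> interior_mfd X (gamma t).
  by move=> /andP[t0 tT]; apply: ig; rewrite in_itv/= t0 (le_trans tT).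
have KgT (t : R) v : 0 <= t < T -> K ^+ 2 * `|v| ^+ 2 <= Defs.form (g c (gamma t)) v v.
  move=> t0T; have [ct ut] := goodT t t0T.
  have it : interior_mfd X (gamma t).
    by apply: igT; case/andP: t0T => -> /ltW.
  have := Kr (c (gamma t)) v ut (interior_chart ac ct it).
  by rewrite (cmapK ac ct).
have sg' : segs (fun x y : R => smooth_segment X x y gamma) 0 s by apply/segsP.
have lT : T <= last 0 s by rewrite ls.
have L j := @chart_path_length c gamma K T ac K0 T1 cg dgT igT KgT 0 s j (lexx 0) T0 ps sg' lT.
have J0 : (0 <= \int[lebesgue_measure]_(t in `[0%R, T]) (speed X g gamma t)%:E)%E.
  by apply: integral_ge0 => t _; exact: speed_ge0.
apply: (@le_trans _ _ (\int[lebesgue_measure]_(t in `[0%R, T]) (speed X g gamma t)%:E)%E); last first.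
  apply: (@lower_integral_subset _ (measurableTypeR R) R lebesgue_measure) => //.
    by move=> t /=; rewrite !in_itv/= => /andP[-> tT]/=; exact: le_trans T1.
  by move=> t _; exact: speed_ge0.
set J := (\int[lebesgue_measure]_(t in _) _)%E in L J0 *.
have [->|JN] := eqVneq J +oo%E; first by rewrite leey.
have JE : J = (fine J)%:E by rewrite fineK// ge0_fin_numE// lt_neqAle JN leey.
rewrite JE lee_fin mulrC -ler_pdivlMr//; apply: le_trans Tr _.
rewrite distrC -[u]cyE -g0; apply: mx_norm_le => [|i j].
  by rewrite divr_ge0 ?(ltW K0)// fine_ge0.
rewrite ord1 !mxE ler_pdivlMr// mulrC -lee_fin -JE; exact: L.
Qed.

Lemma interior_dist_exit c u q (K r : R) : atlas X c -> 0 < K -> 0 < r ->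
  (forall y, `|u - y| <= r -> 0 <= y 0 ord0 -> (c @` cdom c) y) ->
  (forall y v, `|u - y| < r -> 0 < y 0 ord0 ->
    K ^+ 2 * `|v| ^+ 2 <= Defs.form (g c (cinv c y)) v v) ->
  0 < u 0 ord0 -> ~ (cdom c q /\ `|u - c q| < r) ->
  ((K * r)%:E <= interior_dist X g (cinv c u) q)%E.
Proof.
move=> ac K0 r0 ball Kr u0 bad; apply: le_ereal_inf_tmp => _ [gamma [sg g0 g1 ig] <-].
by apply: (exit_length ac K0 r0 ball Kr u0 sg g0 ig); rewrite g1.
Qed.

End lower_bound_interior_dist.

(** * Hausdorff dimension *)

Section hausdorff_theory.
Context {R : realType} (T : Type) (d : T -> T -> \bar R).
Hypothesis d_ge0 : forall x y, (0 <= d x y)%E.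
Local Open Scope ereal_scope.

Lemma diam_ge0 (U : set T) : U !=set0 -> 0 <= diam d U.
Proof. by case=> x Ux; apply: le_trans (d_ge0 x x) (ereal_sup_ubound _); exists (x, x). Qed.

Lemma diam_pow_ge0 (s : R) (U : set T) : 0 <= diam_pow d s U.
Proof. by rewrite /diam_pow; case: asboolP => // _; exact: poweR_ge0. Qed.

Lemma diam_powE (s : R) (U : set T) : U !=set0 -> diam_pow d s U = diam d U `^ s.
Proof. by rewrite /diam_pow; case: asboolP => // -> []. Qed.

Lemma diam_pow_set0 (s : R) : diam_pow d s set0 = 0.
Proof. by rewrite /diam_pow; case: asboolP. Qed.

(** Vanishing of the measure as the existence of covers that are fine and of small total, the form
    in which it passes to countable unions. *)
Definition hausdorff_null (s : R) (A : set T) :=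
  forall delta e : R, (0 < delta)%R -> (0 < e)%R -> exists U : nat -> set T,
    [/\ A `<=` \bigcup_i U i, forall i, diam d (U i) <= delta%:E &
      \sum_(0 <= i <oo) diam_pow d s (U i) <= e%:E].

Lemma hausdorff_premeasure_ge0 s delta A : 0 <= hausdorff_premeasure d s delta A.
Proof.
by apply: le_ereal_inf_tmp => _ [U _ <-]; apply: nneseries_ge0 => i _ _; exact: diam_pow_ge0.
Qed.

Lemma hausdorff_measure_eq0 s A : hausdorff_measure d s A = 0 <-> hausdorff_null s A.
Proof.
split=> [H delta e delta0 e0|H].
  have : hausdorff_premeasure d s delta A < e%:E.
    apply: (@le_lt_trans _ _ 0); last by rewrite lte_fin.
    by rewrite -H; apply: ereal_sup_ubound; exists delta.
  by move=> /ereal_inf_lt[_ [U [AU dU] <-] /ltW US]; exists U.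
apply/eqP; rewrite eq_le; apply/andP; split.
  apply: ub_ereal_sup => _ [delta delta0 <-]; apply/lee_addgt0Pr => e e0.
  rewrite add0e; have [U [AU dU US]] := H delta e delta0 e0.
  by apply: le_trans US; apply: ereal_inf_lbound; exists U.
apply: le_trans (hausdorff_premeasure_ge0 s 1 A) _.
by apply: ereal_sup_ubound; exists 1%R => //=.
Qed.

Lemma hausdorff_null_subset s A B : A `<=` B -> hausdorff_null s B -> hausdorff_null s A.
Proof.
move=> AB nB delta e delta0 e0; have [U [BU dU US]] := nB _ _ delta0 e0.
by exists U; split => //; exact: subset_trans BU.
Qed.

(** The [k]-th set gets the share [e / 2 ^ k.+1], and a bijection of [nat] with [nat * nat] merges
    the covers into one sequence. *)
Lemma hausdorff_null_bigcup s (A : nat -> set T) :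
  (forall k, hausdorff_null s (A k)) -> hausdorff_null s (\bigcup_k A k).
Proof.
move=> nA delta e delta0 e0.
pose P k (V : nat -> set T) := [/\ A k `<=` \bigcup_i V i,
    forall i, diam d (V i) <= delta%:E &
    \sum_(0 <= i <oo) diam_pow d s (V i) <= (e / (2 ^ k.+1)%:R)%:E].
have [G PG] : {G : nat -> nat -> set T & forall k, P k (G k)}.
  apply: (@choice _ _ P) => k; apply: nA => //.
  by rewrite divr_gt0// ltr0n expn_gt0.
have /card_esym/ppcard_eqP[f] := card_nat2.
exists (fun i => G (f i).1 (f i).2); split.
- move=> x [k _ /(let: And3 h _ _ := PG k in h)[i _ Gx]].
  by exists (f^-1%FUN (k, i)) => //=; rewrite invK ?inE.
- by move=> i; have [_ + _] := PG (f i).1; exact.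
have dp0 k : 0 <= diam_pow d s (G (f k).1 (f k).2) by exact: diam_pow_ge0.
rewrite nneseries_esumT//.
rewrite -(@reindex_esum R nat (nat * nat)%type [set: nat] [set: nat * nat] f
   (fun x => diam_pow d s (G x.1 x.2))); last exact: bij.
have -> : [set: nat * nat] = [set: nat] `*`` (fun=> [set: nat]) by apply/seteqP.
rewrite -(@esum_esum R nat nat setT (fun=> setT) (fun i j => diam_pow d s (G i j))); last first.
  by move=> *; exact: diam_pow_ge0.
apply: le_trans (epsilon_trick0 xpredT (ltW e0)).
rewrite [leRHS]nneseries_esumT; last by move=> k; rewrite lee_fin divr_ge0// ltW.
apply: le_esum => k _; rewrite -nneseries_esumT; last by move=> i; exact: diam_pow_ge0.
by have [] := PG k.
Qed.

Lemma hausdorff_null_set0 s : hausdorff_null s set0.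
Proof.
move=> delta e _ e0; exists (fun=> set0); split => //.
  by move=> i; apply: ub_ereal_sup => y [z [z1 _] _]; case: z1.
by rewrite eseries0 ?lee_fin ?ltW// => i _ _; rewrite diam_pow_set0.
Qed.

Lemma hausdorff_null_setU s A B : hausdorff_null s A -> hausdorff_null s B ->
  hausdorff_null s (A `|` B).
Proof.
move=> nA nB.
apply: (@hausdorff_null_subset _ _ (\bigcup_k (if k is 0%N then A else B))).
  by move=> x [Ax|Bx]; [exists 0%N|exists 1%N].
by apply: hausdorff_null_bigcup => -[|k].
Qed.

Lemma hausdorff_dim_le (D : R) A : (0 <= D)%R ->
  (forall s, (D < s)%R -> hausdorff_null s A) -> hausdorff_dim d A <= D%:E.
Proof.
move=> D0 H; apply/lee_addgt0Pr => e e0; apply: ereal_inf_lbound.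
exists (D + e)%R => //; split; first by rewrite addr_ge0// ltW.
by apply/hausdorff_measure_eq0/H; rewrite ltrDl.
Qed.

Lemma hausdorff_dim_ge (D : R) A :
  (forall s, (0 <= s)%R -> hausdorff_null s A -> (D <= s)%R) -> D%:E <= hausdorff_dim d A.
Proof.
move=> H; apply: le_ereal_inf_tmp => _ [s [s0 /hausdorff_measure_eq0 sA] <-].
by rewrite lee_fin H.
Qed.

End hausdorff_theory.

(** Lindelof's argument: the basic open sets in which [A] is null are countably many and cover [A].
    Neighbourhoods are those of the topology of [T], so [d] is not compared with it. *)
Lemma hausdorff_null_local (R : realType) (T : topologicalType) (d : T -> T -> \bar R)
    (s : R) (A : set T) : (forall x y, (0 <= d x y)%E) -> @second_countable T ->
  (forall x, A x -> exists2 U, nbhs x U & hausdorff_null d s (A `&` U)) ->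
  hausdorff_null d s A.
Proof.
move=> d0 [B cB [oB bB]] H.
pose B' := [set U | B U /\ hausdorff_null d s (A `&` U)].
have /countable_injP[f finj] := cB.
pose C k := A `&` [set x | exists2 U, B' U /\ f U = k & U x].
apply: (@hausdorff_null_subset _ _ _ _ _ (\bigcup_k C k)).
  move=> x Ax; have [U xU nU] := H x Ax.
  have [V [BV Vx] VU] := bB x U xU.
  exists (f V) => //; split => //; exists V => //; split => //; split => //.
  by apply: hausdorff_null_subset nU => y [Ay /VU].
apply: hausdorff_null_bigcup => // k.
have [[V [B'V fV]]|noV] := pselect (exists V, B' V /\ f V = k).
  have [BV nV] := B'V; apply: hausdorff_null_subset nV => x [Ax [U [[BU _] fU] Ux]].
  by split => //; have <- : U = V by apply: finj; rewrite ?inE// fU.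
apply: (@hausdorff_null_subset _ _ _ _ _ set0); last exact: hausdorff_null_set0.
move=> x [_ [U [B'U fU] _]].
by apply: noV; exists U.
Qed.

Section upper_bound.
Context {R : realType} (T : Type) (d : T -> T -> \bar R).
Hypothesis d_ge0 : forall x y, (0 <= d x y)%E.

Lemma powR_neg_le (k e : R) : 0 < k -> 0 < e ->
  exists N0 : nat, forall N : nat, (N0 < N)%N -> N%:R `^ (- k) <= e.
Proof.
move=> k0 e0; exists (Num.truncn (e^-1 `^ k^-1)) => N.
rewrite truncn_lt_nat ?powR_ge0// => /ltW HN.
have N0 : 0 < N%:R :> R by apply: lt_le_trans HN; rewrite powR_gt0// invr_gt0.
rewrite powRN invf_ple ?posrE ?powR_gt0//.
have -> : e^-1 = (e^-1 `^ k^-1) `^ k.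
  by rewrite -powRrM mulVf ?gt_eqF// powRr1// invr_ge0 ltW.
by apply: ge0_ler_powR => //; rewrite ?nnegrE ?powR_ge0// ltW.
Qed.

(* The ball is cut into [N ^ m] cells according to the integer parts of rescaled
   coordinates; each has [d]-diameter at most [C * (3 rho / N) `^ sigma]. *)
Lemma hausdorff_null_holder (m : nat) (phi : 'rV[R]_m -> T) (C sigma rho s : R) :
  0 < C -> 0 < sigma -> 0 < rho -> m%:R < sigma * s ->
  (forall y y' h, `|y| < rho -> `|y'| < rho -> 0 < h <= rho -> `|y - y'| < h ->
    (d (phi y) (phi y') <= (C * h `^ sigma)%:E)%E) ->
  hausdorff_null d s (phi @` [set y | `|y| < rho]).
Proof.
move=> C0 sigma0 rho0 ms H delta e delta0 e0.
have s0 : 0 < s by rewrite -(pmulr_rgt0 _ sigma0) (le_lt_trans _ ms).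
pose K := C * (3 * rho) `^ sigma.
have K0 : 0 < K by rewrite mulr_gt0// powR_gt0// mulr_gt0.
have Ks0 : 0 < K `^ s by exact: powR_gt0.
have [N1 hN1] := powR_neg_le sigma0 (divr_gt0 delta0 K0).
have ms' : 0 < sigma * s - m%:R by rewrite subr_gt0.
have [N2 hN2] := powR_neg_le ms' (divr_gt0 e0 Ks0).
(* [N1] makes the cells small, [N2] makes their total small, and 3 makes [3 * rho / N] an admissible
   [h]. *)
pose n := (N1 + N2 + 3)%N; pose N := n.+1.
have N0 : 0 < N%:R :> R by rewrite ltr0n.
have N1N : N%:R `^ (- sigma) <= delta / K by apply: hN1; rewrite /N /n; lia.
have N2N : N%:R `^ (- (sigma * s - m%:R)) <= e / K `^ s by apply: hN2; rewrite /N /n; lia.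
pose D := K * N%:R `^ (- sigma).
have D0 : 0 < D by rewrite mulr_gt0// powR_gt0.
have Ddelta : D <= delta by rewrite /D mulrC -ler_pdivlMr.
pose co (y : 'rV[R]_m) j := (y 0 j + rho) * N%:R / (2 * rho).
pose cell (y : 'rV[R]_m) : {ffun 'I_m -> 'I_N} := [ffun j => inord (Num.truncn (co y j))].
pose U i := phi @` [set y | `|y| < rho /\ enum_rank (cell y) = i :> nat].
have co_bnd y j : `|y| < rho -> 0 <= co y j < N%:R.
  move=> yr; have := le_lt_trans (entry_le_norm y 0 j) yr.
  rewrite ltr_norml => /andP[y1 y2]; apply/andP; split.
    apply: divr_ge0; last by rewrite mulr_ge0// ltW.
    by rewrite mulr_ge0//; lra.
  by rewrite /co ltr_pdivrMr ?mulr_gt0// mulrC ltr_pM2l//; lra.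
have dU i y y' : `|y| < rho -> `|y'| < rho -> enum_rank (cell y) = i :> nat ->
    enum_rank (cell y') = i :> nat -> (d (phi y) (phi y') <= D%:E)%E.
  move=> yr yr' yi yi'.
  have cE : cell y = cell y' by apply/enum_rank_inj/val_inj; rewrite /= yi yi'.
  have -> : D = C * (3 * rho / N%:R) `^ sigma.
    rewrite /D /K [in RHS]powRM ?mulr_ge0 ?invr_ge0 ?(ltW rho0)//.
    by rewrite -[N%:R^-1]powR_inv1 ?ltW// -powRrM mulN1r mulrA.
  have h0 : 0 < 3 * rho / N%:R by rewrite divr_gt0// mulr_gt0.
  apply: H => //.
    rewrite h0/= ler_pdivrMr// mulrC ler_wpM2l// ?ltW//.
    by rewrite ltr_nat /N /n !addnS.
  (* The cells have side [2 * rho / N]; the larger [3 * rho / N] provides the strict inequality in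
     [H]. *)
  apply: (@le_lt_trans _ _ (2 * rho / N%:R)); last first.
    by rewrite ltr_pM2r ?invr_gt0// ltr_pM2r// ltr_nat.
  apply: mx_norm_le => [|k j]; first by rewrite divr_ge0// mulr_ge0// ltW.
  rewrite !mxE ord1.
  have tE : Num.truncn (co y j) = Num.truncn (co y' j).
    have := congr1 (fun f : {ffun 'I_m -> 'I_N} => f j : nat) cE.
    have lt_N z : `|z| < rho -> (Num.truncn (co z j) < N)%N.
      by move=> /(co_bnd z j)/andP[z0 zN]; rewrite truncn_lt_nat.
    by rewrite !ffunE !inordK// lt_N.
  have /andP[a0 _] := co_bnd y j yr; have /andP[b0 _] := co_bnd y' j yr'.
  have /andP[a1 a2] := truncn_itv a0; have /andP[b1 b2] := truncn_itv b0.
  rewrite -tE -natr1 in b1 b2; rewrite -natr1 in a2.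
  have -> : y 0 j - y' 0 j = (co y j - co y' j) * (2 * rho / N%:R).
    by rewrite /co; field; rewrite !gt_eqF.
  have w0 : 0 <= 2 * rho / N%:R by rewrite divr_ge0 ?mulr_ge0 ?(ltW rho0).
  rewrite normrM (ger0_norm w0) ler_piMl//.
  by rewrite ler_norml; apply/andP; split; lra.
have diamU i : (diam d (U i) <= D%:E)%E.
  apply: ub_ereal_sup => _ [[_ _] [/= [y [yr yi] <-] [y' [yr' yi'] <-]] <-] /=.
  exact: dU yr yr' yi yi'.
exists U; split.
- by move=> _ [y yr <-]; exists (enum_rank (cell y)) => //; exists y.
- by move=> i; apply: le_trans (diamU i) _; rewrite lee_fin.
pose c := #|{: {ffun 'I_m -> 'I_N}}|.
have cE : c = (N ^ m)%N by rewrite /c card_ffun !card_ord.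
rewrite (nneseries_split 0 c) => [|k _]; last exact: diam_pow_ge0.
rewrite [X in (_ + X)%E]eseries0 ?adde0; last first.
  move=> i; rewrite add0n => ci _.
  suff -> : U i = set0 by rewrite diam_pow_set0.
  apply/seteqP; split => // t [y [_ yi] _].
  by have := ltn_ord (enum_rank (cell y)); rewrite yi ltnNge ci.
apply: (@le_trans _ _ (\sum_(0 <= i < 0 + c) (D `^ s)%:E)%E).
  apply: lee_sum => i _.
  have [->|/set0P Ui] := eqVneq (U i) set0.
    by rewrite diam_pow_set0 lee_fin powR_ge0.
  rewrite diam_powE// -poweR_EFin; apply: gt0_ler_poweR => //; first exact: ltW.
  - by rewrite in_itv/= leey andbT diam_ge0.
  - by rewrite in_itv/= leey andbT lee_fin ltW.
(* The total is [K ^ s * N ^ (m - sigma * s)], with a negative exponent of [N]. *)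
rewrite sumEFin lee_fin add0n big_const_nat subn0 iter_addr_0 cE.
rewrite /D powRM ?powR_ge0 ?(ltW K0)// -powRrM -[_ *+ _]mulr_natr natrX -powR_mulrn ?(ltW N0)//.
rewrite -mulrA -powRD; last by rewrite (gt_eqF N0) implybT.
rewrite mulrC -ler_pdivlMr//; apply: le_trans N2N.
by rewrite mulNr opprB addrC.
Qed.

End upper_bound.

(** * Lower bounds for the Hausdorff dimension by counting grid points *)

Section lower_bound.
Context {R : realType}.

(** Subtracting the least element maps [S] injectively into the integers from 0 to the integer part
    of [L]. *)
Lemma card_spread (N : nat) (S : {set 'I_N}) (L : R) : 0 <= L ->
  {in S &, forall a b : 'I_N, a%:R - b%:R < L} -> (#|S| <= (Num.truncn L).+1)%N.
Proof.
move=> L0 H; have [->|[a0 a0S]] := set_0Vmem S; first by rewrite cards0.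
case: (@arg_minnP _ a0 (mem S) (fun i : 'I_N => i : nat) a0S) => a aS amin.
rewrite -[leqRHS]card_ord; apply: (@leq_card_in _ _ (fun b : 'I_N => inord (b - a) : 'I_(Num.truncn L).+1)).
move=> b b' bS b'S /(congr1 val) /=.
have bnd (x : 'I_N) : x \in S -> (x - a < (Num.truncn L).+1)%N.
  move=> xS; rewrite ltnS truncn_ge_nat// natrB; last exact: amin.
  exact/ltW/H.
rewrite !inordK ?bnd// => /eqP; rewrite -(eqn_add2r a) !subnK ?amin// => /eqP.
exact: val_inj.
Qed.

(** [F] lies in the product of its coordinate projections, each of bounded spread. *)
Lemma card_ffun_spread (m N : nat) (F : {set {ffun 'I_m -> 'I_N}}) (L : R) : 0 <= L ->
  {in F &, forall f f' : {ffun 'I_m -> 'I_N}, forall j, (f j)%:R - (f' j)%:R < L} ->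
  (#|F| <= (Num.truncn L).+1 ^ m)%N.
Proof.
move=> L0 H; pose S j : {set 'I_N} := [set f j | f : {ffun 'I_m -> 'I_N} in F].
have cS j : (#|S j| <= (Num.truncn L).+1)%N.
  apply: card_spread => // _ _ /imsetP[f fF ->] /imsetP[f' f'F ->].
  exact: H.
have FS : F \subset family (fun j => S j).
  by apply/fintype.subsetP => f fF; apply/familyP => j; exact: imset_f.
apply: leq_trans (subset_leq_card FS) _; rewrite card_family.
apply: (@leq_trans ((Num.truncn L).+1 ^ size (enum 'I_m))%N); last first.
  by rewrite size_enum_ord.
rewrite /image_mem.
elim: (enum 'I_m) => //= j l IH.
by rewrite expnS leq_mul.
Qed.

(* Elementary substitute for the countable subadditivity of the Lebesgue
   measure: compactness reduces to finitely many open sets, and each of them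
   contains few points of a fine grid. *)
Lemma cube_cover_sum (m : nat) (V : nat -> set 'rV[R]_m) (r : nat -> R) (rho : R) :
  0 < rho -> (forall i, 0 < r i) ->
  [set y : 'rV[R]_m | forall j, 0 <= y 0 j <= rho] `<=` \bigcup_i V i ->
  (forall i y y', V i y -> V i y' -> `|y - y'| <= r i) ->
  exists k : nat, (rho / 4) ^+ m <= \sum_(i < k) r i ^+ m.
Proof.
move=> rho0 r0 QV Vr; pose Q := [set y : 'rV[R]_m | forall j, 0 <= y 0 j <= rho].
(* The sets [V i] need not be open; their [r i]-neighbourhoods are, with points at distance less
   than [3 * r i]. *)
pose W i := [set z | exists2 y, V i y & `|y - z| < r i].
have oW i : open (W i).
  rewrite openE => z [y Vy yz]; suff : \forall z' \near z, W i z' by [].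
  apply/near_normP; exists (r i - `|y - z|).
    by rewrite subr_gt0.
  move=> z'; rewrite ltrBrDl => zz'; exists y => //; apply: le_lt_trans zz'.
  by rewrite -[y - z'](subrKA z) ler_normD.
have cQ : compact Q.
  have -> : Q = [set v : 'rV[R]_m | forall i, `[0, rho]%classic (v ord0 i)].
    by apply/seteqP; split => y Qy j; have := Qy j; rewrite /= in_itv.
  exact: (@rV_compact R m (fun=> `[0, rho]%classic) (fun=> @segment_compact R 0 rho)).
have QW : Q `<=` cover [set: nat] W.
  by move=> y /QV[i _ Vy]; exists i => //; exists y; rewrite ?subrr ?normr0.
move: cQ; rewrite compact_cover => /(_ nat setT W (fun i _ => oW i) QW)[D _ DQ].
pose k := (\max_(i <- finmap.enum_fset D) i).+1.
have Dk i : i \in finmap.enum_fset D -> (i < k)%N.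
  by move=> iD; rewrite ltnS (big_rem i iD)/= leq_maxl.
exists k.
(* Since finitely many sets remain, their radii have a positive minimum, and the grid is chosen
   finer than all of them. *)
pose rm := \big[Num.min/rho]_(i < k) r i.
have rm0 : 0 < rm by rewrite /rm; apply: lt_bigmin => //.
have rmr (i : 'I_k) : rm <= r i by exact: bigmin_le.
pose n := Num.truncn (rho / rm); pose N := n.+1.
have N0 : 0 < N%:R :> R by rewrite ltr0n.
have Nr (i : 'I_k) : rho / N%:R <= r i.
  apply: le_trans (rmr i); rewrite ler_pdivrMr// mulrC -ler_pdivrMr//.
  have /andP[_ /ltW] := @truncn_itv _ (rho / rm) (divr_ge0 (ltW rho0) (ltW rm0)).
  exact.
pose pt (f : {ffun 'I_m -> 'I_N}) : 'rV[R]_m := \row_j (rho * (f j)%:R / N%:R).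
have ptQ f : Q (pt f).
  move=> j; rewrite mxE divr_ge0 ?mulr_ge0 ?(ltW rho0)//= ler_pdivrMr//.
  by rewrite ler_wpM2l ?ltW// ltr_nat.
pose F (i : 'I_k) : {set {ffun 'I_m -> 'I_N}} := [set f | `[< W i (pt f) >]]%SET.
have Fcover : [set: {ffun 'I_m -> 'I_N}]%SET \subset (\bigcup_(i < k) F i)%SET.
  apply/fintype.subsetP => f _; have [i iD Wi] := DQ _ (ptQ f).
  have ik := Dk _ iD; apply/finset.bigcupP; exists (Ordinal ik) => //.
  by rewrite inE; apply/asboolP.
pose L (i : 'I_k) := 3 * r i * N%:R / rho.
have L0 (i : 'I_k) : 0 <= L i by rewrite /L divr_ge0 ?mulr_ge0 ?(ltW rho0)// ltW.
have cF (i : 'I_k) : (#|F i|%:R <= (4 * r i * N%:R / rho) ^+ m :> R).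
  have := @card_ffun_spread m N (F i) (L i) (L0 i).
  have H : {in F i &, forall f f' : {ffun 'I_m -> 'I_N}, forall j, (f j)%:R - (f' j)%:R < L i}.
    have Wf (h : {ffun 'I_m -> 'I_N}) : h \in F i -> W i (pt h).
      by rewrite finset.in_set => /asboolP.
    move=> f f' fF f'F j; have [y Vy yf] := Wf _ fF; have [y' Vy' yf'] := Wf _ f'F.
    have d : `|pt f - pt f'| < 3 * r i.
      have -> : pt f - pt f' = (y - y') + ((y' - pt f') - (y - pt f)).
        by apply/rowP => l; rewrite !mxE; ring.
      apply: le_lt_trans (ler_normD _ _) _.
      have h1 := Vr _ _ _ Vy Vy'; have h2 := ler_normB (y' - pt f') (y - pt f).
      lra.
    have := le_lt_trans (entry_le_norm (pt f - pt f') 0 j) d; rewrite !mxE => h.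
    have {}h := le_lt_trans (ler_norm _) h.
    rewrite /L ltr_pdivlMr// -ltr_pdivrMr//; apply: le_lt_trans h.
    by rewrite le_eqVlt; apply/orP; left; apply/eqP; field; rewrite gt_eqF.
  move=> /(_ H) h; apply: le_trans (_ : ((Num.truncn (L i)).+1 ^ m)%:R <= _).
    by rewrite ler_nat.
  rewrite natrX lerXn2r ?nnegrE//.
    by rewrite divr_ge0 ?mulr_ge0 ?(ltW rho0)// ltW.
  rewrite -natr1; have := truncn_le (L i); rewrite L0 => Li.
  (* The point added to the integer part of [3 * r i * N / rho] is thus absorbed, whence the
     constant 4. *)
  have : 1 <= r i * N%:R / rho.
    by rewrite ler_pdivlMr// mul1r -ler_pdivrMr.
  move: Li; rewrite /L -!mulrA; lra.
have : (#|[set: {ffun 'I_m -> 'I_N}]%SET|%:R <= \sum_(i < k) #|F i|%:R :> R).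
  rewrite -natr_sum ler_nat; apply: leq_trans (subset_leq_card Fcover) _.
  elim/big_ind2: _ => [|A a B b hA hB|//]; first by rewrite cards0.
  by apply: leq_trans (leq_card_setU _ _) (leq_add hA hB).
rewrite cardsT card_ffun !card_ord natrX => h.
have {}h : N%:R ^+ m <= \sum_(i < k) (4 * r i * N%:R / rho) ^+ m.
  by apply: le_trans h _; apply: ler_sum => i _; exact: cF.
have E : \sum_(i < k) (4 * r i * N%:R / rho) ^+ m =
    (4 * N%:R / rho) ^+ m * \sum_(i < k) r i ^+ m.
  rewrite mulr_sumr; apply: eq_bigr => i _; rewrite -exprMn; congr (_ ^+ _).
  by field; rewrite gt_eqF.
have p0 : 0 < (4 * N%:R / rho) ^+ m by rewrite exprn_gt0// divr_gt0// mulr_gt0.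
move: h; rewrite E -ler_pdivrMl//.
have -> // : ((4 * N%:R / rho) ^+ m)^-1 * N%:R ^+ m = (rho / 4) ^+ m.
rewrite -exprVn -exprMn; congr (_ ^+ _).
by field; rewrite !gt_eqF.
Qed.

(** Pulled back by [phi], a cover with small sum of [diam ^ t] covers a cube by sets whose diameters
    have a small sum of [m]-th powers if [sigma * t < m], against [cube_cover_sum]. *)
Lemma hausdorff_null_lower (T : Type) (d : T -> T -> \bar R) (m : nat)
    (phi : 'rV[R]_m -> T) (c sigma rho t : R) (A : set T) :
  (forall x y, (0 <= d x y)%E) -> 0 < c -> 0 < sigma -> 0 < rho -> 0 <= t ->
  (forall y, `|y| <= rho -> A (phi y)) ->
  (forall y y', `|y| <= rho -> `|y'| <= rho ->
    ((c * `|y - y'| `^ sigma)%:E <= d (phi y) (phi y'))%E) ->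
  hausdorff_null d t A -> m%:R <= sigma * t.
Proof.
move=> d0 c0 sigma0 rho0 t0 Aphi H nA; rewrite leNgt; apply/negP => tm.
have m0 : (0 < m)%N.
  by rewrite -(ltr0n R); apply: le_lt_trans tm; rewrite mulr_ge0// ltW.
have mR0 : 0 < m%:R :> R by rewrite ltr0n.
(* With this exponent, the [m]-th power of a Euclidean distance is at most [K] times the power [tau]
   of the corresponding [d]. *)
pose tau := m%:R / sigma.
have tau0 : 0 < tau by rewrite divr_gt0.
have ttau : t <= tau by rewrite /tau ler_pdivlMr// mulrC ltW.
pose K := c `^ (- tau).
have K0 : 0 < K by exact: powR_gt0.
(* Chosen so that [(K + 1) * e] is half of [(rho / 4) ^+ m]. *)
pose e := (rho / 4) ^+ m / (2 * (K + 1)).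
have K10 : 0 < 2 * (K + 1) by rewrite mulr_gt0// addr_gt0.
have e0 : 0 < e by rewrite divr_gt0// exprn_gt0// divr_gt0.
(* Diameters at most 1 make the power [tau] smaller than the power [t]. *)
have [U [AU dU SU]] := nA 1 e ltr01 e0.
pose u i := fine (diam_pow d t (U i)).
have dp0 i : (0 <= diam_pow d t (U i))%E by exact: diam_pow_ge0.
have sumU k : (\sum_(0 <= i < k) diam_pow d t (U i) <= e%:E)%E.
  by apply: le_trans SU; apply: nneseries_lim_ge => i _ _.
have ufin i : diam_pow d t (U i) \is a fin_num.
  rewrite ge0_fin_numE//; apply: le_lt_trans (ltry e); apply: le_trans (sumU i.+1).
  by rewrite big_nat_recr//= leeDr// sume_ge0.
have uE i : diam_pow d t (U i) = (u i)%:E by rewrite fineK.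
have u0 i : 0 <= u i by rewrite fine_ge0.
(* The summable second term keeps the radii positive even where the diameter is 0. *)
pose a i := K * u i + e / (2 ^ i.+1)%:R.
have a0 i : 0 < a i.
  by rewrite ltr_wpDl ?mulr_ge0 ?(ltW K0)// divr_gt0// ltr0n expn_gt0.
pose r i := a i `^ m%:R^-1.
have r0 i : 0 < r i by exact: powR_gt0.
have rm i : r i ^+ m = a i.
  by rewrite -powR_mulrn ?(ltW (r0 i))// -powRrM mulVf ?gt_eqF// powRr1// ltW.
pose V i := [set y : 'rV[R]_m | `|y| <= rho /\ U i (phi y)].
have Vr i y y' : V i y -> V i y' -> `|y - y'| <= r i.
  move=> [yr Uy] [yr' Uy'].
  have Ui : U i !=set0 by exists (phi y).
  have dy : (d (phi y) (phi y') <= diam d (U i))%E.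
    by apply: ereal_sup_ubound; exists (phi y, phi y').
  have dfin : diam d (U i) \is a fin_num.
    by rewrite ge0_fin_numE ?diam_ge0//; apply: le_lt_trans (dU i) (ltry 1).
  pose D := fine (diam d (U i)); have DE : diam d (U i) = D%:E by rewrite fineK.
  have D0 : 0 <= D by rewrite fine_ge0// diam_ge0.
  have D1 : D <= 1 by rewrite -lee_fin -DE.
  have uD : u i = D `^ t by rewrite /u diam_powE// fine_poweR.
  have h1 : c * `|y - y'| `^ sigma <= D.
    by rewrite -lee_fin -DE; apply: le_trans (H _ _ yr yr') dy.
  have h2 : `|y - y'| `^ sigma <= c^-1 * D by rewrite ler_pdivlMl.
  have h3 : `|y - y'| ^+ m <= K * D `^ tau.
    have -> : `|y - y'| ^+ m = (`|y - y'| `^ sigma) `^ tau.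
      by rewrite -powRrM /tau mulrCA divff ?gt_eqF// mulr1 powR_mulrn.
    have -> : K * D `^ tau = (c^-1 * D) `^ tau.
      by rewrite powRM ?invr_ge0 ?(ltW c0)// -powR_inv1 ?ltW// -powRrM mulN1r.
    apply: ge0_ler_powR => //; rewrite ?nnegrE ?powR_ge0 ?(ltW tau0)//.
    by rewrite mulr_ge0// invr_ge0 ltW.
  have h4 : D `^ tau <= D `^ t.
    have [->|Dn0] := eqVneq D 0.
      by rewrite powR0 ?gt_eqF// powR_ge0.
    by apply: ger_powR => //; rewrite lt_neqAle eq_sym Dn0 D0.
  have h5 : `|y - y'| ^+ m <= r i ^+ m.
    rewrite rm /a uD; apply: le_trans h3 _; apply: ler_wpDr.
      by rewrite divr_ge0// ltW.
    by rewrite ler_wpM2l ?(ltW K0).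
  by move: h5; rewrite ler_pXn2r// nnegrE// ltW.
have QV : [set y : 'rV[R]_m | forall j, 0 <= y 0 j <= rho] `<=` \bigcup_i V i.
  move=> y yQ; have yr : `|y| <= rho.
    apply: mx_norm_le => [|i j]; first exact: ltW.
    by rewrite ord1; have /andP[h1 h2] := yQ j; rewrite ger0_norm.
  by have [i _ Ui] := AU _ (Aphi _ yr); exists i.
have [k] := cube_cover_sum rho0 r0 QV Vr.
under eq_bigr do rewrite rm.
rewrite big_split/= -mulr_sumr => h.
have s1 : \sum_(i < k) u i <= e.
  rewrite -lee_fin -sumEFin; apply: le_trans (sumU k).
  by rewrite big_mkord; apply: lee_sum => i _; rewrite uE.
have s2 : \sum_(i < k) e / (2 ^ i.+1)%:R <= e.
  rewrite -lee_fin -sumEFin -(big_mkord xpredT (fun i => (e / (2 ^ i.+1)%:R)%:E)).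
  apply: le_trans (epsilon_trick0 xpredT (ltW e0)).
  by apply: nneseries_lim_ge => i _ _; rewrite lee_fin divr_ge0// ltW.
have : (rho / 4) ^+ m <= (K + 1) * e.
  apply: le_trans h _; rewrite mulrDl mul1r; apply: lerD => //.
  by rewrite ler_wpM2l ?(ltW K0).
have -> : (K + 1) * e = (rho / 4) ^+ m / 2.
  rewrite /e; field; rewrite gt_eqF// addr_gt0//.
have : 0 < (rho / 4) ^+ m by rewrite exprn_gt0// divr_gt0.
lra.
Qed.

End lower_bound.

(** * The distance extended to the boundary *)

(** The inequality without subtraction also makes sense at [+oo]: along the filter, [f] is
    eventually [+oo], as for points in different components, or eventually finite and Cauchy. *)
Lemma ereal_cauchy_cvg (R : realType) (T : Type) (F : set_system T) (f : T -> \bar R) :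
  ProperFilter F -> (forall t, (0 <= f t)%E) ->
  (forall e : R, 0 < e -> exists2 N, F N & forall t t', N t -> N t' -> (f t <= f t' + e%:E)%E) ->
  cvg (f t @[t --> F]).
Proof.
move=> FF f0 H; have [N FN HN] := H 1 ltr01.
have [t0 Nt0] := filter_ex FN.
have [ft0|ft0] := eqVneq (f t0) +oo%E.
  apply: (@cvgP _ _ +oo%E); apply: cvg_near_cst.
  apply: filterS FN => t Nt; have := HN t0 t Nt0 Nt; rewrite ft0 leye_eq.
  by case: (f t).
have fin t : N t -> f t \is a fin_num.
  move=> Nt; rewrite ge0_fin_numE//; apply: le_lt_trans (HN t t0 Nt Nt0) _.
  by rewrite lte_add_pinfty ?ltry// lt_neqAle ft0 leey.
have Ffin : \forall t \near F, f t \is a fin_num by apply: filterS FN.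
have : cvg ((fine \o f) t @[t --> F]).
  apply/cauchy_cvgP; apply: cauchy_exP => e e0.
  have [N' FN' HN'] := H (e / 2) (divr_gt0 e0 (ltr0n _ 2)).
  have [t1 [Nt1 N't1]] := filter_ex (filterI FN FN').
  exists (fine (f t1)).
  suff : \forall t \near F, ball (fine (f t1)) e ((fine \o f) t) by [].
  apply: filterS2 FN FN' => t Nt N't.
  rewrite /= /ball/= ltr_norml.
  have := HN' t t1 N't N't1; have := HN' t1 t N't1 N't.
  rewrite -(fineK (fin _ Nt)) -(fineK (fin _ Nt1)) -!EFinD !lee_fin => h1 h2.
  apply/andP; split; lra.
move=> /cvg_ex[l fl]; apply: (@cvgP _ _ l%:E); exact/fine_cvgP.
Qed.

Lemma norm_row_mx0 (R : realType) (m : nat) (y : 'rV[R]_m) :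
  `|row_mx 0 y : 'rV[R]_(1 + m)| = `|y|.
Proof.
apply/eqP; rewrite eq_le; apply/andP; split; apply: mx_norm_le => // i j.
  by rewrite mxE; case: (fintype.split j) => k; [rewrite mxE normr0|exact: entry_le_norm].
by have := entry_le_norm (row_mx 0 y : 'rV[R]_(1 + m)) i (rshift 1 j); rewrite row_mxEr.
Qed.

Section distance.
Context {R : realType} {m : nat} {M : topologicalType}.
Variable X : @smooth_manifold R m.+1 M.
Variable g : @tensor R m.+1 M.
Variable alpha : R.
Hypothesis alpha02 : 0 < alpha < 2.
Hypothesis gg : gas_giant X alpha g.
Implicit Types (c : @chart R m.+1 M) (p q : M) (y z u v w : 'rV[R]_m.+1).

Let riem : riemannian X (interior_mfd X) g. Proof. by have [] := gg. Qed.

Lemma local_model_exists p : exists e c r a b, 0 <= e < 2 /\ local_model X g e c p r a b.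
Proof.
have /andP[a0 a2] := alpha02.
have [bp|ip] := pselect (boundary X p).
  have [c [r [a [b lm]]]] := local_model_boundary a0 gg bp.
  by exists alpha, c, r, a, b; rewrite ltW.
have [c [r [a [b [lm _]]]]] := local_model_interior riem ip.
by exists 0, c, r, a, b; rewrite lexx ltr0n.
Qed.

Lemma near_cmap c p (e : R) : atlas X c -> cdom c p -> 0 < e ->
  \forall q \near p, cdom c q /\ `|c p - c q| < e.
Proof.
move=> ac cp e0; have := near_cdom ac cp.
have h : \forall y \near c p, `|c p - y| < e by apply/near_normP; exists e.
have : \forall q \near p, `|c p - c q| < e by exact: (cmap_continuous ac cp h).
by apply: filterS2.
Qed.

(** This holds at boundary points too, and is the Cauchy property behind the extension of the
    distance. *)
Lemma interior_dist_nbhs p (eps : R) : 0 < eps -> exists2 N, nbhs p N &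
  forall q q', N q -> N q' -> interior_mfd X q -> interior_mfd X q' ->
    (interior_dist X g q q' <= eps%:E)%E.
Proof.
move=> eps0; have [e [c [r [a [b [e02 lm]]]]]] := local_model_exists p.
have [C C0 HC] := interior_dist_upper riem e02 lm.
have s0 : 0 < 1 - e / 2 by have /andP[_] := e02; lra.
have ac := lm_atlas lm; have r0 := lm_r lm.
(* The second argument solves [C * h ^ (1 - e / 2) = eps]. *)
pose h := Num.min (r / 4) ((eps / C) `^ (1 - e / 2)^-1).
have h0 : 0 < h by rewrite lt_min divr_gt0//= powR_gt0// divr_gt0.
have hC : C * h `^ (1 - e / 2) <= eps.
  rewrite -ler_pdivlMl// [C^-1 * _]mulrC.
  apply: (@le_trans _ _ (((eps / C) `^ (1 - e / 2)^-1) `^ (1 - e / 2))).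
    by apply: ge0_ler_powR; rewrite ?nnegrE ?ge_min ?lexx ?orbT ?powR_ge0//; exact: ltW.
  by rewrite -powRrM mulVf ?gt_eqF// powRr1// ltW// divr_gt0.
pose d := Num.min (r / 8) (h / 2).
have d0 : 0 < d by rewrite lt_min !divr_gt0.
exists [set q | cdom c q /\ `|c p - c q| < d]; first exact: near_cmap (lm_dom lm) d0.
move=> q q' [cq pq] [cq' pq'] iq iq'.
move: pq pq'; rewrite !lt_min => /andP[pq1 pq2] /andP[pq1' pq2'].
rewrite -(cmapK ac cq) -(cmapK ac cq'); apply: (@le_trans _ _ (C * h `^ (1 - e / 2))%:E); last first.
  by rewrite lee_fin.
apply: HC => //.
- exact: interior_chart iq.
- exact: interior_chart iq'.
- by rewrite h0 ge_min lexx.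
- have := ler_distD (c p) (c q) (c q'); rewrite (distrC (c q) (c p)); lra.
Qed.

Let F p q := within (interior_mfd X `*` interior_mfd X) (nbhs (p, q)).

(** Density of the interior: every point is a limit of interior points. *)
Let F_proper p q : ProperFilter (F p q).
Proof.
apply: (@Build_ProperFilter_ex _ (F p q)) => D -[[N1 N2] [/= pN1 qN2] ND].
have [u N1u iu] := interior_mfd_dense X pN1; have [v N2v iv] := interior_mfd_dense X qN2.
by exists (u, v); apply: (ND (u, v)).
Qed.

Let F_prod p q N1 N2 (P : M * M -> Prop) : nbhs p N1 -> nbhs q N2 ->
  (forall u v : M, N1 u -> N2 v -> interior_mfd X u -> interior_mfd X v -> P (u, v)) -> F p q P.
Proof.
by move=> pN1 qN2 H; exists (N1, N2) => // -[u v] [/= N1u N2v] [/= iu iv]; exact: H.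
Qed.

Lemma interior_dist_cvg p q :
  cvg ((fun z : M * M => interior_dist X g z.1 z.2) @
    within (interior_mfd X `*` interior_mfd X) (nbhs (p, q))).
Proof.
apply: (@ereal_cauchy_cvg _ _ (F p q) _ (F_proper p q)) => [t|e e0]; first exact: interior_dist_ge0.
have e20 : 0 < e / 2 by rewrite divr_gt0.
have [N1 pN1 H1] := interior_dist_nbhs p e20.
have [N2 pN2 H2] := interior_dist_nbhs q e20.
exists [set z | [/\ N1 z.1, N2 z.2, interior_mfd X z.1 & interior_mfd X z.2]].
  exact: F_prod pN1 pN2 _.
move=> [u v] [u' v'] [/= N1u N2v iu iv] [/= N1u' N2v' iu' iv'].
apply: le_trans (interior_dist_triangle X g u u' v) _.
apply: (@le_trans _ _ ((e / 2)%:E + (interior_dist X g u' v' + (e / 2)%:E))%E).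
  apply: leeD; first exact: H1.
  apply: le_trans (interior_dist_triangle X g u' v' v) _.
  by apply: leeD => //; exact: H2.
by rewrite addeCA -EFinD -splitr.
Qed.

(** Bounds between interior points near [p] and [q] pass to the limit. *)
Lemma dist_le p q N1 N2 x : nbhs p N1 -> nbhs q N2 ->
  (forall u v : M, N1 u -> N2 v -> interior_mfd X u -> interior_mfd X v ->
    (interior_dist X g u v <= x)%E) -> (dist X g p q <= x)%E.
Proof.
move=> pN1 qN2 H; apply: (@lime_le _ (F p q) (F_proper p q)); first exact: interior_dist_cvg.
exact: F_prod pN1 qN2 H.
Qed.

Lemma dist_ge p q N1 N2 x : nbhs p N1 -> nbhs q N2 ->
  (forall u v : M, N1 u -> N2 v -> interior_mfd X u -> interior_mfd X v ->
    (x <= interior_dist X g u v)%E) -> (x <= dist X g p q)%E.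
Proof.
move=> pN1 qN2 H; apply: (@lime_ge _ (F p q) (F_proper p q)); first exact: interior_dist_cvg.
exact: F_prod pN1 qN2 H.
Qed.

Lemma dist_ge0 p q : (0 <= dist X g p q)%E.
Proof.
apply: (@dist_ge p q setT setT); [exact: filterT|exact: filterT|].
by move=> u v _ _ _ _; exact: interior_dist_ge0.
Qed.

Section local_bounds.
Variables (e r a b : R) (c : @chart R m.+1 M) (p : M).
Hypothesis e02 : 0 <= e < 2.
Hypothesis lm : local_model X g e c p r a b.

Let near_cinv y (d : R) : `|c p - y| < r -> 0 <= y 0 ord0 -> 0 < d ->
  \forall q \near cinv c y, cdom c q /\ `|y - c q| < d.
Proof.
move=> py y0 d0; have [cy cyE] := cinvP (lm_atlas lm) (lm_image lm py y0).
by have := near_cmap (lm_atlas lm) cy d0; rewrite cyE.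
Qed.

Lemma dist_upper : exists2 C : R, 0 < C &
  forall y y' (h : R), `|c p - y| < r / 8 -> `|c p - y'| < r / 8 ->
    0 <= y 0 ord0 -> 0 <= y' 0 ord0 -> 0 < h <= r / 4 -> `|y - y'| < h ->
    (dist X g (cinv c y) (cinv c y') <= (C * h `^ (1 - e / 2))%:E)%E.
Proof.
have [C C0 HC] := interior_dist_upper riem e02 lm; exists C => // y y' h py py' y0 y'0 hr yy.
have r0 := lm_r lm; have ac := lm_atlas lm.
(* The margins left by the strict hypotheses, so that they also hold for interior points near [y]
   and [y']. *)
pose d := Num.min (Num.min (r / 8 - `|c p - y|) (r / 8 - `|c p - y'|)) ((h - `|y - y'|) / 2).
have d0 : 0 < d by rewrite !lt_min !subr_gt0 py py' divr_gt0// subr_gt0.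
have /andP[/andP[d1 d2] d3] : (d <= r / 8 - `|c p - y|) && (d <= r / 8 - `|c p - y'|)
    && (d <= (h - `|y - y'|) / 2) by rewrite -!le_min lexx.
have pyr : `|c p - y| < r by lra.
have pyr' : `|c p - y'| < r by lra.
apply: dist_le (near_cinv pyr y0 d0) (near_cinv pyr' y'0 d0) _.
move=> u v [cu yu] [cv yv] iu iv.
rewrite -(cmapK ac cu) -(cmapK ac cv); apply: HC => //.
- have := ler_distD y (c p) (c u); lra.
- have := ler_distD y' (c p) (c v); lra.
- exact: interior_chart iu.
- exact: interior_chart iv.
- have := ler_distD y (c u) (c v); have := ler_distD y' y (c v); rewrite (distrC (c u) y); lra.
Qed.

(** A curve between points near [y] and [y'] leaves a ball of radius [rho / 2]. If [y] has height 0,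
    heights in that ball are at most [rho], which bounds the metric from below; for [e = 0] the
    height does not enter. *)
Lemma dist_lower y y' : `|c p - y| <= r / 8 -> `|c p - y'| <= r / 8 ->
  0 <= y 0 ord0 -> 0 <= y' 0 ord0 -> e = 0 \/ y 0 ord0 = 0 ->
  ((Num.sqrt a / 2 * `|y - y'| `^ (1 - e / 2))%:E <= dist X g (cinv c y) (cinv c y'))%E.
Proof.
move=> py py' y0 y'0 ey; have [e0 e2] := andP e02.
have r0 := lm_r lm; have ac := lm_atlas lm; have a0 := lm_a lm.
set rho := `|y - y'|.
have [rho0|rhon0] := eqVneq rho 0.
  rewrite rho0 powR0 ?mulr0; first exact: dist_ge0.
  by rewrite gt_eqF//; lra.
have rho0 : 0 < rho by rewrite lt_neqAle eq_sym rhon0 /rho/=.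
have rhor : rho <= r / 4.
  have := ler_distD (c p) y y'; rewrite (distrC y (c p)) -/rho; lra.
(* Least speed per unit of chart velocity at heights up to [rho]. *)
pose K := Num.sqrt a * rho `^ (- (e / 2)).
have K0 : 0 < K by rewrite mulr_gt0 ?sqrtr_gt0// powR_gt0.
have K2 : K ^+ 2 = a * rho `^ (- e).
  rewrite exprMn sqr_sqrtr ?(ltW a0)// -powR_mulrn ?powR_ge0// -powRrM.
  by congr (_ * _ `^ _); field.
have KE : Num.sqrt a / 2 * rho `^ (1 - e / 2) = K * (rho / 2).
  rewrite powRD; last by rewrite (gt_eqF rho0) implybT.
  by rewrite powRr1 ?(ltW rho0)// /K; ring.
have d0 : 0 < rho / 4 by rewrite divr_gt0.
have pyr : `|c p - y| < r by lra.
have pyr' : `|c p - y'| < r by lra.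
rewrite KE; apply: dist_ge (near_cinv pyr y0 d0) (near_cinv pyr' y'0 d0) _.
move=> u v [cu yu] [cv yv] iu iv; rewrite -(cmapK ac cu).
have near_p z : `|c u - z| <= rho / 2 -> `|c p - z| < r.
  have := ler_distD y (c p) z; have := ler_distD (c u) y z; lra.
apply: (interior_dist_exit riem ac K0) => //.
- by rewrite divr_gt0.
- by move=> z /near_p; exact: (lm_image lm).
- move=> z w uz z0; have /andP[+ _] := lm_form lm w (near_p z (ltW uz)) z0.
  apply: le_trans; rewrite ler_wpM2r ?exprn_ge0// K2 ler_wpM2l ?(ltW a0)//.
  case: ey => [->|ey0]; first by rewrite oppr0 !powRr0.
  (* [z] is within [rho / 4 + rho / 2] of [y], which has height 0. *)
  have z1 : z 0 ord0 <= rho.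
    have := entry_le_norm (y - z) 0 ord0; rewrite !mxE ey0 sub0r normrN gtr0_norm//.
    have := ler_distD (c u) y z; lra.
  rewrite !powRN lef_pV2 ?posrE ?powR_gt0//.
  by apply: ge0_ler_powR; rewrite ?nnegrE ?(ltW z0) ?(ltW rho0).
- exact: interior_chart iu.
- move=> [_ uv]; have := ler_distD (c u) y y'; have := ler_distD (c v) (c u) y'.
  rewrite (distrC (c v)) -/rho; lra.
Qed.

End local_bounds.
End distance.

(** * Null sets of the boundary and of the interior *)

Section dimension_bounds.
Context {R : realType} {m : nat} {M : topologicalType}.
Variable X : @smooth_manifold R m.+1 M.
Variable g : @tensor R m.+1 M.
Variable alpha : R.
Hypothesis alpha02 : 0 < alpha < 2.
Hypothesis gg : gas_giant X alpha g.

Let sigma := 1 - alpha / 2.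

Let sigma_gt0 : 0 < sigma.
Proof. by have /andP[_] := alpha02; rewrite /sigma; lra. Qed.

Let riem : riemannian X (interior_mfd X) g. Proof. by have [] := gg. Qed.

Lemma boundary_slice (c : @chart R m.+1 M) (p : M) (y : 'rV[R]_m) :
  atlas X c -> cdom c p -> boundary X p ->
  (c p + (row_mx 0 y : 'rV[R]_(1 + m))) 0 ord0 = 0.
Proof.
move=> ac cp bp; rewrite mxE (boundary_chart ac cp bp) add0r.
have -> : ord0 = lshift m (0 : 'I_1) by exact: val_inj.
by apply: (etrans (row_mxEl (0 : 'rV[R]_1) y 0 0)); rewrite mxE.
Qed.

Let slice_dist (v : 'rV[R]_m.+1) (y : 'rV[R]_m) :
  `|v - (v + (row_mx 0 y : 'rV[R]_(1 + m)))| = `|y|.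
Proof. by rewrite opprD addrA subrr add0r normrN norm_row_mx0. Qed.

Let slice_sub (v : 'rV[R]_m.+1) (y y' : 'rV[R]_m) :
  `|(v + (row_mx 0 y : 'rV[R]_(1 + m))) - (v + (row_mx 0 y' : 'rV[R]_(1 + m)))| = `|y - y'|.
Proof.
rewrite opprD addrACA subrr add0r -(norm_row_mx0 (y - y')); congr (Num.norm _).
apply/rowP => j; rewrite -[j]/(j : 'I_(1 + m)) !mxE.
by case: (@fintype.split 1 m j) => k; rewrite !mxE ?subrr.
Qed.

Lemma boundary_null (s : R) : m%:R < sigma * s -> hausdorff_null (dist X g) s (boundary X).
Proof.
move=> ms; have [a0 a2] := andP alpha02.
apply: hausdorff_null_local.
- by move=> x y; exact: (dist_ge0 alpha02 gg).
- exact: mfd_second_countable X.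
move=> p bp; have [c [r [a [b lm]]]] := local_model_boundary a0 gg bp.
have ac := lm_atlas lm; have cp := lm_dom lm; have r0 := lm_r lm.
have r80 : 0 < r / 8 by rewrite divr_gt0.
exists [set q | cdom c q /\ `|c p - c q| < r / 8]; first exact: near_cmap ac cp r80.
have e02 : 0 <= alpha < 2 by rewrite (ltW a0).
have [C C0 HC] := dist_upper alpha02 gg e02 lm.
apply: (@hausdorff_null_subset _ _ _ s _ ((fun y => cinv c (c p + (row_mx 0 y : 'rV[R]_(1 + m)))) @`
    [set y : 'rV[R]_m | `|y| < r / 8])); last first.
  apply: (hausdorff_null_holder (dist_ge0 alpha02 gg) C0 sigma_gt0 r80 ms) => y y' h yr y'r /andP[h0 hr] yy.
  apply: HC; rewrite ?slice_dist ?slice_sub ?(boundary_slice _ ac cp bp)//.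
  by rewrite h0/=; lra.
move=> q [bq [cq pq]].
(* Both points have height 0, so their difference is determined by the remaining [m] coordinates. *)
pose y : 'rV[R]_m := rsubmx (c q - c p : 'rV[R]_(1 + m)).
have yE : (row_mx 0 y : 'rV[R]_(1 + m)) = c q - c p.
  rewrite -[RHS](@hsubmxK _ _ 1 m); congr row_mx.
  apply/rowP => j; rewrite ord1 !mxE.
  have -> : lshift m (0 : 'I_1) = (ord0 : 'I_m.+1) by exact: val_inj.
  by rewrite (boundary_chart ac cq bq) (boundary_chart ac cp bp) subrr.
exists y => /=; first by rewrite -norm_row_mx0 yE distrC.
by rewrite yE addrC subrK (cmapK ac cq).
Qed.

(** A single boundary chart is enough; all points of the slice have height 0, as [dist_lower]
    requires. *)
Lemma boundary_null_lower (t : R) : boundary X !=set0 -> 0 <= t ->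
  hausdorff_null (dist X g) t (boundary X) -> m%:R <= sigma * t.
Proof.
move=> [p bp] t0; have [a0 a2] := andP alpha02.
have [c [r [a [b lm]]]] := local_model_boundary a0 gg bp.
have ac := lm_atlas lm; have cp := lm_dom lm; have r0 := lm_r lm.
have r80 : 0 < r / 8 by rewrite divr_gt0.
have e02 : 0 <= alpha < 2 by rewrite (ltW a0).
have k0 : 0 < Num.sqrt a / 2 by rewrite divr_gt0// sqrtr_gt0 (lm_a lm).
apply: (hausdorff_null_lower (phi := fun y => cinv c (c p + (row_mx 0 y : 'rV[R]_(1 + m))))
  _ k0 sigma_gt0 r80 t0).
- by move=> x y; exact: (dist_ge0 alpha02 gg).
- move=> y yr; have h0 := boundary_slice y ac cp bp.
  have [|cy cyE] := @cinvP _ _ _ X c (c p + (row_mx 0 y : 'rV[R]_(1 + m))) ac.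
    by apply: (lm_image lm); [rewrite slice_dist; lra|rewrite h0].
  by exists c; split => //; rewrite cyE; apply/halfspace_boundaryE.
- move=> y y' yr y'r; rewrite -(slice_sub (c p)).
  apply: (dist_lower alpha02 gg e02 lm); rewrite ?slice_dist ?(boundary_slice _ ac cp bp)//.
  by right.
Qed.

Let ball_height (v z : 'rV[R]_m.+1) (r : R) : 0 < r -> r <= v 0 ord0 -> `|z| <= r / 8 ->
  0 < (v + z) 0 ord0.
Proof.
move=> r0 rv zr; rewrite mxE.
have := le_trans (entry_le_norm z 0 ord0) zr; rewrite ler_norml => /andP[h _]; lra.
Qed.

Let ball_dist (v z : 'rV[R]_m.+1) : `|v - (v + z)| = `|z|.
Proof. by rewrite opprD addrA subrr add0r normrN. Qed.

Let ball_sub (v z z' : 'rV[R]_m.+1) : (v + z) - (v + z') = z - z'.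
Proof. by rewrite opprD addrACA subrr add0r. Qed.

Let lt02 : 0 <= (0 : R) < 2. Proof. by rewrite lexx ltr0n. Qed.

(** In the model with [e = 0] the Hölder exponent is [1 - 0 / 2 = 1]. *)
Lemma interior_null (s : R) : m.+1%:R < s -> hausdorff_null (dist X g) s (interior_mfd X).
Proof.
move=> ms; apply: hausdorff_null_local.
- by move=> x y; exact: (dist_ge0 alpha02 gg).
- exact: mfd_second_countable X.
move=> p ip; have [c [r [a [b [lm rp]]]]] := local_model_interior riem ip.
have ac := lm_atlas lm; have cp := lm_dom lm; have r0 := lm_r lm.
have r80 : 0 < r / 8 by rewrite divr_gt0.
exists [set q | cdom c q /\ `|c p - c q| < r / 8]; first exact: near_cmap ac cp r80.
have [C C0 HC] := dist_upper alpha02 gg lt02 lm.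
apply: (@hausdorff_null_subset _ _ _ s _ ((fun z => cinv c (c p + z)) @`
    [set z : 'rV[R]_m.+1 | `|z| < r / 8])); last first.
  have h10 : 0 < 1 - 0 / 2 :> R by rewrite mul0r subr0.
  apply: (hausdorff_null_holder (dist_ge0 alpha02 gg) C0 h10 r80); first by rewrite mul0r subr0 mul1r.
  move=> y y' h yr y'r /andP[h0 hr] yy.
  apply: HC; rewrite ?ball_dist ?ball_sub// ?(ltW (ball_height r0 rp (ltW _)))//.
  by rewrite h0/=; lra.
move=> q [_ [cq pq]]; exists (c q - c p) => /=; first by rewrite distrC.
by rewrite addrC subrK (cmapK ac cq).
Qed.

Lemma interior_null_lower (t : R) : interior_mfd X !=set0 -> 0 <= t ->
  hausdorff_null (dist X g) t (interior_mfd X) -> m.+1%:R <= t.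
Proof.
move=> [p ip] t0; have [c [r [a [b [lm rp]]]]] := local_model_interior riem ip.
have ac := lm_atlas lm; have cp := lm_dom lm; have r0 := lm_r lm.
have r80 : 0 < r / 8 by rewrite divr_gt0.
have k0 : 0 < Num.sqrt a / 2 by rewrite divr_gt0// sqrtr_gt0 (lm_a lm).
rewrite -[X in _ -> _ <= X]mul1r.
apply: (hausdorff_null_lower (phi := fun z => cinv c (c p + z)) _ k0 ltr01 r80 t0).
- by move=> x y; exact: (dist_ge0 alpha02 gg).
- move=> z zr; have h0 := ball_height r0 rp zr.
  have [|cy cyE] := @cinvP _ _ _ X c (c p + z) ac.
    by apply: (lm_image lm); [rewrite ball_dist; lra|exact: ltW].
  by apply: (chart_interior ac cy); rewrite cyE.
- move=> y y' yr y'r; have := @dist_lower _ _ _ _ _ _ alpha02 gg _ _ _ _ _ _ lt02 lm (c p + y) (c p + y').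
  rewrite !ball_dist ball_sub mul0r subr0; apply => //.
  + exact/ltW/(ball_height r0 rp).
  + exact/ltW/(ball_height r0 rp).
  + by left.
Qed.

End dimension_bounds.

Theorem proposition15 (R : realType) (n : nat) (M : topologicalType)
    (X : @smooth_manifold R n M) (alpha : R) (g : @tensor R n M)
    (compactM : compact [set: M])
    (boundaryM : boundary X !=set0)
    (alpha_bounds : 0 < alpha < 2)
    (gas_giant_g : gas_giant X alpha g) :
  hausdorff_dim (dist X g) (boundary X)
    = (2 / (2 - alpha) * (n%:R - 1))%:E /\
  hausdorff_dim (dist X g) [set: M]
    = (Num.max n%:R (2 / (2 - alpha) * (n%:R - 1)))%:E.
Proof.
(* For [n = 0] no chart has boundary points, against [boundaryM]. *)
case: n X g boundaryM gas_giant_g => [X g [p [c [_ _ [[]]]]]//|m X g bM gg].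
have a2 : 0 < 2 - alpha by have /andP[_] := alpha_bounds; rewrite subr_gt0.
have -> : m.+1%:R - 1 = m%:R :> R by rewrite -natr1 addrK.
set D := 2 / (2 - alpha) * m%:R.
have D0 : 0 <= D by rewrite mulr_ge0// divr_ge0// ltW.
(* [D] is [m / sigma] with [sigma = 1 - alpha / 2], the critical exponent of the null set lemmas. *)
have DE (s : R) : (D < s) = (m%:R < (1 - alpha / 2) * s).
  have -> : D = m%:R / (1 - alpha / 2).
    by rewrite /D; field; rewrite gt_eqF.
  by rewrite ltr_pdivrMr ?[s * _]mulrC//; lra.
have DE' (s : R) : (D <= s) = (m%:R <= (1 - alpha / 2) * s).
  have -> : D = m%:R / (1 - alpha / 2).
    by rewrite /D; field; rewrite gt_eqF.
  by rewrite ler_pdivrMr ?[s * _]mulrC//; lra.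
(* By density the interior meets every neighbourhood of a boundary point. *)
have iM : interior_mfd X !=set0.
  have [p bp] := bM; have [q _ iq] := @interior_mfd_dense _ _ _ X p setT filterT.
  by exists q.
split; apply/eqP; rewrite eq_le; apply/andP; split.
- apply: hausdorff_dim_le => // s; rewrite DE; exact: boundary_null.
- apply: hausdorff_dim_ge => s s0 ns; rewrite DE'; exact: boundary_null_lower gg s bM s0 ns.
- apply: hausdorff_dim_le; first by rewrite le_max D0 orbT.
  move=> s; rewrite gt_max DE => /andP[ns Ds].
  have -> : [set: M] = boundary X `|` interior_mfd X by rewrite setUv.
  by apply: hausdorff_null_setU;
    [exact: (boundary_null alpha_bounds gg)|exact: (interior_null alpha_bounds gg)].
- apply: hausdorff_dim_ge => s s0 ns; rewrite ge_max DE'; apply/andP; split.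
    apply: (interior_null_lower alpha_bounds gg iM s0).
    exact: hausdorff_null_subset ns.
  apply: (boundary_null_lower alpha_bounds gg bM s0).
  exact: hausdorff_null_subset ns.
Qed.
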